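(* Let $p,q\ge2$ be integers, suppose $(\beta,h)\in\Theta$ is regular, and let $\boldsymbol m_*=\boldsymbol x_s$ denote the unique maximizer of $H_{\beta,h}$. Let $\bar\beta,\bar h\in\mathbb R$ and $\boldsymbol X\sim\mathbb P_{\beta+N^{-1/2}\bar\beta,\,h+N^{-1/2}\bar h,\,N}$. Then, as $N\to\infty$, $$N^{1/2}\left(\bar{\boldsymbol X}_N-\boldsymbol m_*\right)\xrightarrow{D}\mathcal N_q\left(\Sigma(\bar\beta p\,\boldsymbol m_*^{p-1}+\bar h\boldsymbol e_1),\,\Sigma\right),$$ where $\boldsymbol x^\ell:=(x_1^\ell,\dots,x_q^\ell)$ for $\boldsymbol x\in\mathbb R^q$, $\boldsymbol e_1=(1,0,\dots,0)$, and, with $\rho:=k''\left(\frac{1+(q-1)s}{q}\right)\big/k''\left(\frac{1-s}{q}\right)$, $\Sigma$ is the $q\times q$ matrix $$\Sigma:=\left(-\frac{q^2}{q-1}f''_{\beta,h}(s)\right)^{-1}\begin{pmatrix}q-1&-1&\cdots&-1\\-1&1+(q-2)\rho&&-\rho\\ \vdots&&\ddots&\\-1&-\rho&&1+(q-2)\rho\end{pmatrix},$$ i.e. in the bracketed matrix the $(1,1)$ entry is $q-1$, the other entries of the first row and first column are $-1$, the remaining diagonal entries are $1+(q-2)\rho$, and all remaining off-diagonal entries are $-\rho$.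
   Context: For real $\beta,h$ and $N\ge1$, $\mathbb P_{\beta,h,N}$ is the probability measure on $\{1,\dots,q\}^N$ with $\mathbb P_{\beta,h,N}(\boldsymbol X)\propto\exp\left(\beta N\sum_{r=1}^q\bar X_{\cdot r}^p+Nh\bar X_{\cdot1}\right)$, where $\bar X_{\cdot r}=N^{-1}\#\{i:X_i=r\}$; $\bar{\boldsymbol X}_N=(\bar X_{\cdot1},\dots,\bar X_{\cdot q})^\top$. $\Theta=(0,\infty)\times[0,\infty)$. On the set $\mathcal P_q$ of probability vectors in $\mathbb R^q$, $H_{\beta,h}(\boldsymbol t)=\beta\sum_r t_r^p+ht_1-\sum_r t_r\log t_r$. For $s\in[0,1]$, $\boldsymbol x_s=\left(\frac{1+(q-1)s}{q},\frac{1-s}{q},\dots,\frac{1-s}{q}\right)$, $f_{\beta,h}(s)=H_{\beta,h}(\boldsymbol x_s)$, and $k(x)=\beta x^p-x\log x$. The unique maximizer of $H_{\beta,h}$, when it is unique, is of the form $\boldsymbol x_s$ with $s\in[0,1)$. The point $(\beta,h)\in\Theta$ is regular if $H_{\beta,h}$ has a unique global maximizer $\boldsymbol m_*$ and the quadratic form $\boldsymbol Q_{\boldsymbol m_*,\beta}(\boldsymbol t)=\sum_{r=1}^q\left(\beta p(p-1)m_{*,r}^{p-2}-\frac1{m_{*,r}}\right)t_r^2$ is negative definite on $\mathcal H_q=\{\boldsymbol t\in\mathbb R^q:\sum_r t_r=0\}$. $\mathcal N_q(\mu,\Sigma)$ denotes the ($q$-dimensional, possibly degenerate) normal law. *)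

(* Defs.v *)
From HB Require Import structures.
From mathcomp Require Import all_boot all_order all_algebra.
From mathcomp Require Import all_classical all_reals all_analysis.

Set Implicit Arguments.
Unset Strict Implicit.
Unset Printing Implicit Defensive.

Import Order.TTheory GRing.Theory Num.Theory.
Import numFieldNormedType.Exports.

Local Open Scope classical_set_scope.
Local Open Scope ring_scope.

(* The colors 1, ..., q are the elements 0, ..., q-1 of 'I_q, so color 1 (the
   one carrying the magnetic field) is the element 0, and a vector t of R^q has
   coordinates t r 0. *)
Definition color1 (q : nat) (q_gt1 : (1 < q)%N) : 'I_q := Ordinal (ltnW q_gt1).

Section Vectors.
Context {R : realType} {q : nat}.
Implicit Types t : 'cV[R]_q.

Definition basis_vec (r : 'I_q) : 'cV[R]_q := \col_i (i == r)%:R.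

Definition vpow t (l : nat) : 'cV[R]_q := map_mx (fun x => x ^+ l) t.

Definition prob_vectors : set 'cV[R]_q :=
  [set t | (forall r, 0 <= t r 0) /\ \sum_r t r 0 = 1].

Definition zero_sum : set 'cV[R]_q := [set t | \sum_r t r 0 = 0].

End Vectors.

Section Potts.
Context {R : realType}.
Variables (p q : nat) (q_gt1 : (1 < q)%N).
Local Notation c1 := (color1 q_gt1).
Implicit Types (beta h s : R) (t m : 'cV[R]_q) (N : nat).

Definition magnetization N (X : {ffun 'I_N -> 'I_q}) : 'cV[R]_q :=
  \col_r (#|[pred i | X i == r]|%:R / N%:R).

Definition potts_weight beta h N (X : {ffun 'I_N -> 'I_q}) : R :=
  expR (beta * N%:R * (\sum_r magnetization X r 0 ^+ p)
        + N%:R * h * magnetization X c1 0).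

Definition potts_pmf beta h N (X : {ffun 'I_N -> 'I_q}) : R :=
  potts_weight beta h X
  / \sum_(Y : {ffun 'I_N -> 'I_q}) potts_weight beta h Y.

Definition potts_expectation beta h N (g : {ffun 'I_N -> 'I_q} -> R) : R :=
  \sum_X potts_pmf beta h X * g X.

(* [ln 0 = 0] in the library, so t log t vanishes at t = 0, as it should. *)
Definition neg_free_energy beta h t : R :=
  beta * (\sum_r t r 0 ^+ p) + h * t c1 0 - \sum_r t r 0 * ln (t r 0).

Definition global_maximizer beta h : set 'cV[R]_q :=
  [set m | prob_vectors m /\ forall t, prob_vectors t ->
             neg_free_energy beta h t <= neg_free_energy beta h m].

Definition unique_maximizer beta h m : Prop :=
  unique (global_maximizer beta h) m.

Definition hessian_form m beta t : R :=
  \sum_r (beta * p%:R * (p%:R - 1) * m r 0 ^+ (p - 2) - (m r 0)^-1)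
         * t r 0 ^+ 2.

Definition regular beta h : Prop :=
  exists m, unique_maximizer beta h m /\
    forall t, zero_sum t -> t != 0 -> hessian_form m beta t < 0.

Definition xvec s : 'cV[R]_q :=
  \col_r (if r == c1 then (1 + (q%:R - 1) * s) / q%:R else (1 - s) / q%:R).

Definition f_potts beta h s : R := neg_free_energy beta h (xvec s).

Definition k_potts beta (x : R) : R := beta * x ^+ p - x * ln x.

Definition rho beta s : R :=
  derive1n 2 (k_potts beta) ((1 + (q%:R - 1) * s) / q%:R)
  / derive1n 2 (k_potts beta) ((1 - s) / q%:R).

(* At s = 0 the two-sided second derivative of [f_potts], whose formula makes
   sense on a neighborhood of 0, agrees with the one-sided one on [0, 1]. *)
Definition potts_cov beta h s : 'M[R]_q :=
  (- (q%:R ^+ 2 / (q%:R - 1) * derive1n 2 (f_potts beta h) s))^-1 *: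
  \matrix_(i, j)
    (if (i == c1) && (j == c1) then q%:R - 1
     else if (i == c1) || (j == c1) then -1
     else if i == j then 1 + (q%:R - 2) * rho beta s
     else - rho beta s).

End Potts.

(* R^q with its Borel sigma-algebra. *)
Definition borel_vec (R : realType) (q : nat) :=
  g_sigma_algebraType (@open 'cV[R]_q).

Section NormalLaw.
Context {R : realType}.

(* [normal_prob m s] takes the standard deviation s, and for s = 0 it is by
   convention a uniform law, so the point mass has to be added by hand. *)
Definition normal_law1 (m v : R) (A : set R) : \bar R :=
  if v == 0 then \d_m A else normal_prob m (Num.sqrt v) A.

(* N_q(mu, Sigma), possibly degenerate: every linear combination u^T Y of the
   coordinates is normal, with mean u^T mu and variance u^T Sigma u >= 0. *)
Definition multivariate_normal q (mu : 'cV[R]_q) (Sigma : 'M[R]_q)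
    (P : probability (borel_vec R q) R) : Prop :=
  Sigma^T = Sigma /\
  forall u : 'cV[R]_q,
    0 <= (u^T *m Sigma *m u) 0 0 /\
    forall A : set R, measurable A ->
      P [set y : 'cV[R]_q | A ((u^T *m y) 0 0)] =
      normal_law1 ((u^T *m mu) 0 0) ((u^T *m Sigma *m u) 0 0) A.

(* Convergence in distribution of random vectors Y_N of R^q to the law P, where
   [E_ N g] is the expectation of g(Y_N). *)
Definition cvg_in_distribution q (E_ : nat -> ('cV[R]_q -> R) -> R)
    (P : probability (borel_vec R q) R) : Prop :=
  forall g : 'cV[R]_q -> R, continuous g -> [bounded g y | y in setT] ->
    (fun N => E_ N g) @ \oo --> \int[P]_y g y.

End NormalLaw.

(* Main.v *)
Require Import Defs.
From HB Require Import structures.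
From mathcomp Require Import all_boot all_order all_algebra.
From mathcomp Require Import all_classical all_reals all_analysis.
From mathcomp Require Import measurable_realfun.
From mathcomp Require Import ring lra.

(** The weight of a word depends only on its vector of counts [nu], so the law of the
    counts is explicit: a multinomial coefficient times an exponential. With
    [t = nu / N], Stirling's formula turns its logarithm, up to a term that depends on
    [N] alone, into
      N (H(t) - H(m)) + sqrt N (bbar sum_r (t_r^p - m_r^p) + hbar (t_1 - m_1))
    plus a remainder ([log_ratio], [count_weightE]). If the fluctuation
    [y = sqrt N (t - m)] converges, this converges too, up to a constant, to
    [Q(y) / 2 + l(y)], where [Q] is the Hessian form at [m] and [l] is the
    linear form given by [bbar p m^(p-1) + hbar e_1]: the first-order term of [H]
    vanishes at the maximizer ([log_ratio_cvg]). Regularity makes [Q] negative definite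
    on zero-sum vectors, and completing the square there centers the Gaussian weight at
    [mu = Sigma l], with [Sigma] the inverse of [- Q] ([completed_square]). Uniqueness of
    the maximizer and regularity together give
    [H(t) - H(m) <= - c |t - m|^2] on the whole simplex ([free_energy_gap]), which bounds
    the weights by a Gaussian uniformly in [N] ([log_ratio_bound]).

    It remains to pass from this local limit to sums over all counts. The counts of all
    colors but the last are summed one after the other, and each inner sum is a
    one-dimensional Riemann sum of mesh [1 / sqrt N], so that dominated convergence on
    the line suffices ([riemann_sum_cvg], [iter_sum_cvg]). For this to produce
    independent normal variables, one needs coordinates on zero-sum vectors which
    diagonalize [Q] and of which the [k]-th one is a translate of the [k]-th count once
    the earlier counts are fixed. Helmert coordinates have both properties, since the
    entries of [Q] are [a] for the first color and [b] for all others
    ([quadratic_form_helmert]). The limit law is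
    thus that of [mu + sum_k x_k v_k] with independent centered normal [x_k]
    ([gaussian_walk]); its projections are normal by convolution ([gaussian_walk_dot]),
    with the variances prescribed by [Sigma] ([helmert_cov_dot]). The normalization is
    the same sum with the test function 1, so every constant cancels in the quotient. *)

Set Implicit Arguments.
Unset Strict Implicit.
Unset Printing Implicit Defensive.
Import Order.TTheory GRing.Theory Num.Theory.
Import numFieldNormedType.Exports.
Local Open Scope classical_set_scope.
Local Open Scope ring_scope.

(** * Normal laws on the line *)

Section normal_density.
Context {R : realType}.
Local Notation mu := (@lebesgue_measure R).

(** The density [normal_pdf] is a Radon-Nikodym derivative up to a null set, and a
    null set does not affect the integral. *)
Lemma ge0_integral_normal_prob (m s : R) (f : measurableTypeR R -> \bar R) :
  measurable_fun setT f -> (forall x, (0 <= f x)%E) ->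
  (\int[normal_prob m s]_x f x = \int[mu]_x (f x * (normal_pdf m s x)%:E))%E.
Proof.
move=> mf f0.
have dom := normal_prob_dominates m s.
rewrite -(Radon_Nikodym_SigmaFinite.change_of_variables dom f0 measurableT mf).
have mpdf : measurable_fun setT (fun x => (normal_pdf m s x)%:E : \bar R).
  by apply/measurable_EFinP; exact: measurable_normal_pdf.
have mRN : measurable_fun setT
    (Radon_Nikodym_SigmaFinite.f (normal_prob m s) mu).
  exact: measurable_int (Radon_Nikodym_SigmaFinite.f_integrable dom).
apply: ae_eq_integral => //; [exact: emeasurable_funM|exact: emeasurable_funM|].
apply: ae_eqe_mul2l.
apply: integral_ae_eq => //.
  exact: Radon_Nikodym_SigmaFinite.f_integrable.
by move=> A _ mA; rewrite -Radon_Nikodym_SigmaFinite.f_integral.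
Qed.

End normal_density.

Section affine_change_of_variables.
Context {R : realType}.
Local Notation mu := (@lebesgue_measure R).

(** Both sides are measures in [A] that agree on half-open intervals, the reflection
    for [c < 0] exchanging the open end and the closed one; uniqueness of Lebesgue
    measure concludes. *)
Lemma lebesgue_measure_affine (m c : R) (A : set R) : c != 0 -> measurable A ->
  mu A = (`|c|%:E * mu ((fun t : R => (m + c * t)%R) @^-1` A))%E.
Proof.
move=> c0 mA.
have mphi : measurable_fun [set: measurableTypeR R]
    ((fun t : R => (m + c * t)%R) : _ -> measurableTypeR R).
  by apply: measurable_funD => //; exact: measurable_funM.
pose nu := mscale (NngNum (normr_ge0 c))
  (measure_function_pushforward__canonical__measure_function_Measure mu mphi).
rewrite (@lebesgue_measure_unique R nu) // => X /ocitvP[->|[[a b] /= ab ->]].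
  by rewrite !measure0.
rewrite lebesgue_measure_itv /= lte_fin ab.
set Y := (X in _ = X); have {Y}-> : Y = (`|c|%:E * mu ((fun t : R => (m + c * t)%R) @^-1` `]a, b]))%E by [].
have [c_lt0|c_gt0|c_eq0] := ltgtP c 0; last by rewrite c_eq0 eqxx in c0.
- have -> : (fun t : R => (m + c * t)%R) @^-1` `]a, b] = `[(b - m) / c, (a - m) / c[%classic.
    apply/seteqP; split=> t /=; rewrite !in_itv /= ler_ndivrMr// ltr_ndivlMr// [t * c]mulrC;
    by move=> /andP[? ?]; apply/andP; split; lra.
  rewrite lebesgue_measure_itv /= lte_fin ltr_nM2r ?invr_lt0// ltrD2r ab.
  by rewrite -!EFinD -EFinM ltr0_norm//; congr EFin; field.
- have -> : (fun t : R => (m + c * t)%R) @^-1` `]a, b] = `](a - m) / c, (b - m) / c]%classic.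
    apply/seteqP; split=> t /=; rewrite !in_itv /= ler_pdivlMr// ltr_pdivrMr// [t * c]mulrC;
    by move=> /andP[? ?]; apply/andP; split; lra.
  rewrite lebesgue_measure_itv /= lte_fin ltr_pM2r ?invr_gt0// ltrD2r ab.
  by rewrite -!EFinD -EFinM gtr0_norm//; congr EFin; field.
Qed.

Lemma ge0_integral_affine (m c : R) (f : R -> \bar R) : c != 0 ->
  measurable_fun setT f -> (forall x, (0 <= f x)%E) ->
  (\int[mu]_x f x = `|c|%:E * \int[mu]_t f (m + c * t)%R)%E.
Proof.
move=> c0 mf f0.
have mphi : measurable_fun [set: measurableTypeR R]
    ((fun t : R => (m + c * t)%R) : _ -> measurableTypeR R).
  by apply: measurable_funD => //; exact: measurable_funM.
pose nu := mscale (NngNum (normr_ge0 c))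
  (measure_function_pushforward__canonical__measure_function_Measure mu mphi).
rewrite (@eq_measure_integral _ _ _ _ nu) => [|A mA _]; last first.
  exact: lebesgue_measure_affine.
rewrite ge0_integral_mscale//=; congr (_ * _)%E.
by rewrite ge0_integral_pushforward.
Qed.

End affine_change_of_variables.

Section normal_affine_convolution.
Context {R : realType}.
Local Notation mu := (@lebesgue_measure R).

Lemma measurable_EFin_normal_pdf (m s : R) :
  measurable_fun setT (fun x : R => (normal_pdf m s x)%:E : \bar R).
Proof. by apply/measurable_EFinP; exact: measurable_normal_pdf. Qed.

Lemma normal_prob_indic (m s : R) (A : set R) : measurable A ->
  (normal_prob m s A = \int[mu]_x (\1_A x * normal_pdf m s x)%:E)%E.
Proof.
move=> mA; rewrite /normal_prob integral_mkcond; apply: eq_integral => x _.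
by rewrite patchE indicE; case: ifP => _; rewrite ?mul1r ?mul0r.
Qed.

Lemma normal_pdf_affine (m0 s m c t : R) : s != 0 -> c != 0 ->
  `|c| * normal_pdf (m + c * m0) (`|c| * s) (m + c * t) = normal_pdf m0 s t.
Proof.
move=> s0 c0; have c0' : `|c| != 0 by rewrite normr_eq0.
rewrite !normal_pdfE ?mulf_neq0// /normal_fun mulrA; congr (_ * expR _).
  rewrite /normal_peak exprMn -mulrA -mulrnAr sqrtrM ?sqr_ge0// sqrtr_sqr normr_id.
  by rewrite invfM mulrA divff// mul1r.
rewrite exprMn real_normK ?num_real//; field.
by rewrite s0 c0.
Qed.

Lemma normal_prob_affine (m0 s m c : R) (A : set R) :
  s != 0 -> c != 0 -> measurable A ->
  normal_prob m0 s ((fun t : R => m + c * t) @^-1` A) =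
  normal_prob (m + c * m0) (`|c| * s) A.
Proof.
move=> s0 c0 mA.
have mphi : measurable_fun [set: measurableTypeR R]
    ((fun t : R => m + c * t) : _ -> measurableTypeR R).
  by apply: measurable_funD => //; exact: measurable_funM.
have mB : measurable ((fun t : R => m + c * t) @^-1` A).
  by rewrite -[X in measurable X]setTI; exact: mphi.
rewrite (normal_prob_indic _ _ mB) (normal_prob_indic _ _ mA) [RHS](ge0_integral_affine m c0).
- rewrite -ge0_integralZl//=.
  + apply: eq_integral => t _; rewrite -EFinM; congr EFin.
    by rewrite -(normal_pdf_affine m0 m t s0 c0) mulrCA.
  + apply/measurable_EFinP; apply: measurable_funM.
      by apply: measurableT_comp mphi; exact: measurable_indic.
    by apply: measurableT_comp mphi; exact: measurable_normal_pdf.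
  + by move=> t _; rewrite lee_fin mulr_ge0 ?normal_pdf_ge0.
- apply/measurable_EFinP; apply: measurable_funM; first exact: measurable_indic.
  exact: measurable_normal_pdf.
- by move=> t; rewrite lee_fin mulr_ge0 ?normal_pdf_ge0.
Qed.


(** Completing the square in [t]: the joint density of [t] and [x] is factored
    through the marginal law of [x] and the conditional law of [t] given [x]. *)
Lemma normal_pdf_mul (m s c sigma x t : R) : s != 0 -> sigma != 0 ->
  let S := Num.sqrt (s ^+ 2 + c ^+ 2 * sigma ^+ 2) in
  normal_pdf (m + c * t) s x * normal_pdf 0 sigma t =
  normal_pdf m S x *
  normal_pdf (c * sigma ^+ 2 * (x - m) / S ^+ 2) (s * sigma / S) t.
Proof.
move=> s0 sig0 S.
have s2 : 0 < s ^+ 2 by rewrite exprn_even_gt0.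
have sig2 : 0 < sigma ^+ 2 by rewrite exprn_even_gt0.
have S2_gt0 : 0 < s ^+ 2 + c ^+ 2 * sigma ^+ 2.
  by rewrite ltr_wpDr// mulr_ge0 ?sqr_ge0.
have S2 : S ^+ 2 = s ^+ 2 + c ^+ 2 * sigma ^+ 2 by rewrite sqr_sqrtr// ltW.
have S0 : S != 0 by rewrite gt_eqF// sqrtr_gt0.
rewrite !normal_pdfE ?mulf_neq0 ?invr_eq0// mulrACA [RHS]mulrACA. congr (_ * _).
  have pi2 : 0 < pi *+ 2 :> R by rewrite pmulrn_lgt0// pi_gt0.
  rewrite /normal_peak -!mulrnAr -!invfM; congr (_^-1).
  have nng (x0 : R) : 0 <= x0 ^+ 2 * (pi *+ 2) by rewrite mulr_ge0 ?sqr_ge0 ?ltW.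
  rewrite -(sqrtrM _ (nng s)) -(sqrtrM _ (nng S)).
  apply: (congr1 Num.sqrt); rewrite exprMn exprVn exprMn.
  by field.
rewrite /normal_fun -!expRD; apply: (congr1 expR); rewrite !exprMn !exprVn S2; field.
by rewrite s0 sig0 exprMn gt_eqF.
Qed.

(** Convolution of two normal laws. After Fubini the inner integral over [t] is that
    of a normal density, by [normal_pdf_mul], hence equal to 1. *)
Lemma integral_normal_prob_shift (m s c sigma : R) (A : set R) :
  s != 0 -> sigma != 0 -> measurable A ->
  (\int[normal_prob 0 sigma]_t normal_prob (m + c * t)%R s A =
   normal_prob m (Num.sqrt (s ^+ 2 + c ^+ 2 * sigma ^+ 2)) A)%E.
Proof.
move=> s0 sig0 mA; set S := Num.sqrt _.
pose F (z : R * R) := (\1_A z.2 * normal_pdf (m + c * z.1) s z.2)%:E : \bar R.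
have F0 z : (0 <= F z)%E by rewrite lee_fin mulr_ge0 ?normal_pdf_ge0.
have mF : measurable_fun setT F.
  apply/measurable_EFinP; apply: measurable_funM.
    by apply: measurableT_comp => //; exact: measurable_indic.
  rewrite (_ : (fun _ => _) = (fun z : R * R => normal_pdf 0 s (z.2 - (m + c * z.1)))).
    apply: measurableT_comp; first exact: measurable_normal_pdf.
    apply: measurable_funB => //; apply: measurable_funD => //.
    exact: measurable_funM.
  apply/funext => z; rewrite !normal_pdfE//; congr (_ * expR _).
  by rewrite subr0.
have FE : (fun t : R => normal_prob (m + c * t) s A) =
          fun t => (\int[mu]_x F (t, x))%E.
  by apply/funext => t; rewrite normal_prob_indic.
rewrite FE ge0_integral_normal_prob; last 2 first.
- exact: measurable_fun_fubini_tonelli_F.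
- by move=> t; apply: integral_ge0.
pose G (z : R * R) := (F z * (normal_pdf 0 sigma z.1)%:E)%E.
transitivity (\int[mu]_t \int[mu]_x G (t, x))%E.
  apply: eq_integral => t _; rewrite /G /= ge0_integralZr//.
    exact: measurableT_comp.
  by rewrite lee_fin normal_pdf_ge0.
rewrite (@sfinite_Fubini _ _ _ _ _ mu mu G); last 2 first.
- by move=> z; rewrite mule_ge0// lee_fin normal_pdf_ge0.
- apply: emeasurable_funM => //.
  exact: measurableT_comp (measurable_EFin_normal_pdf _ _) _.
rewrite normal_prob_indic//; apply: eq_integral => x _.
transitivity (\int[mu]_t ((\1_A x * normal_pdf m S x)%:E *
   (normal_pdf (c * sigma ^+ 2 * (x - m) / S ^+ 2) (s * sigma / S) t)%:E))%E.
  apply: eq_integral => t _; rewrite /G /F /= -!EFinM; congr EFin.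
  by rewrite -[LHS]mulrA -[RHS]mulrA normal_pdf_mul.
rewrite ge0_integralZl//.
- by rewrite integral_normal_pdf mule1.
- exact: measurable_EFin_normal_pdf.
- by move=> t _; rewrite lee_fin normal_pdf_ge0.
- by rewrite lee_fin mulr_ge0 ?normal_pdf_ge0.
Qed.

End normal_affine_convolution.

(** * Borel functions of vectors *)

Section borel_vectors.
Context {R : realType} {q : nat}.

(** Boxes with rational centers and radii [1 / (n + 1)] form a countable base; the
    countability is what makes measurability of the coordinates sufficient for the
    sigma-algebra generated by the open sets. *)
Lemma open_bigcup_rat_box (U : set 'cV[R]_q) : open U ->
  let box (p : 'cV[rat]_q * nat) :=
    [set y : 'cV[R]_q | forall i, `|y i 0 - ratr (p.1 i 0)| < p.2.+1%:R^-1] in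
  U = \bigcup_(p in [set p | box p `<=` U]) box p.
Proof.
move=> oU box; apply/seteqP; split=> [y Uy|y [p + py]]; last exact.
have [e /= e0 yeU] : nbhs_ball y U.
  by apply/nbhs_ballP; move: oU; rewrite openE => /(_ _ Uy).
have [n ne] : exists n, 2 * n.+1%:R^-1 < e.
  exists (Num.truncn (e / 2)^-1).
  have e2 : 0 < e / 2 by rewrite divr_gt0.
  rewrite mulrC -ltr_pdivlMr// -[ltRHS]invrK ltf_pV2 ?posrE ?invr_gt0//.
  exact: truncnS_gt.
have rat_near (x : R) : exists r : rat, `|x - ratr r| < n.+1%:R^-1.
  have xx : x - n.+1%:R^-1 < x + n.+1%:R^-1.
    by rewrite ltrD2l gtrN// invr_gt0.
  have [r] := rat_in_itvoo xx; rewrite in_itv /= => /andP[r1 r2].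
  by exists r; rewrite ltr_norml; apply/andP; move: n.+1%:R^-1 r1 r2 => u r1 r2; split; lra.
have [c cP] := choice rat_near.
exists (\col_i c (y i 0), n) => [z /= zp|i] /=; last by rewrite mxE.
apply: yeU; split=> // i j; rewrite ord1 /ball /=.
have := zp i; have := cP (y i 0); rewrite mxE => h1 h2.
have -> : y i 0 - z i 0 = (y i 0 - ratr (c (y i 0))) - (z i 0 - ratr (c (y i 0))).
  by ring.
apply: le_lt_trans (ler_normB _ _) _.
by move: n.+1%:R^-1 ne h1 h2 => u ne h1 h2; lra.
Qed.

Lemma measurable_fun_borel_vec d (T : measurableType d) (f : T -> borel_vec R q) :
  (forall i, measurable_fun setT (fun t => (f t : 'cV[R]_q) i 0)) ->
  measurable_fun setT f.
Proof.
move=> mf; apply: (@measurability _ _ _ (borel_vec R q) _ _ (@open 'cV[R]_q)) => //.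
move=> _ [U oU <-]; rewrite setTI (open_bigcup_rat_box oU) preimage_bigcup.
rewrite bigcup_mkcond; apply: countable_bigcupT_measurable; first exact: countableP.
move=> p; case: ifP => _; last exact: measurable0.
rewrite [X in measurable X](_ : _ = \bigcap_(i in [set: 'I_q])
    ((fun t => (f t : 'cV[R]_q) i 0 - ratr (p.1 i 0)) @^-1`
       ball (0 : R) p.2.+1%:R^-1)); last first.
  apply/seteqP; split=> t /= h i => [_|]; rewrite /ball /=.
    by rewrite sub0r normrN; exact: h.
  by have := h i I; rewrite /ball /= sub0r normrN.
apply: fin_bigcap_measurable => // i _; rewrite -[X in measurable X]setTI.
by apply: measurable_funB => //; exact: measurable_ball.
Qed.

Lemma continuous_measurable_borel_vec (g : 'cV[R]_q -> R) : continuous g ->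
  measurable_fun setT (g : borel_vec R q -> R).
Proof.
move=> cg; apply: (measurability _ (RGenOpens.measurableE R)).
move=> _ [U [a [b ->]] <-]; rewrite setTI; apply: sub_sigma_algebra.
exact/open_comp.
Qed.

End borel_vectors.

(** * Gaussian walks in R^q *)

Section gaussian_walk.
Context {R : realType} {q : nat}.
Variables (mu0 : 'cV[R]_q) (v : nat -> 'cV[R]_q) (sigma : nat -> R).
Hypothesis sigma_gt0 : forall k, 0 < sigma k.

Definition shift_along (w : 'cV[R]_q) (z : borel_vec R q * measurableTypeR R) : borel_vec R q :=
  (z.1 : 'cV[R]_q) + (z.2 : R) *: w.

Lemma measurable_coord (i : 'I_q) :
  measurable_fun setT (fun y : borel_vec R q => (y : 'cV[R]_q) i 0).
Proof. by apply: continuous_measurable_borel_vec; exact: coord_continuous. Qed.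

Lemma measurable_shift_along w : measurable_fun setT (shift_along w).
Proof.
apply: measurable_fun_borel_vec => i.
rewrite (_ : (fun _ => _) = fun z : borel_vec R q * measurableTypeR R => (z.1 : 'cV[R]_q) i 0 + (z.2 : R) * w i 0).
  apply: measurable_funD; last exact: measurable_funM.
  exact: measurableT_comp (measurable_coord i) measurable_fst.
by apply/funext => z; rewrite !mxE.
Qed.

HB.instance Definition _ w :=
  @isMeasurableFun.Build _ _ _ _ (shift_along w) (measurable_shift_along w).

(** The law of [mu0 + \sum_(k < n) x_k *: v k] for independent centered normal [x_k]
    of standard deviations [sigma k], built one step at a time so that an integral
    against it unfolds into one-dimensional normal integrals. *)
Fixpoint gaussian_walk (n : nat) : probability (borel_vec R q) R :=
  if n is k.+1 then
    distribution (gaussian_walk k \x normal_prob 0 (sigma k))%E (shift_along (v k))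
  else \d_(mu0 : borel_vec R q).

Lemma ge0_integral_gaussian_walkS k (f : borel_vec R q -> \bar R) :
  measurable_fun setT f -> (forall y, (0 <= f y)%E) ->
  (\int[gaussian_walk k.+1]_y f y =
   \int[normal_prob 0 (sigma k)]_t \int[gaussian_walk k]_y
      f (shift_along (v k) (y, t)))%E.
Proof.
move=> mf f0; rewrite ge0_integral_distribution//.
have mfs := measurableT_comp mf (measurable_shift_along (v k)).
by rewrite fubini_tonelli2// => z; exact: f0.
Qed.

Lemma measurable_dot (u : 'cV[R]_q) :
  measurable_fun setT (fun y : borel_vec R q => (u^T *m (y : 'cV[R]_q)) 0 0).
Proof.
rewrite (_ : (fun _ => _) = fun y : borel_vec R q => \sum_i u i 0 * (y : 'cV[R]_q) i 0).
  apply: measurable_sum => i; apply: measurable_funM => //.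
  exact: measurable_coord.
by apply/funext => y; rewrite mxE; apply: eq_bigr => i _; rewrite mxE.
Qed.

(** Each step convolves the law of the projection with a normal law. Since
    [normal_law1] is a point mass at zero variance, a projection that has not moved
    yet and a step orthogonal to [u] are treated apart. *)
Lemma gaussian_walk_dot k (u : 'cV[R]_q) (A : set R) : measurable A ->
  gaussian_walk k [set y : 'cV[R]_q | A ((u^T *m y) 0 0)] =
  normal_law1 ((u^T *m mu0) 0 0)
    (\sum_(j < k) sigma j ^+ 2 * ((u^T *m v j) 0 0) ^+ 2) A.
Proof.
move=> mA; elim: k A mA => [|k IHk] A mA.
  by rewrite big_ord0 /normal_law1 eqxx.
have mB B : measurable B ->
    measurable ([set y : 'cV[R]_q | B ((u^T *m y) 0 0)] : set (borel_vec R q)).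
  by move=> mB; rewrite -[X in measurable X]setTI; exact: measurable_dot.

set c : R := (u^T *m v k) 0 0; set m : R := (u^T *m mu0) 0 0.
pose f (y : borel_vec R q) : \bar R :=
  (\1_([set z : 'cV[R]_q | A ((u^T *m z) 0 0)] : set (borel_vec R q)) y)%:E.
have -> : gaussian_walk k.+1 [set y : 'cV[R]_q | A ((u^T *m y) 0 0)] =
    (\int[gaussian_walk k.+1]_y f y)%E.
  by rewrite /f integral_indic ?setIT//; exact: mB.
rewrite ge0_integral_gaussian_walkS; last 2 first.
- by apply/measurable_EFinP; apply: measurable_indic; exact: mB.
- by move=> y; rewrite lee_fin.
set V := \sum_(j < k) _ in IHk.
have V_ge0 : 0 <= V by apply: sumr_ge0 => j _; rewrite mulr_ge0 ?sqr_ge0.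
have mpre t : measurable ((fun x : R => (x + t * c)%R) @^-1` A).
  rewrite -[X in measurable X]setTI.
  have : measurable_fun setT (fun x : R => (x + t * c)%R) by exact: measurable_funD.
  exact.
transitivity (\int[normal_prob 0 (sigma k)]_t
    normal_law1 m V ((fun x : R => (x + t * c)%R) @^-1` A))%E.
  apply: eq_integral => t _; rewrite -(IHk _ (mpre t)).
  have mBt := mB _ (mpre t).
  transitivity (\int[gaussian_walk k]_y
      (\1_([set z : 'cV[R]_q | ((fun x : R => (x + t * c)%R) @^-1` A) ((u^T *m z) 0 0)]
         : set (borel_vec R q)) y)%:E)%E; last by rewrite integral_indic ?setIT.
  apply: eq_integral => y _; rewrite /f !indicE; congr ((nat_of_bool _)%:R%:E).
  have E : (u^T *m (shift_along (v k) (y, t) : 'cV[R]_q)) 0 0 =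
      (u^T *m (y : 'cV[R]_q)) 0 0 + (t : R) * c.
    by rewrite /shift_along /c /= mulmxDr -scalemxAr !mxE.
  by apply/idP/idP; rewrite !inE /= E.
rewrite big_ord_recr /= -/V /normal_law1 -/c.
have sk0 : sigma k != 0 by rewrite gt_eqF.
have [V0|V_neq0] := eqVneq V 0.
  rewrite V0 add0r.
  have -> : (\int[normal_prob 0 (sigma k)]_t
      (\d_m ((fun x : R => (x + t * c)%R) @^-1` A) : \bar R) =
    \int[normal_prob 0 (sigma k)]_t (\1_((fun t : R => (m + c * t)%R) @^-1` A) t)%:E)%E.
    apply: eq_integral => t _; rewrite diracE indicE; congr ((nat_of_bool _)%:R%:E).
    by apply/idP/idP; rewrite !inE /= mulrC.
  have mpre2 : measurable ((fun t : R => (m + c * t)%R) @^-1` A).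
    rewrite -[X in measurable X]setTI.
    have : measurable_fun setT (fun t : R => (m + c * t)%R).
      by apply: measurable_funD => //; exact: measurable_funM.
    exact.
  rewrite integral_indic// setIT.
  have [c0|c0] := eqVneq c 0.
    rewrite c0 expr0n mulr0 eqxx.
    have [Am|nAm] := pselect (A m).
      have -> : (fun t : R => (m + 0 * t)%R) @^-1` A = setT.
        by apply/seteqP; split=> t //= _; rewrite mul0r addr0.
      by rewrite diracE mem_set//; exact: (probability_setT (normal_prob 0 (sigma k))).
    have -> : (fun t : R => (m + 0 * t)%R) @^-1` A = set0.
      by apply/seteqP; split=> t //=; rewrite mul0r addr0.
    by rewrite diracE memNset//; exact: (measure0 (normal_prob 0 (sigma k))).
  rewrite mulf_eq0 !expf_eq0 /= (negbTE sk0) (negbTE c0).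
  rewrite (normal_prob_affine 0 m sk0 c0 mA) mulr0 addr0; congr (normal_prob _ _ _).
  by rewrite -exprMn sqrtr_sqr normrM (gtr0_norm (sigma_gt0 k)) mulrC.
have V_gt0 : 0 < V by rewrite lt_def V_neq0.
have sV0 : Num.sqrt V != 0 by rewrite gt_eqF// sqrtr_gt0.
have -> : (V + sigma k ^+ 2 * c ^+ 2 == 0) = false.
  by rewrite gt_eqF// ltr_wpDr// mulr_ge0 ?sqr_ge0.
have -> : (fun t : R => normal_prob m (Num.sqrt V) ((fun x : R => (x + t * c)%R) @^-1` A)) =
          (fun t : R => normal_prob (m + c * t) (Num.sqrt V) A).
  apply/funext => t.
  have := normal_prob_affine m (t * c) sV0 (oner_neq0 R) mA.
  rewrite normr1 !mul1r (_ : t * c + m = m + c * t); last by ring.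
  move=> <-; congr (normal_prob m (Num.sqrt V) _).
  by apply/seteqP; split=> x /=; rewrite mul1r [x + _]addrC.
have := integral_normal_prob_shift m c sV0 sk0 mA.
rewrite (sqr_sqrtr V_ge0) [c ^+ 2 * _]mulrC => <-.
by [].
Qed.

End gaussian_walk.

Section bounded_integrands.
Context d {T : measurableType d} {R : realType} (P : probability T R).

Lemma bounded_integrable (f : T -> R) (M : R) : measurable_fun setT f ->
  (forall x, `|f x| <= M) -> P.-integrable setT (EFin \o f).
Proof.
move=> mf fM; apply: measurable_bounded_integrable => //.
  by rewrite [X in (X < _)%E](_ : _ = 1%E) ?ltry//; exact: probability_setT.
exists M; split; first exact: num_real.
by move=> y My x _; exact: le_trans (fM x) (ltW My).
Qed.

Lemma normr_Rintegral_bounded (f : T -> R) (M : R) : measurable_fun setT f ->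
  (forall x, `|f x| <= M) -> `|\int[P]_x f x| <= M.
Proof.
move=> mf fM; apply: le_trans (le_normr_Rintegral measurableT (bounded_integrable mf fM)) _.
have M0 : 0 <= M by apply: le_trans (fM point).
have mnf : measurable_fun setT (fun x => `|f x|) by exact: measurableT_comp.
apply: (@le_trans _ _ (\int[P]_x (fun=> M) x)).
  apply: le_Rintegral => //.
    by apply: (@bounded_integrable _ M) => // x; rewrite normr_id.
  by apply: (@bounded_integrable _ M) => // x; rewrite ger0_norm.
rewrite /= Rintegral_cst// [X in M * fine X](_ : _ = 1%E) ?mulr1//.
exact: probability_setT.
Qed.

End bounded_integrands.

Section normal_average.
Context {R : realType}.

(** Adding the bound [M] makes the integrand nonnegative, which reduces the claim to
    [ge0_integral_normal_prob]. *)
Lemma integral_normal_prob_density (s M : R) (f : R -> R) :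
  measurable_fun setT f -> (forall x, `|f x| <= M) ->
  \int[normal_prob 0 s]_x f x = \int[lebesgue_measure]_x (f x * normal_pdf 0 s x).
Proof.
move=> mf fM.
have fM0 x : 0 <= f x + M by have := fM x; rewrite ler_norml => /andP[]; lra.
have mfM : measurable_fun setT (fun x => f x + M) by exact: measurable_funD.
have ipdf := @integrable_normal_pdf R 0 s.
have ifpdf : lebesgue_measure.-integrable [set: R]
    (EFin \o (fun x => f x * normal_pdf 0 s x)).
  apply: le_integrable (integrableZl measurableT M ipdf) => //.
  - apply/measurable_EFinP; apply: measurable_funM => //.
    exact: measurable_normal_pdf.
  - move=> x _; rewrite /= lee_fin !normrM ler_wpM2r//.
    exact: le_trans (fM x) (ler_norm _).
have H : (\int[normal_prob 0 s]_x (f x + M)%:E =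
    \int[lebesgue_measure]_x ((f x * normal_pdf 0 s x)%:E + M%:E * (normal_pdf 0 s x)%:E))%E.
  rewrite ge0_integral_normal_prob.
  - by apply: eq_integral => x _; rewrite -EFinM mulrDl.
  - exact/measurable_EFinP.
  - by move=> x; rewrite lee_fin.
have i1 : (normal_prob 0 s).-integrable setT (EFin \o f).
  exact: (@bounded_integrable _ _ _ (normal_prob 0 s) f M mf fM).
have i2 : (normal_prob 0 s).-integrable setT (EFin \o cst M).
  exact: (@bounded_integrable _ _ _ (normal_prob 0 s) (cst M) `|M|).
have L : (\int[normal_prob 0 s]_x (f x + M)%:E =
    \int[normal_prob 0 s]_x (f x)%:E + M%:E)%E.
  rewrite (integralD measurableT i1 i2); congr (_ + _)%E.
  rewrite -[RHS]mule1 -[X in (_ = _ * X)%E](probability_setT (normal_prob 0 s)).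
  exact: (integral_cst (normal_prob 0 s) measurableT M%:E).
have L' : (\int[lebesgue_measure]_x
      ((f x * normal_pdf 0 s x)%:E + M%:E * (normal_pdf 0 s x)%:E) =
    \int[lebesgue_measure]_x (f x * normal_pdf 0 s x)%:E + M%:E)%E.
  rewrite (integralD measurableT ifpdf (integrableZl measurableT M ipdf)).
  by rewrite integralZl// integral_normal_pdf mule1.
move: H; rewrite L L' => /(congr1 (fun z => z - M%:E)%E); rewrite !addeK// => H.
by rewrite /Rintegral H.
Qed.

End normal_average.

Section integral_gaussian_walk.
Context {R : realType} {q : nat}.
Variables (mu0 : 'cV[R]_q) (v : nat -> 'cV[R]_q) (sigma : nat -> R).

Definition normal_average k (g : 'cV[R]_q -> R) (y : 'cV[R]_q) : R :=
  \int[normal_prob 0 (sigma k)]_t g (y + t *: v k).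

Definition bounded_measurable (g : 'cV[R]_q -> R) : Prop :=
  measurable_fun setT (g : borel_vec R q -> R) /\ exists M, forall y, `|g y| <= M.

Lemma measurable_section k (g : 'cV[R]_q -> R) (y : 'cV[R]_q) :
  measurable_fun setT (g : borel_vec R q -> R) ->
  measurable_fun setT (fun t : measurableTypeR R => g (y + (t : R) *: v k)).
Proof.
move=> mg; have mp : measurable_fun setT
    (fun t : measurableTypeR R => (y : borel_vec R q, t)).
  by apply/measurable_fun_pairP; split; [exact: measurable_cst|exact: measurable_id].
exact: measurableT_comp (measurableT_comp mg (measurable_shift_along (v k))) mp.
Qed.

Lemma normal_average_bound k (g : 'cV[R]_q -> R) M :
  measurable_fun setT (g : borel_vec R q -> R) ->
  (forall y, `|g y| <= M) -> forall y, `|normal_average k g y| <= M.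
Proof.
move=> mg gM y; apply: normr_Rintegral_bounded => [|t]; last exact: gM.
exact: measurable_section.
Qed.

Lemma Rintegral_gaussian_walkS k (g : 'cV[R]_q -> R) : bounded_measurable g ->
  bounded_measurable (normal_average k g) /\
  \int[gaussian_walk mu0 v sigma k.+1]_y g y =
  \int[gaussian_walk mu0 v sigma k]_y normal_average k g y.
Proof.
move=> [mg [M gM]].
pose P := gaussian_walk mu0 v sigma k; pose Q := normal_prob 0 (sigma k).
pose F z : \bar R := (g (shift_along (v k) z))%:E.
have mgs := measurableT_comp mg (measurable_shift_along (v k)).
have iF : (P \x Q)%E.-integrable setT F.
  apply: (@bounded_integrable _ _ _ (P \x Q)%E (g \o shift_along (v k)) M) => //.
  by move=> z; exact: gM.
have mna : measurable_fun setT (normal_average k g : borel_vec R q -> R).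
  exact: measurableT_comp (measurable_fubini_F iF).
split; first by split=> //; exists M; exact: normal_average_bound.
rewrite /Rintegral [gaussian_walk _ _ _ k.+1]/=; congr fine.
rewrite integral_distribution//; last by apply/measurable_EFinP.
rewrite -[LHS](integral12_prod_meas1 iF); apply: eq_integral => y _.
rewrite /fubini_F /normal_average /Rintegral fineK// /F.
apply: integrable_fin_num => //.
apply: (@bounded_integrable _ _ _ Q (fun t => g (y + t *: v k)) M) => //.
exact: measurable_section.
Qed.

Lemma Rintegral_gaussian_walk0 (g : 'cV[R]_q -> R) : bounded_measurable g ->
  \int[gaussian_walk mu0 v sigma 0]_y g y = g mu0.
Proof.
move=> [mg _]; rewrite /Rintegral /= integral_dirac//; last exact/measurable_EFinP.
by rewrite diracT mul1e.
Qed.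

(** The last [j] of [d] steps are averaged, the innermost integral being over the
    last one; the iterated sums [iter_sum] below follow the same order. *)
Fixpoint iter_average d j (g : 'cV[R]_q -> R) : 'cV[R]_q -> R :=
  if j is i.+1 then normal_average (d - j) (iter_average d i g) else g.

Lemma bounded_measurable_iter_average d j g :
  bounded_measurable g -> bounded_measurable (iter_average d j g).
Proof.
move=> bg; elim: j => //= j IHj.
by have [] := Rintegral_gaussian_walkS (d - j.+1) IHj.
Qed.

Lemma Rintegral_gaussian_walk d g : bounded_measurable g ->
  \int[gaussian_walk mu0 v sigma d]_y g y = iter_average d d g mu0.
Proof.
move=> bg; suff H j : (j <= d)%N ->
    \int[gaussian_walk mu0 v sigma d]_y g y =
    \int[gaussian_walk mu0 v sigma (d - j)]_y iter_average d j g y.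
  rewrite (H d)// subnn Rintegral_gaussian_walk0//.
  exact: bounded_measurable_iter_average.
elim: j => [|j IHj] jd; first by rewrite subn0.
rewrite IHj; last exact: ltnW.
rewrite -subSS subSn//.
by have [] := Rintegral_gaussian_walkS (d - j.+1)
  (bounded_measurable_iter_average d j bg).
Qed.

End integral_gaussian_walk.

(** * Riemann sums of mesh 1 / sqrt N *)

Section limits_of_sums.
Context {K : numFieldType} {T : Type} {F : set_system T} {FF : Filter F}.

Lemma cvg_bigsum {V : normedModType K} (I : Type) (r : seq I) (P : pred I)
    (f : I -> T -> V) (l : I -> V) : (forall i, P i -> f i x @[x --> F] --> l i) ->
  \sum_(i <- r | P i) f i x @[x --> F] --> \sum_(i <- r | P i) l i.
Proof.
move=> fl; elim: r => [|i r IHr].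
  rewrite big_nil; under eq_fun do rewrite big_nil.
  exact: cvg_cst.
rewrite big_cons; under eq_fun do rewrite big_cons.
by case: ifP => // Pi; apply: cvgD => //; exact: fl.
Qed.

End limits_of_sums.

Section gaussian_kernel.
Context {R : realType}.
Local Notation mu := (@lebesgue_measure R).

Definition gauss_kernel (c x : R) := expR (- c * x ^+ 2).

(** Integrability of the kernel is inherited from the normal density. *)
Lemma gauss_kernelE (c : R) : 0 < c ->
  exists2 s, 0 < s & gauss_kernel c =
    (fun x => (normal_peak s)^-1 * normal_pdf 0 s x).
Proof.
move=> c0; have c2 : 0 < (c *+ 2)^-1 by rewrite invr_gt0 pmulrn_lgt0.
exists (Num.sqrt (c *+ 2)^-1); first by rewrite sqrtr_gt0.
set s := Num.sqrt _; have s0 : s != 0 by rewrite gt_eqF// sqrtr_gt0.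
apply/funext => x; rewrite normal_pdfE// mulKf; last first.
  by rewrite gt_eqF// normal_peak_gt0.
rewrite /normal_fun /gauss_kernel subr0 sqr_sqrtr ?ltW//; congr expR.
by field; rewrite gt_eqF.
Qed.

Lemma measurable_gauss_kernel (c : R) : measurable_fun setT (gauss_kernel c).
Proof.
by apply: measurableT_comp => //; apply: measurable_funM.
Qed.

Lemma integrable_gauss_kernel (c : R) : 0 < c ->
  mu.-integrable setT (EFin \o gauss_kernel c).
Proof.
move=> /gauss_kernelE[s s0 ->]; rewrite (_ : _ \o _ = fun x =>
  ((normal_peak s)^-1%:E * (normal_pdf 0 s x)%:E)%E) //.
apply: integrableZl => //; exact: integrable_normal_pdf.
Qed.

End gaussian_kernel.

Section riemann_sum.
Context {R : realType}.
Local Notation mu := (@lebesgue_measure R).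
Variables (N : nat) (th : R) (a : nat -> R).
Hypothesis N_gt0 : (0 < N)%N.

Definition grid (j : nat) : R := j%:R / Num.sqrt N%:R - th.

(** With the value [a j] on the [j]-th cell of the grid, the Riemann sum becomes an
    integral over the line ([integral_grid_step]) to which dominated convergence
    applies. *)
Definition grid_step (x : R) : R :=
  \sum_(j < N.+1) a j * \1_(`[grid j, grid j.+1[%classic) x.

Let sqN_gt0 : 0 < Num.sqrt N%:R :> R. Proof. by rewrite sqrtr_gt0 ltr0n. Qed.

Let sqN_ge1 : 1 <= Num.sqrt N%:R :> R.
Proof. by rewrite -[leLHS]sqrtr1 ler_wsqrtr// ler1n. Qed.

Lemma gridS j : grid j.+1 = grid j + (Num.sqrt N%:R)^-1.
Proof. by rewrite /grid -[j.+1]addn1 natrD mulrDl mul1r addrAC. Qed.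

Lemma grid_homo i j : (i <= j)%N -> grid i <= grid j.
Proof. by move=> ij; rewrite lerD2r ler_pM2r ?invr_gt0// ler_nat. Qed.

Lemma grid_step_eq j x : (forall i, (N < i)%N -> a i = 0) ->
  grid j <= x < grid j.+1 -> grid_step x = a j.
Proof.
move=> a0 /andP[jx xj].
have out i : i != j -> \1_(`[grid i, grid i.+1[%classic) x = 0 :> R.
  move=> ij; rewrite indicE memNset//= in_itv /= => /andP[ix xi].
  have [lt_ij|lt_ji|eq_ij] := ltngtP i j; last by rewrite eq_ij eqxx in ij.
  - by have := le_lt_trans (le_trans (grid_homo lt_ij) jx) xi; rewrite ltxx.
  - by have := le_lt_trans (le_trans (grid_homo lt_ji) ix) xj; rewrite ltxx.
have [jN|Nj] := leqP j N.
  rewrite /grid_step (bigD1 (Ordinal (jN : j < N.+1)%N))//= big1 ?addr0.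
    by rewrite indicE mem_set ?mulr1//= in_itv /= jx xj.
  by move=> i ij; rewrite out ?mulr0.
rewrite /grid_step big1 ?a0// => i _; rewrite out ?mulr0// neq_ltn.
by rewrite (leq_ltn_trans _ Nj)// -ltnS.
Qed.

Lemma measurable_grid_step : measurable_fun setT grid_step.
Proof.
apply: measurable_sum => j; apply: measurable_funM => //.
Qed.

Lemma integral_grid_step :
  (\int[mu]_x (grid_step x)%:E = ((Num.sqrt N%:R)^-1 * \sum_(j < N.+1) a j)%:E)%E.
Proof.
rewrite (_ : (fun x => _) = fun x => (\sum_(j < N.+1)
    (a j)%:E * (\1_(`[grid j, grid j.+1[%classic) x)%:E)%E); last first.
  by apply/funext => x; rewrite -sumEFin.
have i1 j : mu.-integrable setT (EFin \o \1_(`[grid j, grid j.+1[%classic)).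
  exact: integrable_indic_itv.
rewrite integral_sum//; last by move=> j; apply: integrableZl (i1 j).
rewrite mulr_sumr -sumEFin; apply: eq_bigr => j _.
rewrite (integralZl measurableT (i1 j)).
rewrite [X in (_ * X)%E](_ : _ = mu `[grid j, grid j.+1[%classic); last first.
  by rewrite -[X in mu X]setIT -integral_indic.
rewrite lebesgue_measure_itv /= lte_fin.
rewrite gridS ltrDl invr_gt0 sqN_gt0 -EFinD -EFinM; congr EFin.
by rewrite addrAC subrr add0r mulrC.
Qed.

(** A cell has length at most 1, so [x ^+ 2 / 2 <= grid j ^+ 2 + 1] on the [j]-th
    cell: the decay at its left end transfers to the whole cell at the price of
    halving [c]. *)
Lemma grid_step_bound (C c x : R) : 0 <= C -> 0 < c ->
  (forall j, `|a j| <= C * gauss_kernel c (grid j)) ->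
  (forall i, (N < i)%N -> a i = 0) ->
  `|grid_step x| <= C * expR c * gauss_kernel (c / 2) x.
Proof.
move=> C0 c0 aC a0.
have [[j /andP[jx xj]]|no] := pselect (exists j, grid j <= x < grid j.+1).
  rewrite (grid_step_eq a0 (j := j)) ?jx//.
  apply: le_trans (aC j) _; rewrite -mulrA ler_wpM2l// -expRD ler_expR.
  have d1 : x - grid j <= 1.
    rewrite gridS in xj; have : (Num.sqrt N%:R)^-1 <= 1 :> R by rewrite invf_le1.
    by move: (Num.sqrt _)^-1 xj => u; lra.
  have d0 : 0 <= x - grid j by rewrite subr_ge0.
  have : (x - grid j) ^+ 2 <= 1 by rewrite expr_le1.
  move: (grid j) => g h; have h2 : 0 <= (x - 2 * g) ^+ 2 by exact: sqr_ge0.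
  rewrite -subr_ge0 (_ : _ - _ = c * ((x - 2 * g) ^+ 2 / 2 + (1 - (x - g) ^+ 2))).
    by rewrite mulr_ge0 ?(ltW c0)// addr_ge0 ?subr_ge0 ?divr_ge0.
  by field.
rewrite /grid_step big1 ?normr0 ?mulr_ge0 ?expR_ge0// => i _.
rewrite indicE memNset ?mulr0//= in_itv /= => ix; apply: no.
by exists i.
Qed.

Lemma riemann_sum_bound (C c : R) : 0 <= C -> 0 < c ->
  (forall j, `|a j| <= C * gauss_kernel c (grid j)) ->
  (forall i, (N < i)%N -> a i = 0) ->
  `|(Num.sqrt N%:R)^-1 * \sum_(j < N.+1) a j| <=
  C * (expR c * \int[mu]_x gauss_kernel (c / 2) x).
Proof.
move=> C0 c0 aC a0.
have c2 : 0 < c / 2 by rewrite divr_gt0.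
have ik := integrable_gauss_kernel c2.
rewrite -lee_fin -abse_EFin -integral_grid_step.
apply: le_trans (le_abse_integral _ _ _) _ => //.
  by apply/measurable_EFinP; exact: measurable_grid_step.
rewrite mulrA EFinM /Rintegral fineK; last exact: integrable_fin_num.
rewrite -integralZl//; apply: ge0_le_integral => //.
- apply: measurableT_comp => //; apply/measurable_EFinP.
  exact: measurable_grid_step.
- by apply/measurable_EFinP/measurable_funM => //; exact: measurable_gauss_kernel.
- by move=> x _; rewrite lee_fin; exact: grid_step_bound.
Qed.

End riemann_sum.

Section riemann_sum_limit.
Context {R : realType}.
Local Notation mu := (@lebesgue_measure R).

Lemma cvg_inv_sqrtn : (Num.sqrt N%:R)^-1 @[N --> \oo] --> (0 : R).
Proof.
apply/cvgrPdist_lt => e e0; near=> N.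
have N0 : (0 < N)%N by near: N; exact: nbhs_infty_gt.
have sN0 : 0 < Num.sqrt N%:R :> R by rewrite sqrtr_gt0 ltr0n.
rewrite sub0r normrN ger0_norm ?invr_ge0 ?ltW//.
rewrite -[ltRHS]invrK ltf_pV2 ?posrE ?invr_gt0//.
rewrite -[ltLHS]ger0_norm ?invr_ge0 ?ltW// -sqrtr_sqr ltr_sqrt ?ltr0n//.
by near: N; exact: nbhs_infty_gtr.
Unshelve. all: by end_near. Qed.

(** Convergence of the terms is asked along arbitrary index sequences [J] whose grid
    points tend to [x]. Applied to the cell that contains [x], it gives pointwise
    convergence of the step functions, and [grid_step_bound] dominates them. Every
    [x] is eventually covered because the left end [- th N] of the grid passes below
    it. *)
Lemma riemann_sum_cvg (a : nat -> nat -> R) (th : nat -> R) (f : R -> R) (C c : R) :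
  0 <= C -> 0 < c ->
  (forall N j, (0 < N)%N -> `|a N j| <= C * gauss_kernel c (grid N (th N) j)) ->
  (forall N j, (N < j)%N -> a N j = 0) ->
  (forall x (J : nat -> nat), grid N (th N) (J N) @[N --> \oo] --> x ->
     a N (J N) @[N --> \oo] --> f x) ->
  (forall x, \forall N \near \oo, 0 <= x + th N) ->
  (Num.sqrt N%:R)^-1 * \sum_(j < N.+1) a N j @[N --> \oo] --> \int[mu]_x f x.
Proof.
move=> C0 c0 aC a0 acvg th_large.
have c2 : 0 < c / 2 by rewrite divr_gt0.
pose g N := grid_step N (th N) (a N).
pose G x := C * expR c * gauss_kernel (c / 2) x.
have gG N x : (0 < N)%N -> `|g N x| <= G x.
  move=> N0; apply: grid_step_bound => // [j|i]; [exact: aC|exact: a0].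
have gf x : g N x @[N --> \oo] --> f x.
  (* The index of the cell that contains [x]. *)
  pose J N := Num.truncn ((x + th N) * Num.sqrt N%:R).
  have JP : \forall N \near \oo, grid N (th N) (J N) <= x < grid N (th N) (J N).+1.
    near=> N.
    have N0 : (0 < N)%N by near: N; exact: nbhs_infty_gt.
    have sN0 : 0 < Num.sqrt N%:R :> R by rewrite sqrtr_gt0 ltr0n.
    have xth : 0 <= x + th N by near: N; exact: th_large.
    rewrite /grid lerBlDr ltrBrDr ler_pdivrMr// ltr_pdivlMr// truncnS_gt andbT.
    by rewrite truncn_le mulr_ge0// ltW.
  have gridJ : grid N (th N) (J N) @[N --> \oo] --> x.
    apply: (@squeeze_cvgr _ _ _ _ (fun N => x - (Num.sqrt N%:R)^-1) (fun=> x)).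
    - near=> N; have /andP[-> /=] : grid N (th N) (J N) <= x < grid N (th N) (J N).+1.
        by near: N; exact: JP.
      by rewrite gridS andbT lerBlDr => /ltW.
    - rewrite -[X in _ --> X]subr0; apply: cvgB; first exact: cvg_cst.
      exact: cvg_inv_sqrtn.
    - exact: cvg_cst.
  apply: cvg_trans (acvg x J gridJ); apply: near_eq_cvg; near=> N.
  apply/esym/grid_step_eq; [|exact: a0|].
    by near: N; exact: nbhs_infty_gt.
  by near: N; exact: JP.
(* Index shifted by one: the cells are proper intervals only for [N > 0]. *)
have mg N : measurable_fun setT (EFin \o g N.+1).
  by apply/measurable_EFinP; exact: measurable_grid_step.
have gf' x : g N.+1 x @[N --> \oo] --> f x.
  by have := gf x; rewrite -cvg_shiftS.
have mf : measurable_fun setT (EFin \o f).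
  apply/measurable_EFinP; apply: (@measurable_fun_cvg _ _ _ _ (fun N => g N.+1)).
  - by move=> N; exact: measurable_grid_step.
  - by move=> x _; exact: gf'.
have iG : mu.-integrable setT (EFin \o G).
  rewrite (_ : _ \o _ = fun x => ((C * expR c)%:E * (gauss_kernel (c / 2) x)%:E)%E)//.
  by apply: integrableZl => //; exact: integrable_gauss_kernel.
have gf'E x : setT x -> (EFin \o g N.+1) x @[N --> \oo] --> (EFin \o f) x.
  by move=> _; apply: cvg_EFin; [exact: nearW|exact: gf'].
have gG' x N : setT x -> (`|(EFin \o g N.+1) x| <= (EFin \o G) x)%E.
  by move=> _; rewrite lee_fin gG.
have [if_ _ Icvg] := @dominated_convergence _ _ _ mu setT measurableT
  (fun N => EFin \o g N.+1) (EFin \o f) (EFin \o G) mg mf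
  (aeW mu gf'E) iG (aeW mu gG').
rewrite -cvg_shiftS.
have fin : (\int[mu]_x (f x)%:E)%E \is a fin_num by exact: integrable_fin_num.
have -> : [sequence (Num.sqrt N.+1%:R)^-1 * \sum_(j < N.+2) a N.+1 j]_N =
    fine \o [sequence (\int[mu]_x (EFin \o g N.+1) x)%E]_N.
  by apply/funext => N /=; rewrite integral_grid_step.
by apply: fine_cvg; rewrite /Rintegral fineK.
Unshelve. all: by end_near. Qed.

End riemann_sum_limit.

(** * Iterated Riemann sums *)

Section iterated_sum.
Context {R : realType}.

Definition upd T (n : nat -> T) (k : nat) (a : T) : nat -> T :=
  fun j => if j == k then a else n j.

Lemma upd_same T (n : nat -> T) k a : upd n k a k = a.
Proof. by rewrite /upd eqxx. Qed.

Lemma upd_lt T (n : nat -> T) k a j : (j < k)%N -> upd n k a j = n j.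
Proof. by move=> jk; rewrite /upd ltn_eqF. Qed.

(** Parallel to [iter_average]: index [d - j] is summed while the earlier ones stay
    frozen in [n], so that the two recursions match level by level. *)
Fixpoint iter_sum (r : R) (N d j : nat) (F : (nat -> nat) -> R) (n : nat -> nat) : R :=
  if j is i.+1 then r * \sum_(l < N.+1) iter_sum r N d i F (upd n (d - j) l)
  else F n.

Lemma iter_sum_out r N d j F n : (j <= d)%N ->
  (forall n, (exists2 k, (k < d)%N & (N < n k)%N) -> F n = 0) ->
  (exists2 k, (k < d - j)%N & (N < n k)%N) -> iter_sum r N d j F n = 0.
Proof.
move=> + F0; elim: j n => [|j IHj] n jd; first by rewrite subn0; exact: F0.
move=> [k kd Nk] /=; rewrite big1 ?mulr0// => l _; apply: IHj; first exact: ltnW.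
exists k; first by apply: leq_trans kd _; rewrite leq_sub2l.
by rewrite upd_lt.
Qed.

End iterated_sum.

Section iterated_riemann_sum.
Context {R : realType} {q : nat}.
Variables (d : nat) (mu0 : 'cV[R]_q) (v : nat -> 'cV[R]_q) (sigma : nat -> R).
Hypothesis sigma_gt0 : forall k, 0 < sigma k.
Variables (X : nat -> (nat -> nat) -> nat -> R) (th : nat -> (nat -> nat) -> nat -> R).
Hypothesis X_upd_lt : forall N n k l i, (i < k)%N -> X N (upd n k l) i = X N n i.
Hypothesis X_upd_same : forall N n k l, X N (upd n k l) k = grid N (th N n k) l.
Hypothesis th_large : forall (n : nat -> nat -> nat) (x : nat -> R) k, (k < d)%N ->
  (forall i, (i < k)%N -> X N (n N) i @[N --> \oo] --> x i) ->
  forall y, \forall N \near \oo, 0 <= y + th N (n N) k.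
Variables (g : 'cV[R]_q -> R) (F : nat -> (nat -> nat) -> R) (K C c : R).
Hypotheses (C_ge0 : 0 <= C) (c_gt0 : 0 < c).
Hypothesis g_bm : bounded_measurable g.
Hypothesis F_out : forall N n, (exists2 k, (k < d)%N & (N < n k)%N) -> F N n = 0.
Hypothesis F_bound : forall N n, (0 < N)%N ->
  `|F N n| <= C * \prod_(i < d) gauss_kernel c (X N n i).
Hypothesis F_cvg : forall (n : nat -> nat -> nat) (x : nat -> R),
  (forall i, (i < d)%N -> X N (n N) i @[N --> \oo] --> x i) ->
  F N (n N) @[N --> \oo] --> K * (\prod_(i < d) normal_fun 0 (sigma i) (x i) *
     g (mu0 + \sum_(i < d) x i *: v i)).

Let S j N := iter_sum (Num.sqrt N%:R)^-1 N d j (F N).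

Let Cj j := C * (expR c * \int[lebesgue_measure]_x gauss_kernel (c / 2) x) ^+ j.

Lemma gauss_kernel_ge0 (b x : R) : 0 <= gauss_kernel b x.
Proof. exact: expR_ge0. Qed.

Lemma gauss_kernel_le1 (b x : R) : 0 <= b -> gauss_kernel b x <= 1.
Proof. by move=> b0; rewrite -[leRHS]expR0 ler_expR mulNr oppr_le0 mulr_ge0 ?sqr_ge0. Qed.

Let Cj_ge0 j : 0 <= Cj j.
Proof.
rewrite mulr_ge0// exprn_ge0// mulr_ge0 ?expR_ge0//.
by apply: Rintegral_ge0 => x _; exact: gauss_kernel_ge0.
Qed.

(** The bound is uniform in the frozen indices and keeps their Gaussian decay, so it
    serves as domination at the next level of the induction. *)
Lemma iter_sum_bound j N n : (j <= d)%N -> (0 < N)%N ->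
  `|S j N n| <= Cj j * \prod_(i < d - j) gauss_kernel c (X N n i).
Proof.
move=> jd N0; elim: j n jd => [|j IHj] n jd.
  by rewrite /Cj expr0 mulr1 subn0; exact: F_bound.
have dj : (d - j = (d - j.+1).+1)%N by rewrite subnSK.
rewrite /S /=; set k := (d - j.+1)%N in dj *.
have -> : Cj j.+1 * \prod_(i < k) gauss_kernel c (X N n i) =
    (Cj j * \prod_(i < k) gauss_kernel c (X N n i)) *
    (expR c * \int[lebesgue_measure]_x gauss_kernel (c / 2) x).
  by rewrite /Cj exprSr; ring.
apply: (@riemann_sum_bound _ _ (th N n k) (fun l => S j N (upd n k l))) => //.
- by rewrite mulr_ge0// prodr_ge0// => i _; exact: gauss_kernel_ge0.
- move=> l; apply: le_trans (IHj _ (ltnW jd)) _.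
  rewrite dj big_ord_recr /= X_upd_same mulrA.
  by under eq_bigr => i _ do rewrite X_upd_lt//.
- move=> i Ni; apply: iter_sum_out; [exact: ltnW|exact: F_out|].
  by exists k; rewrite ?dj// upd_same.
Qed.

(** Induction on the number of sums carried out: each level is a Riemann sum in the
    last free coordinate whose terms are the previous level. The frozen indices are
    arbitrary sequences with convergent coordinates because this is the form in which
    [riemann_sum_cvg] asks for the convergence of its terms. *)
Lemma iter_sum_cvg j (n : nat -> nat -> nat) (x : nat -> R) : (j <= d)%N ->
  (forall i, (i < d - j)%N -> X N (n N) i @[N --> \oo] --> x i) ->
  S j N (n N) @[N --> \oo] -->
    K * \prod_(d - j <= i < d) (normal_peak (sigma i))^-1 *
    (\prod_(i < d - j) normal_fun 0 (sigma i) (x i) *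
     iter_average v sigma d j g (mu0 + \sum_(i < d - j) x i *: v i)).
Proof.
elim: j n x => [|j IHj] n x jd Xx.
  rewrite subn0 big_geq// mulr1; apply: F_cvg => i id; apply: Xx.
  by rewrite subn0.
have dj : (d - j = (d - j.+1).+1)%N by rewrite subnSK.
have kd : (d - j.+1 < d)%N by rewrite -dj leq_subr.
rewrite /S /=; set k := (d - j.+1)%N in dj kd Xx *.
set A := K * \prod_(k.+1 <= i < d) (normal_peak (sigma i))^-1 *
  \prod_(i < k) normal_fun 0 (sigma i) (x i).
set y := mu0 + \sum_(i < k) x i *: v i.
set h := iter_average v sigma d j g.
pose f (t : R) := A * (normal_fun 0 (sigma k) t * h (y + t *: v k)).
have [mh [M hM]] := @bounded_measurable_iter_average R q mu0 v sigma d j g g_bm.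
set lim := (X in _ --> X).
have {lim}-> : lim = \int[lebesgue_measure]_t f t.
  have sk0 : sigma k != 0 by rewrite gt_eqF.
  have pk0 : normal_peak (sigma k) != 0 by rewrite gt_eqF// normal_peak_gt0.
  have fE t : f t = A * (normal_peak (sigma k))^-1 *
      (h (y + t *: v k) * normal_pdf 0 (sigma k) t).
    by rewrite /f normal_pdfE//; field.
  have mht := measurable_section v k y mh.
  have -> : f = (fun t => A * (normal_peak (sigma k))^-1 *
      (h (y + t *: v k) * normal_pdf 0 (sigma k) t)) by apply/funext.
  rewrite RintegralZl//; last first.
    apply: le_integrable (integrableZl measurableT M (integrable_normal_pdf 0 (sigma k))) => //.
    - apply/measurable_EFinP; apply: measurable_funM => //.
      exact: measurable_normal_pdf.
    - move=> t _; rewrite /= lee_fin !normrM ler_wpM2r//.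
      exact: le_trans (hM _) (ler_norm _).
  rewrite -(@integral_normal_prob_density _ _ M)// /lim /A.
  rewrite (big_ltn kd) /normal_average -/h; ring.
apply: (@riemann_sum_cvg _ (fun N l => S j N (upd (n N) k l)) (fun N => th N (n N) k)
   f (Cj j) c) => //.
- move=> N l N0; apply: le_trans (iter_sum_bound _ (ltnW jd) N0) _.
  rewrite ler_wpM2l// dj big_ord_recr /= X_upd_same ler_piMl ?gauss_kernel_ge0//.
  apply: prodr_ile1 => i _; rewrite gauss_kernel_ge0 gauss_kernel_le1// ltW//.
- move=> N i Ni; apply: iter_sum_out; [exact: ltnW|exact: F_out|].
  by exists k; rewrite ?dj// upd_same.
- move=> t J gt.
  have := IHj (fun N => upd (n N) k (J N)) (upd x k t) (ltnW jd).
  rewrite dj !big_ord_recr /= upd_same -/h.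
  have -> : \prod_(i < k) normal_fun 0 (sigma i) (upd x k t i) =
      \prod_(i < k) normal_fun 0 (sigma i) (x i).
    by apply: eq_bigr => i _; rewrite upd_lt.
  have -> : \sum_(i < k) upd x k t i *: v i = \sum_(i < k) x i *: v i.
    by apply: eq_bigr => i _; rewrite upd_lt.
  rewrite addrA -/y.
  rewrite (_ : K * _ * _ = f t); last by rewrite /f /A; ring.
  apply=> i; rewrite ltnS leq_eqVlt => /predU1P[->|ik].
    by rewrite upd_same; under eq_cvg do rewrite X_upd_same.
  by rewrite upd_lt//; under eq_cvg do rewrite X_upd_lt//; exact: Xx.
- by apply: th_large Xx.
Qed.

End iterated_riemann_sum.

(** * Counting words *)

Section counting_words.
Variable q : nat.
Local Open Scope nat_scope.

Definition letter_count N (X : {ffun 'I_N -> 'I_q}) (r : 'I_q) : nat :=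
  \sum_i (X i == r).

Definition word_cons N (p : 'I_q * {ffun 'I_N -> 'I_q}) : {ffun 'I_N.+1 -> 'I_q} :=
  [ffun i => if unlift ord0 i is Some j then p.2 j else p.1].

Definition word_uncons N (X : {ffun 'I_N.+1 -> 'I_q}) : 'I_q * {ffun 'I_N -> 'I_q} :=
  (X ord0, [ffun j => X (lift ord0 j)]).

Lemma word_consK N : cancel (@word_cons N) (@word_uncons N).
Proof.
move=> [r X]; rewrite /word_uncons ffunE unlift_none; congr pair.
by apply/ffunP => j; rewrite !ffunE liftK.
Qed.

Lemma word_unconsK N : cancel (@word_uncons N) (@word_cons N).
Proof.
move=> X; apply/ffunP => i; rewrite ffunE.
by case: unliftP => [j ->|->] /=; rewrite ?ffunE.
Qed.

Lemma letter_count_cons N r (X : {ffun 'I_N -> 'I_q}) s :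
  letter_count (word_cons (r, X)) s = (r == s) + letter_count X s.
Proof.
rewrite /letter_count big_ord_recl ffunE unlift_none /=; congr addn.
by apply: eq_bigr => i _; rewrite ffunE liftK.
Qed.

Lemma sum_letter_count N (X : {ffun 'I_N -> 'I_q}) : \sum_r letter_count X r = N.
Proof.
rewrite exchange_big /= -[RHS]card_ord -sum1_card; apply: eq_bigr => i _.
by rewrite (bigD1 (X i)) //= eqxx big1 ?addn0 // => r; rewrite eq_sym => /negbTE->.
Qed.

(** The multinomial formula, without division, by induction on the length of the word:
    removing the first letter [r] lowers [n r] by one. *)
Lemma card_letter_count N (n : 'I_q -> nat) :
  (\sum_(X : {ffun 'I_N -> 'I_q}) [forall r, letter_count X r == n r]) *
    \prod_r (n r)`! = (\sum_r n r == N) * N`!.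
Proof.
elim: N n => [|N IHN] n.
  have [n0|] := eqVneq (\sum_r n r) 0.
    have {}n0 r : n r = 0.
      by apply/eqP; move/eqP: n0; rewrite sum_nat_eq0 => /forallP/(_ r).
    have -> : \prod_r (n r)`! = 1 by rewrite big1 // => r _; rewrite n0.
    rewrite muln1 mul1n (eq_bigr (fun=> 1)) => [|X _].
      by rewrite sum1_card card_ffun !card_ord expn0.
    by rewrite (_ : [forall r, _]) //; apply/forallP => r; rewrite n0 /letter_count big_ord0.
  rewrite mul0n; apply: contra_neq_eq => /=.
  rewrite muln_eq0 negb_or => /andP[+ _]; rewrite sum_nat_eq0 negb_forall.
  move=> /existsP[X]; rewrite implyTb eqb0 negbK => /forallP nX.
  by rewrite -(eq_bigr _ (fun r _ => eqP (nX r))) sum_letter_count.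
rewrite (reindex (@word_cons N)); last first.
  by apply: onW_bij; exists (@word_uncons N); [exact: word_consK|exact: word_unconsK].
rewrite -(pair_bigA_idem _ (fun r X => nat_of_bool
  [forall s, letter_count (word_cons (r, X)) s == n s])) //=.
transitivity (\sum_r n r * ((\sum_s n s == N.+1) * N`!)); last first.
  rewrite -big_distrl /=; have [->|_] := eqVneq; first by rewrite !mul1n factS.
  by rewrite !mul0n muln0.
rewrite big_distrl /=; apply: eq_bigr => r _.
have [nr0|nr_gt0] := posnP (n r).
  rewrite nr0 mul0n big1 ?mul0n // => X _; apply/eqP; rewrite eqb0.
  by apply/forallPn; exists r; rewrite letter_count_cons eqxx nr0.
pose n' s := n s - (r == s).
have n'E s : n s = (r == s) + n' s.
  by rewrite /n'; case: eqP => [<-|_]; rewrite ?subn0 ?add0n // subnKC.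
have -> : \prod_s (n s)`! = n r * \prod_s (n' s)`!.
  rewrite (bigD1 r) //= [in RHS](bigD1 r) //= mulnA; congr (_ * _).
    by rewrite /n' eqxx subn1 -[in LHS](prednK nr_gt0) factS prednK.
  by apply: eq_bigr => s; rewrite eq_sym /n' => /negbTE->; rewrite subn0.
rewrite mulnCA; congr (_ * _).
have -> : (\sum_s n s == N.+1) = (\sum_s n' s == N).
  rewrite (eq_bigr _ (fun s _ => n'E s)) big_split /= (bigD1 r) //= eqxx.
  by rewrite big1 => [|s]; rewrite ?addn0 ?add1n ?eqSS // eq_sym => /negbTE->.
rewrite -IHN; congr (_ * _); apply: eq_bigr => X _; congr nat_of_bool.
by apply: eq_forallb => s; rewrite letter_count_cons n'E eqn_add2l.
Qed.

End counting_words.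

Section sum_over_words.
Context {R : realType}.
Variables (N d : nat).

Definition complete_counts (n : nat -> nat) (r : 'I_d.+1) : nat :=
  if (r < d)%N then n r else (N - \sum_(j < d) n j)%N.

(** Extended by zero outside of the simplex, so that each count can run over the whole
    of [0..N]. *)
Definition multinomial (n : nat -> nat) : R :=
  if (\sum_(j < d) n j <= N)%N then
    N`!%:R / \prod_(r < d.+1) (complete_counts n r)`!%:R
  else 0.

Lemma sum_complete_counts (n : nat -> nat) : (\sum_(j < d) n j <= N)%N ->
  (\sum_r complete_counts n r = N)%N.
Proof.
move=> nN; rewrite big_ord_recr /= /complete_counts ltnn.
rewrite (eq_bigr (fun j : 'I_d => n j)) => [|i _]; first exact: subnKC.
by rewrite /= ltn_ord.
Qed.

Lemma iter_sumZ (r : R) j F n :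
  iter_sum r N d j F n = r ^+ j * iter_sum 1 N d j F n.
Proof.
elim: j n => [|j IHj] n /=; first by rewrite expr0 mul1r.
rewrite mul1r exprS -mulrA; congr (_ * _); rewrite mulr_sumr.
by apply: eq_bigr => l _; rewrite IHj.
Qed.

Lemma eq_iter_sum (r : R) j F G n : F =1 G -> iter_sum r N d j F n = iter_sum r N d j G n.
Proof.
move=> FG; elim: j n => [|j IHj] n /=; first exact: FG.
by congr (_ * _); apply: eq_bigr => l _; rewrite IHj.
Qed.

Lemma iter_sum_sum (I : finType) (r : R) j (F : I -> (nat -> nat) -> R) n :
  \sum_i iter_sum r N d j (F i) n = iter_sum r N d j (fun n => \sum_i F i n) n.
Proof.
elim: j n => //= j IHj n; rewrite -mulr_sumr; congr (_ * _).
rewrite exchange_big; by apply: eq_bigr => l _; rewrite IHj.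
Qed.

Lemma iter_sum_mulr (r a : R) j F n :
  iter_sum r N d j (fun n => a * F n) n = a * iter_sum r N d j F n.
Proof.
elim: j n => //= j IHj n; rewrite mulrCA; congr (_ * _); rewrite mulr_sumr.
by apply: eq_bigr => l _; rewrite IHj.
Qed.

Lemma iter_sum_delta (m : nat -> nat) j n : (j <= d)%N -> (forall i, (m i <= N)%N) ->
  iter_sum 1 N d j (fun n => (\prod_(i < d) (n i == m i))%N%:R) n =
  (\prod_(i < d - j) (n i == m i))%N%:R :> R.
Proof.
move=> + mN; elim: j n => [|j IHj] n jd; first by rewrite subn0.
rewrite /= mul1r.
have dj : (d - j = (d - j.+1).+1)%N by rewrite subnSK.
set k := (d - j.+1)%N in dj *.
rewrite (bigD1 (Ordinal (mN k : m k < N.+1)%N)) //= big1 ?addr0 => [|l].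
  rewrite IHj ?(ltnW jd)// dj big_ord_recr /= upd_same eqxx muln1.
  by congr (_%:R); apply: eq_bigr => i _; rewrite upd_lt.
move=> lm; rewrite IHj ?(ltnW jd)// dj big_ord_recr /= upd_same.
by rewrite -val_eqE /= in lm; rewrite (negbTE lm) muln0.
Qed.

(** Words are grouped by their counts: a product of Kronecker deltas picks the counts
    of each word out of the iterated sum ([iter_sum_delta]), and exchanging the two
    summations leaves the number of words with given counts. *)
Lemma sum_words (G : ('I_d.+1 -> nat) -> R) n0 :
  \sum_(X : {ffun 'I_N -> 'I_d.+1}) G (letter_count X) =
  iter_sum 1 N d d (fun n => multinomial n * G (complete_counts n)) n0.
Proof.
pose c (X : {ffun 'I_N -> 'I_d.+1}) (i : nat) : nat := letter_count X (inord i).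
have cN X i : (c X i <= N)%N.
  by rewrite -[leqRHS](sum_letter_count X) (bigD1 (inord i))//= leq_addr.
have cE X : (\sum_(j < d) c X j = N - c X d)%N.
  have := sum_letter_count X; rewrite big_ord_recr /= => /(congr1 (subn^~ (c X d))) <-.
  rewrite {2}/c (_ : inord d = ord_max) ?addnK; last by apply: val_inj; rewrite /= inordK.
  apply: eq_bigr => i _; congr (letter_count X _).
  by apply: val_inj; rewrite /= inordK // ltnS ltnW.
transitivity (\sum_(X : {ffun 'I_N -> 'I_d.+1})
    iter_sum 1 N d d (fun n => G (letter_count X) * (\prod_(i < d) (n i == c X i))%N%:R) n0).
  apply: eq_bigr => X _.
  by rewrite iter_sum_mulr iter_sum_delta// subnn big_ord0 mulr1.
rewrite iter_sum_sum; apply: eq_iter_sum => n.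
have key X : (\prod_(i < d) (n i == c X i))%N =
    ((\sum_(j < d) n j <= N) && [forall r, letter_count X r == complete_counts n r])%N :> nat.
  have [nc|/forallPn[i ni]] := boolP [forall i : 'I_d, n i == c X i]; last first.
    rewrite (bigD1 i)//= (negbTE ni) mul0n; apply/esym/eqP; rewrite eqb0 negb_and.
    apply/orP; right; apply/forallPn; exists (inord i).
    have id : (i < d.+1)%N by rewrite ltnS ltnW.
    by rewrite /complete_counts (inordK id) ltn_ord eq_sym.
  have {}nc (i : 'I_d) : n i = c X i by apply/eqP; move/forallP: nc.
  rewrite big1 => [|i _]; last by rewrite nc eqxx.
  have nE : (\sum_(j < d) n j = \sum_(j < d) c X j)%N by apply: eq_bigr.
  rewrite nE cE leq_subr /=; apply/esym/eqP; rewrite eqb1; apply/forallP => r.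
  rewrite /complete_counts; case: ltnP => [rd|dr].
    by rewrite (nc (Ordinal rd)) /c /= inord_val.
  rewrite nE cE subKn// /c (_ : inord d = r)//; apply: val_inj; rewrite /= inordK//.
  by apply/eqP; rewrite eqn_leq dr andTb -ltnS; exact: ltn_ord.
under eq_bigr => X _ do rewrite key.
rewrite /multinomial; case: ifP => [nN|_]; last by rewrite big1 ?mul0r// => X _; rewrite mulr0.
transitivity ((\sum_(X : {ffun 'I_N -> 'I_d.+1})
    [forall r, letter_count X r == complete_counts n r])%N%:R * G (complete_counts n)).
  rewrite natr_sum mulr_suml; apply: eq_bigr => X _ /=.
  case: (boolP [forall r, _]) => [/forallP cX|_]; last by rewrite mulr0 mul0r.
  rewrite mulr1 mul1r; congr G; apply/funext => r; exact/eqP.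
congr (_ * _).
have sumN := sum_complete_counts nN.
have := card_letter_count N (complete_counts n).
rewrite sumN eqxx mul1n => /(congr1 (fun k : nat => k%:R : R)); rewrite natrM => <-.
rewrite natr_prod mulfK//; apply/prodf_neq0 => r _.
by rewrite pnatr_eq0 -lt0n fact_gt0.
Qed.

End sum_over_words.

(** * Stirling's formula *)

Section stirling.
Context {R : realType}.

Lemma nonneg_derive_ge0 (f df : R -> R) (a b : R) : a <= b ->
  (forall x, a <= x -> is_derive x 1 f (df x)) ->
  (forall x, a <= x -> 0 <= df x) -> f a <= f b.
Proof.
move=> ab fdf df0.
have [c cab E] : exists2 c, c \in `[a, b]%R & f b - f a = df c * (b - a).
  apply: MVT_segment ab _ _ => [x|].
    by rewrite in_itv /= => /andP[/ltW + _]; exact: fdf.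
  apply: derivable_within_continuous => x; rewrite in_itv /= => /andP[ax _].
  by have [] := fdf x ax.
rewrite -subr_ge0 E mulr_ge0 ?subr_ge0// df0//.
by move: cab; rewrite in_itv /= => /andP[].
Qed.

(** This bound and [ln_le_sinh] agree with [ln] to second order at 1, which is what
    makes the increments of [stirling_error] of order [n ^- 2]. In both cases the
    derivative of the difference is a square divided by a positive quantity. *)
Lemma ln_ge_pade (w : R) : 1 <= w -> 2 - 4 / (w + 1) <= ln w.
Proof.
move=> w1; rewrite -subr_ge0.
have -> : 0 = ln 1 - (2 - 4 / (1 + 1)) :> R by rewrite ln1; field.
apply: (@nonneg_derive_ge0 (fun x => ln x - (2 - 4 / (x + 1)))
  (fun x => (x - 1) ^+ 2 / (x * (x + 1) ^+ 2))) => // x x1;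
  have x0 : 0 < x by exact: lt_le_trans x1.
  have xp : x + 1 != 0 by rewrite gt_eqF// addr_gt0.
  have d1 := is_derive1_ln x0.
  have d2 : is_derive x 1 (fun y : R => y + 1) 1 by apply: is_derive_eq; rewrite addr0.
  have d3 := @is_deriveV _ (fun y : R => y + 1) x 1 1 xp d2.
  apply: is_derive_eq; rewrite /GRing.scale /=; field.
  by rewrite xp gt_eqF.
by apply: divr_ge0; [exact: sqr_ge0|apply: mulr_ge0; [exact: ltW|exact: sqr_ge0]].
Qed.

Lemma ln_le_sinh (w : R) : 1 <= w -> ln w <= (w - w^-1) / 2.
Proof.
move=> w1; rewrite -subr_ge0.
have -> : 0 = (1 - 1^-1) / 2 - ln 1 :> R by rewrite ln1; field.
apply: (@nonneg_derive_ge0 (fun x => (x - x^-1) / 2 - ln x)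
  (fun x => (1 - x^-1) ^+ 2 / 2)) => // x x1;
  have x0 : 0 < x by exact: lt_le_trans x1.
  have d1 := is_derive1_ln x0.
  have x0' : x != 0 by rewrite gt_eqF.
  have d3 := @is_deriveV _ id x 1 1 x0' (is_derive_id x 1).
  apply: is_derive_eq; rewrite /GRing.scale /=; field.
  by rewrite x0'.
by apply: divr_ge0; first exact: sqr_ge0.
Qed.

Definition stirling_error (n : nat) : R :=
  ln n`!%:R - (n%:R * ln n%:R - n%:R + ln n%:R / 2).

Lemma stirling_error_step n : (0 < n)%N ->
  0 <= stirling_error n - stirling_error n.+1 <= (n%:R^-1 - n.+1%:R^-1) / 4.
Proof.
move=> n0; have n0R : 0 < n%:R :> R by rewrite ltr0n.
have n1R : n.+1%:R = n%:R + 1 :> R by rewrite -natr1.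
set x : R := n%:R in n0R n1R *.
have x1 : 0 < x + 1 by rewrite addr_gt0.
have E : stirling_error n - stirling_error n.+1 = (x + 2^-1) * ln ((x + 1) / x) - 1.
  rewrite /stirling_error factS natrM n1R -/x lnM ?posrE ?ltr0n ?fact_gt0//.
  by rewrite ln_div ?posrE//; field.
have w1 : 1 <= (x + 1) / x by rewrite ler_pdivlMr// mul1r lerDl.
have L := ln_ge_pade w1; have U := ln_le_sinh w1.
have xh : 0 < x + 2^-1 by rewrite addr_gt0.
rewrite E n1R; apply/andP; split.
  rewrite subr_ge0; apply: le_trans (ler_wpM2l (ltW xh) L).
  rewrite le_eqVlt; apply/orP; left; apply/eqP; field.
  by apply/andP; split; rewrite gt_eqF// addr_gt0// mulrn_wgt0.
rewrite lerBlDr; apply: le_trans (ler_wpM2l (ltW xh) U) _.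
rewrite le_eqVlt; apply/orP; left; apply/eqP; field.
by rewrite !gt_eqF.
Qed.

(** The term [n%:R^-1 / 4] of the lower bound makes the induction telescope. *)
Lemma stirling_error_bounds n : (0 < n)%N ->
  3 / 4 + n%:R^-1 / 4 <= stirling_error n <= 1.
Proof.
elim: n => // -[|n] IHn _.
  by rewrite /stirling_error /= ln1 invr1; apply/andP; split; lra.
have := IHn isT; have := @stirling_error_step n.+1 isT.
move: (n.+1%:R^-1) (n.+2%:R^-1) => u t /andP[s0 s1] /andP[lo hi].
by apply/andP; split; lra.
Qed.

Lemma stirling_error_normr n : `|stirling_error n| <= 1.
Proof.
case: n => [|n].
  by rewrite /stirling_error fact0 ln1 ln0// !(mul0r, subr0, addr0) normr0.
have /andP[lo hi] := @stirling_error_bounds n.+1 isT.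
by rewrite ger0_norm//; apply: le_trans lo; rewrite addr_ge0.
Qed.

(** The error decreases and is bounded below. Its limit enters the weights only as a
    constant factor that the normalization cancels, hence the existential form. *)
Lemma stirling_error_cvg : exists c : R, stirling_error n @[n --> \oo] --> c.
Proof.
have : cvgn (fun n => stirling_error n.+1).
  apply: nonincreasing_is_cvgn.
    apply/nonincreasing_seqP => n.
    by have /andP[+ _] := @stirling_error_step n.+1 isT; rewrite subr_ge0.
  exists (- 1) => _ [n _ <-].
  by have := stirling_error_normr n.+1; rewrite ler_norml => /andP[].
by move=> /cvg_ex[c]; rewrite (cvg_shiftS (stirling_error)) => cc; exists c.
Qed.

End stirling.

(** * Second-order expansions and the entropy function *)

Section taylor.
Context {R : realType}.

(** Second-order expansion with the second derivative at the single point [x0]: the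
    mean value theorem applied to the difference between [f] and its Taylor
    polynomial. *)
Lemma taylor_order2 (f df : R -> R) (x0 d2 r e : R) : 0 < r ->
  (forall x, `|x - x0| < r -> is_derive x 1 f (df x)) -> is_derive x0 1 df d2 ->
  0 < e -> exists2 dl, 0 < dl & forall x, `|x - x0| < dl ->
    `|f x - f x0 - df x0 * (x - x0) - d2 / 2 * (x - x0) ^+ 2| <= e * (x - x0) ^+ 2.
Proof.
move=> r0 fdf dfd2 e0.
have [dl0 /= dl0_gt0 H] : exists2 dl : R, 0 < dl & forall x, `|x - x0| < dl ->
    `|df x - df x0 - d2 * (x - x0)| <= e * `|x - x0|.
  have [/cvg_ex[l dfl] dfE] := dfd2.
  have {dfE}dfl : h^-1 *: (df (h *: 1 + x0) - df x0) @[h --> 0^'] --> d2.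
    by rewrite -dfE /derive (cvg_lim _ dfl).
  move/cvgrPdist_le : dfl => /(_ _ e0)/nbhs_ballP[dl /= dl0 H].
  exists dl => // x xdl; have [->|xx0] := eqVneq x x0.
    by rewrite !subrr mulr0 subrr normr0 mulr0.
  have x_neq0 : x - x0 != 0 by rewrite subr_eq0.
  have xball : ball (0 : R) dl (x - x0) by rewrite /ball /= sub0r normrN.
  have := H (x - x0) xball x_neq0.
  rewrite /GRing.scale /= mulr1 subrK => {}H.
  rewrite -ler_pdivrMr ?normr_gt0// -normf_div -normrN; apply: le_trans H.
  by rewrite le_eqVlt; apply/orP; left; apply/eqP; congr (Num.norm _); field.
exists (Num.min r dl0); first by rewrite lt_min r0.
move=> x; rewrite lt_min => /andP[xr xdl].
pose g y := f y - (df x0 * (y - x0) + d2 / 2 * (y - x0) ^+ 2).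
have gd y : `|y - x0| < r -> is_derive y 1 g (df y - df x0 - d2 * (y - x0)).
  move=> /fdf d1.
  have d3 : is_derive y 1 (fun y => y - x0) 1 by apply: is_derive_eq; rewrite subr0.
  by apply: is_derive_eq; rewrite /GRing.scale /=; field.
have -> : f x - f x0 - df x0 * (x - x0) - d2 / 2 * (x - x0) ^+ 2 = g x - g x0.
  by rewrite /g; ring.
have mvt a b : a <= b -> `|a - x0| < r -> `|b - x0| < r ->
    exists2 c, a <= c <= b & g b - g a = (df c - df x0 - d2 * (c - x0)) * (b - a).
  move=> ab ar br.
  have inr c : a <= c <= b -> `|c - x0| < r.
    move=> /andP[ac cb]; move: ar br; rewrite !ltr_norml => /andP[? ?] /andP[? ?].
    by apply/andP; split; lra.
  have [c cab E] : exists2 c, c \in `[a, b]%R &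
      g b - g a = (df c - df x0 - d2 * (c - x0)) * (b - a).
    apply: MVT_segment ab _ _ => [y|].
      by rewrite in_itv /= => /andP[ay yb]; apply/gd/inr; rewrite !ltW.
    apply: derivable_within_continuous => y; rewrite in_itv /= => yab.
    by have [] := gd y (inr y yab).
  by exists c => //; move: cab; rewrite in_itv.
have x0r : `|x0 - x0| < r by rewrite subrr normr0.
have fin c : `|c - x0| <= `|x - x0| ->
    `|df c - df x0 - d2 * (c - x0)| * `|x - x0| <= e * (x - x0) ^+ 2.
  move=> cx; rewrite -[(x - x0) ^+ 2]ger0_norm ?sqr_ge0// normrX expr2 mulrA.
  rewrite ler_wpM2r//; apply: le_trans (H c (le_lt_trans cx xdl)) _.
  by rewrite ler_pM2l.
have [le|/ltW le] := leP x0 x.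
  have [c /andP[c1 c2] ->] := mvt _ _ le x0r xr.
  by rewrite normrM fin// !ger0_norm ?subr_ge0//; lra.
have [c /andP[c1 c2] E] := mvt _ _ le xr x0r.
rewrite distrC E normrM [`|x0 - x|]distrC fin//.
by rewrite ![`|_ - x0|]distrC !ger0_norm ?subr_ge0//; lra.
Qed.

End taylor.

Section entropy_derivatives.
Context {R : realType}.
Variables (p : nat) (beta : R).
Hypothesis p_gt1 : (1 < p)%N.

Definition k_der (x : R) : R := beta * p%:R * x ^+ p.-1 - ln x - 1.

Definition k_der2 (x : R) : R := beta * p%:R * (p%:R - 1) * x ^+ (p - 2) - x^-1.

Lemma is_derive_exprn n (x : R) : is_derive x 1 (fun y : R => y ^+ n) (n%:R * x ^+ n.-1).
Proof.
apply: DeriveDef; first exact: exprn_derivable.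
by rewrite exp_derive /GRing.scale /= mulr1.
Qed.

Lemma is_derive_k (x : R) : 0 < x -> is_derive x 1 (k_potts p beta) (k_der x).
Proof.
move=> x0; have d1 := is_derive1_ln x0.
have dX := is_derive_exprn p x.
apply: is_derive_eq; rewrite /GRing.scale /= /k_der; field.
by rewrite gt_eqF.
Qed.

Lemma is_derive_k_der (x : R) : 0 < x -> is_derive x 1 k_der (k_der2 x).
Proof.
move=> x0; have d1 := is_derive1_ln x0.
have dX : is_derive x 1 (fun y : R => y ^+ p.-1) ((p%:R - 1) * x ^+ (p - 2)).
  rewrite (_ : p%:R - 1 = p.-1%:R); last by rewrite -subn1 natrB ?(ltnW p_gt1).
  by rewrite subn2; exact: is_derive_exprn.
by apply: is_derive_eq; rewrite /GRing.scale /= /k_der2; ring.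
Qed.

Lemma derive2_k (x : R) : 0 < x -> derive1n 2 (k_potts p beta) x = k_der2 x.
Proof.
move=> x0 /=; rewrite derive1E.
have E : {near x, k_der =1 (k_potts p beta)^`()%classic}.
  near=> y; have y0 : 0 < y by near: y; exact: lt_nbhsr.
  by have := is_derive_k y0; rewrite derive1E => H; rewrite derive_val.
have := near_eq_is_derive E (is_derive_k_der x0) => H.
by rewrite derive_val.
Unshelve. all: by end_near. Qed.

End entropy_derivatives.

Section xlnx_continuity.
Context {R : realType}.

(** Both bounds on the logarithm come from [ln y < y], applied to [x] and to the
    inverse of its square root. *)
Lemma normr_xlnx_le (x : R) : `|x * ln x| <= 2 * Num.sqrt `|x| + x ^+ 2.
Proof.
have [x0|x0] := leP x 0.
  by rewrite ln0// mulr0 normr0 addr_ge0 ?sqr_ge0// mulr_ge0// sqrtr_ge0.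
have sx0 : 0 < Num.sqrt x by rewrite sqrtr_gt0.
have xE : x = Num.sqrt x ^+ 2 by rewrite sqr_sqrtr// ltW.
have up : ln x <= x by apply/ltW/ln_sublinear.
have lo : - ln x <= 2 / Num.sqrt x.
  rewrite [in - ln x]xE lnXn// -mulNrn -lnV ?posrE// -[leLHS]mulr_natl ler_pM2l//.
  by apply/ltW/ln_sublinear; rewrite invr_gt0.
rewrite (gtr0_norm x0) normrM (gtr0_norm x0).
have [l0|l0] := leP 0 (ln x).
  rewrite ger0_norm// expr2; apply: le_trans (ler_wpM2l (ltW x0) up) _.
  by rewrite lerDr mulr_ge0// sqrtr_ge0.
rewrite ltr0_norm//; apply: le_trans (ler_wpM2l (ltW x0) lo) _.
rewrite {1}xE [leLHS](_ : _ = 2 * Num.sqrt x); last by field; rewrite gt_eqF.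
by rewrite lerDl sqr_ge0.
Qed.

Lemma continuous_xlnx : continuous (fun x : R => x * ln x).
Proof.
move=> x; have [x0|x0|->] := ltgtP x 0.
- apply: (@near_cst_continuous _ _ 0 (fun x : R => x * ln x)).
  near=> y; have y0 : y < 0 by near: y; exact: lt_nbhsl.
  by rewrite ln0 ?mulr0// ltW.
- by apply: cvgM; [exact: cvg_id|exact: continuous_ln].
rewrite /continuous_at mul0r; apply/cvgr0Pnorm_lt => e e0.
have c : (fun y : R => 2 * Num.sqrt `|y| + y ^+ 2) y @[y --> (0 : R)] --> (0 : R).
  rewrite -[X in _ --> X]addr0; apply: cvgD.
    rewrite -[X in _ --> X](mulr0 2); apply: cvgM; first exact: cvg_cst.
    rewrite -[X in _ --> X]sqrtr0 -[X in Num.sqrt X](@normr0 _ R).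
    apply: continuous_cvg; first exact: sqrt_continuous.
    by apply: cvg_norm; exact: cvg_id.
  rewrite -[X in _ --> X](expr0n R 2); exact: exprn_continuous.
move/cvgr0Pnorm_lt : c => /(_ _ e0); apply: filterS => y.
apply: le_lt_trans; rewrite [leRHS]ger0_norm ?normr_xlnx_le//.
by rewrite addr_ge0 ?sqr_ge0// mulr_ge0// sqrtr_ge0.
Unshelve. all: by end_near. Qed.

End xlnx_continuity.

(** * Helmert coordinates on zero-sum vectors *)

Section helmert.
Context {R : realFieldType}.
Variable d : nat.
Implicit Types (z : nat -> R) (k : nat).

(** Deviation of an entry from the mean of the later ones. *)
Definition tail_dev z k : R := z k - (\sum_(k.+1 <= i < d.+1) z i) / (d - k)%:R.

(** Empirical variance of the entries from [k] on, times their number. *)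
Definition tail_var z k : R :=
  \sum_(k <= i < d.+1) z i ^+ 2 - (\sum_(k <= i < d.+1) z i) ^+ 2 / (d.+1 - k)%:R.

(** Welford's update formula for the empirical variance. *)
Lemma tail_varS z k : (k < d)%N -> tail_var z k =
  (d - k)%:R / (d.+1 - k)%:R * tail_dev z k ^+ 2 + tail_var z k.+1.
Proof.
move=> kd; have kd1 : (k < d.+1)%N by exact: ltnW.
rewrite /tail_var /tail_dev !(big_ltn kd1) subSS subSn ?(ltnW kd)// -natr1.
have : (d - k)%:R != 0 :> R by rewrite pnatr_eq0 -lt0n subn_gt0.
have : (d - k)%:R + 1 != 0 :> R by rewrite natr1 pnatr_eq0.
move: (d - k)%:R (\sum_(k.+1 <= i < d.+1) z i) (\sum_(k.+1 <= i < d.+1) _ ^+ 2).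
by move=> D T Y D1 D0; field; rewrite D0 D1.
Qed.

Lemma tail_varE z k : (k <= d)%N -> tail_var z k =
  \sum_(k <= j < d) (d - j)%:R / (d.+1 - j)%:R * tail_dev z j ^+ 2.
Proof.
move=> kd; rewrite -(subKn kd); move: (d - k)%N (leq_subr k d) => {kd}j.
elim: j => [|j IHj] jd.
  by rewrite subn0 [RHS]big_geq// /tail_var !big_nat1 subSnn divr1 subrr.
have kd : (d - j.+1 < d)%N by rewrite subnSK// leq_subr.
by rewrite (tail_varS _ kd) (big_ltn kd) subnSK// IHj// ltnW.
Qed.

(** For zero-sum [z] this is a positive multiple of [tail_dev z k]
    ([helmert_coordE]). In terms of the earlier entries, as written here, it is a
    translate of [z k], which is what a sum over [z k] with those entries frozen
    requires. *)
Definition helmert_coord z k : R := z k + (\sum_(i < k) z i) / (d.+1 - k)%:R.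

Lemma helmert_coordE z k : (k < d)%N -> \sum_(i < d.+1) z i = 0 ->
  helmert_coord z k = (d - k)%:R / (d.+1 - k)%:R * tail_dev z k.
Proof.
move=> kd z0; have kd1 : (k < d.+1)%N by exact: ltnW.
have : \sum_(i < k) z i = - (z k + \sum_(k.+1 <= i < d.+1) z i).
  apply/eqP; rewrite -addr_eq0; apply/eqP; move: z0; rewrite -(big_mkord xpredT).
  by rewrite (big_cat_nat (n := k)) ?(ltnW kd1)//= (big_ltn kd1) big_mkord.
rewrite /helmert_coord /tail_dev => ->; rewrite subSn ?(ltnW kd)// -natr1.
have : (d - k)%:R != 0 :> R by rewrite pnatr_eq0 -lt0n subn_gt0.
have : (d - k)%:R + 1 != 0 :> R by rewrite natr1 pnatr_eq0.
by move: (d - k)%:R => D D1 D0; field; rewrite D0 D1.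
Qed.

(** The [k]-th basis vector minus the mean of the later ones. *)
Definition helmert_vec k : 'cV[R]_d.+1 :=
  \col_i (if (i < k)%N then 0 else if (i == k :> nat) then 1 else - (d - k)%:R^-1).

Lemma sum_helmert_coord z k : (k <= d)%N ->
  \sum_(j < k) helmert_coord z j / (d - j)%:R = (\sum_(j < k) z j) / (d.+1 - k)%:R.
Proof.
elim: k => [|k IHk] kd; first by rewrite !big_ord0 mul0r.
rewrite !big_ord_recr /= IHk ?(ltnW kd)// /helmert_coord subSS subSn ?(ltnW kd)// -natr1.
have : (d - k)%:R != 0 :> R by rewrite pnatr_eq0 -lt0n subn_gt0.
have : (d - k)%:R + 1 != 0 :> R by rewrite natr1 pnatr_eq0.
by move: (d - k)%:R => D D1 D0; field; rewrite D0 D1.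
Qed.

Lemma helmert_expansion z (r : 'I_d.+1) : \sum_(i < d.+1) z i = 0 ->
  z r = (\sum_(k < d) helmert_coord z k *: helmert_vec k) r 0.
Proof.
move=> z0; rewrite summxE.
have low : \sum_(k < r) helmert_coord z k * - (d - k)%:R^-1 =
    - ((\sum_(j < r) z j) / (d.+1 - r)%:R).
  have rd : (r <= d)%N by rewrite -ltnS.
  by rewrite -(sum_helmert_coord z rd) -sumrN; apply: eq_bigr => j _; rewrite mulrN.
rewrite -(big_mkord xpredT (fun k => (helmert_coord z k *: helmert_vec k) r 0)).
have [rd|dr] := ltnP r d.
  rewrite (big_cat_nat (n := r)) ?(ltnW rd)//= (big_ltn rd) [X in _ + (_ + X)]big_nat_cond.
  rewrite [X in _ + (_ + X)]big1 => [|k]; last first.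
    by rewrite andbT => /andP[rk _]; rewrite !mxE rk mulr0.
  rewrite addr0 !mxE ltnn eqxx mulr1 big_mkord (eq_bigr (fun k : 'I_r =>
    helmert_coord z k * - (d - k)%:R^-1)) => [|k _].
    by rewrite low /helmert_coord addrC addrK.
  by rewrite !mxE ltnNge (ltnW (ltn_ord k)) /= gtn_eqF.
have {dr} rd : r = d :> nat by apply/eqP; rewrite eqn_leq dr andbT -ltnS.
rewrite big_mkord (eq_bigr (fun k : 'I_d => - (helmert_coord z k / (d - k)%:R))).
  rewrite sumrN sum_helmert_coord// subSnn divr1 rd.
  by move/eqP: z0; rewrite big_ord_recr /= addrC addr_eq0 => /eqP.
by move=> k _; rewrite !mxE rd ltnNge (ltnW (ltn_ord k)) /= gtn_eqF// mulrN.
Qed.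

Lemma dot_helmert_vec z k : (k < d)%N ->
  \sum_(i < d.+1) z i * helmert_vec k i 0 = tail_dev z k.
Proof.
move=> kd; have kd1 : (k < d.+1)%N by exact: ltnW.
rewrite (eq_bigr (fun i : 'I_d.+1 => z i *
    (if (i < k)%N then 0 else if (i == k :> nat) then 1 else - (d - k)%:R^-1))); last first.
  by move=> i _; rewrite mxE.
rewrite -(big_mkord xpredT (fun i => z i *
    (if (i < k)%N then 0 else if (i == k :> nat) then 1 else - (d - k)%:R^-1))).
rewrite (big_cat_nat (n := k)) ?(ltnW kd1)//= (big_ltn kd1) ltnn eqxx mulr1.
rewrite [X in X + _]big_nat_cond [X in X + _]big1 ?add0r => [|i]; last first.
  by rewrite andbT => /andP[_ ->]; rewrite mulr0.
rewrite /tail_dev; congr (_ + _); rewrite mulr_suml -sumrN.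
apply: eq_big_nat => i /andP[ki _]; rewrite ltnNge (ltnW ki) /= gtn_eqF// mulrN//.
Qed.

End helmert.

Section helmert_quadratic_forms.
Context {R : rcfType}.
Variables (d : nat) (d_gt0 : (0 < d)%N) (q_gt1 : (1 < d.+1)%N) (a b : R).
Hypotheses (ab_lt0 : d%:R * a + b < 0) (b_lt0 : (1 < d)%N -> b < 0).
Local Notation c1 := (color1 q_gt1).
Implicit Types (z : nat -> R) (u : 'cV[R]_d.+1).

Let d_gt0R : 0 < d%:R :> R. Proof. by rewrite ltr0n. Qed.
Let d_neq0 : d%:R != 0 :> R. Proof. by rewrite gt_eqF. Qed.

(** Minus the inverse of the coefficient of [helmert_coord z k ^+ 2] in the quadratic
    form with entries [a, b, ..., b]; the default 1 keeps it positive beyond [d]. *)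
Definition helmert_variance k : R :=
  if k == 0%N then - (a + b / d%:R)^-1
  else if (k < d)%N then - ((d - k)%:R / (b * (d.+1 - k)%:R)) else 1.

Lemma helmert_variance_gt0 k : 0 < helmert_variance k.
Proof.
rewrite /helmert_variance; have [_|k0] := eqVneq k 0%N.
  rewrite oppr_gt0 invr_lt0 -(pmulr_rlt0 _ d_gt0R) mulrDr mulrCA divff// mulr1.
  exact: ab_lt0.
case: ltnP => // kd; have d1 : (1 < d)%N by apply: leq_ltn_trans kd; rewrite lt0n.
rewrite oppr_gt0 pmulr_rlt0 ?ltr0n ?subn_gt0// invr_lt0 nmulr_rlt0 ?b_lt0//.
by rewrite ltr0n subn_gt0 ltnW.
Qed.

Lemma tail_var1 z : tail_var d z 1 =
  \sum_(i < d.+1) z i ^+ 2 - z 0%N ^+ 2 - (\sum_(i < d.+1) z i - z 0%N) ^+ 2 / d%:R.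
Proof.
rewrite /tail_var -(big_mkord xpredT z) -(big_mkord xpredT (fun i => z i ^+ 2)).
by rewrite !(big_ltn (ltn0Sn d)) subSS subn0 ![z 0%N + _]addrC ![z 0%N ^+ 2 + _]addrC !addrK.
Qed.

Lemma tail_var1E z : tail_var d z 1 =
  \sum_(1 <= j < d) (d - j)%:R / (d.+1 - j)%:R * tail_dev d z j ^+ 2.
Proof. by rewrite tail_varE. Qed.

Lemma tail_var_ge0 z k : (k <= d)%N -> 0 <= tail_var d z k.
Proof.
by move=> kd; rewrite tail_varE// sumr_ge0// => j _; rewrite mulr_ge0 ?sqr_ge0 ?divr_ge0.
Qed.

Lemma quadratic_form_split z : \sum_(i < d.+1) z i = 0 ->
  a * z 0%N ^+ 2 + b * (\sum_(i < d.+1) z i ^+ 2 - z 0%N ^+ 2) =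
  (a + b / d%:R) * z 0%N ^+ 2 + b * tail_var d z 1.
Proof. by move=> z0; rewrite tail_var1 z0; field. Qed.

(** Splitting off the first coordinate leaves [b] times an empirical variance, which
    Welford's formula diagonalizes. *)
Lemma quadratic_form_helmert z : \sum_(i < d.+1) z i = 0 ->
  a * z 0%N ^+ 2 + b * (\sum_(i < d.+1) z i ^+ 2 - z 0%N ^+ 2) =
  - \sum_(k < d) helmert_coord d z k ^+ 2 / helmert_variance k.
Proof.
move=> z0; rewrite quadratic_form_split// tail_var1E -(big_mkord xpredT (fun k =>
  helmert_coord d z k ^+ 2 / helmert_variance k)) (big_ltn d_gt0).
rewrite {1}/helmert_coord big_ord0 mul0r addr0 {1}/helmert_variance eqxx.
rewrite invrN invrK mulrN opprD opprK mulrC; congr (_ + _).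
rewrite mulr_sumr -sumrN; apply: eq_big_nat => k /andP[k1 kd].
rewrite helmert_coordE// /helmert_variance gtn_eqF// kd.
have b0 : b != 0 by rewrite lt_eqF// b_lt0// (leq_ltn_trans k1).
have : (d - k)%:R != 0 :> R by rewrite pnatr_eq0 -lt0n subn_gt0.
have : (d.+1 - k)%:R != 0 :> R by rewrite pnatr_eq0 -lt0n subn_gt0 ltnW.
by move: (d - k)%:R (d.+1 - k)%:R => D D' D0 D1; field; rewrite D0 D1 b0.
Qed.

Lemma quadratic_form_coercive : exists2 c, 0 < c & forall z, \sum_(i < d.+1) z i = 0 ->
  a * z 0%N ^+ 2 + b * (\sum_(i < d.+1) z i ^+ 2 - z 0%N ^+ 2) <=
  - (c * \sum_(i < d.+1) z i ^+ 2).
Proof.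
have abd : a + b / d%:R < 0.
  by rewrite -(pmulr_rlt0 _ d_gt0R) mulrDr mulrCA divff// mulr1.
have d1_gt0 : 0 < 1 + d%:R^-1 :> R by rewrite addr_gt0 ?invr_gt0.
pose c0 := - (a + b / d%:R) / (1 + d%:R^-1).
have c0_gt0 : 0 < c0 by rewrite divr_gt0 ?oppr_gt0.
pose c := if (1 < d)%N then Num.min c0 (- b) else c0.
have c_gt0 : 0 < c by rewrite /c; case: ifP => // d1; rewrite lt_min c0_gt0 oppr_gt0 b_lt0.
exists c => // z z0; rewrite quadratic_form_split//.
have W0 : 0 <= tail_var d z 1 by exact: tail_var_ge0.
have E : \sum_(i < d.+1) z i ^+ 2 = (1 + d%:R^-1) * z 0%N ^+ 2 + tail_var d z 1.
  by rewrite tail_var1 z0; field.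
have h1 : (a + b / d%:R) * z 0%N ^+ 2 <= - (c * ((1 + d%:R^-1) * z 0%N ^+ 2)).
  rewrite [leRHS](_ : _ = - (c * (1 + d%:R^-1)) * z 0%N ^+ 2); last by ring.
  rewrite ler_wpM2r ?sqr_ge0// lerNr -ler_pdivlMr//.
  by rewrite /c; case: ifP => // _; rewrite ge_min lexx.
have h2 : b * tail_var d z 1 <= - (c * tail_var d z 1).
  have [d1|d1] := ltnP 1 d.
    by rewrite -mulNr ler_wpM2r// lerNr /c d1 ge_min lexx orbT.
  have -> : tail_var d z 1 = 0 by rewrite tail_var1E big_geq.
  by rewrite !mulr0 oppr0.
by rewrite E [X in _ <= - X]mulrDr opprD; exact: lerD.
Qed.

Lemma sum_helmert_coord_sqr z : \sum_(i < d.+1) z i = 0 ->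
  \sum_(k < d) helmert_coord d z k ^+ 2 <= \sum_(i < d.+1) z i ^+ 2.
Proof.
move=> z0; have -> : \sum_(i < d.+1) z i ^+ 2 = tail_var d z 0.
  by rewrite /tail_var !big_mkord z0 expr0n mul0r subr0.
rewrite tail_varE// big_mkord; apply: ler_sum => k _.
rewrite helmert_coordE// exprMn ler_wpM2r ?sqr_ge0// expr2 ler_piMr ?divr_ge0//.
have D0 : 0 < (d.+1 - k)%:R :> R by rewrite ltr0n subn_gt0 ltnW ?ltnS.
by rewrite ler_pdivrMr// mul1r ler_nat leq_sub2r.
Qed.

(** The inverse, on zero-sum vectors, of minus the quadratic form with entries
    [a, b, ..., b] ([helmert_cov_stationary]). *)
Definition helmert_cov : 'M[R]_d.+1 :=
  (- (d%:R * a + b))^-1 *: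
  \matrix_(i, j)
    (if (i == c1) && (j == c1) then d%:R
     else if (i == c1) || (j == c1) then -1
     else if i == j then 1 + (d%:R - 1) * (a / b)
     else - (a / b)).

Lemma helmert_cov_mul u i : (helmert_cov *m u) i 0 =
  (- (d%:R * a + b))^-1 *
  (if i == c1 then d.+1%:R * u c1 0 - \sum_j u j 0
   else - u c1 0 + (1 + d%:R * (a / b)) * u i 0 - a / b * (\sum_j u j 0 - u c1 0)).
Proof.
rewrite mxE (bigD1 c1) //= [in RHS](bigD1 c1) //= !mxE eqxx andbT orbT.
have [->|ic] := eqVneq i c1.
  rewrite (eq_bigr (fun j => (- (d%:R * a + b))^-1 * - u j 0)) => [|j jc]; last first.
    by rewrite !mxE eqxx (negbTE jc) /= -mulrA mulN1r.
  by rewrite -mulr_sumr sumrN -natr1; ring.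
rewrite (bigD1 i) //= [in RHS](bigD1 i) //= !mxE (negbTE ic) eqxx /=.
rewrite (eq_bigr (fun j => (- (d%:R * a + b))^-1 * (- (a / b) * u j 0))) => [|j /andP[jc ji]].
  by rewrite -!mulr_sumr; ring.
by rewrite !mxE (negbTE ic) (negbTE jc) eq_sym (negbTE ji) /= mulrA.
Qed.

Lemma helmert_cov_sym : helmert_cov^T = helmert_cov.
Proof.
apply/matrixP => i j; rewrite !mxE andbC orbC; congr (_ * _).
by case: ifP => // _; case: ifP => // _; rewrite eq_sym.
Qed.


Lemma helmert_cov_mul_sum0 u : \sum_i (helmert_cov *m u) i 0 = 0.
Proof.
rewrite (bigD1 c1) //= (eq_bigr (fun i => (- (d%:R * a + b))^-1 * (- u c1 0 +
   (1 + d%:R * (a / b)) * u i 0 - a / b * (\sum_j u j 0 - u c1 0)))); last first.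
  by move=> i ic; rewrite helmert_cov_mul (negbTE ic).
have S (F : 'I_d.+1 -> R) : \sum_(i | i != c1) F i = \sum_i F i - F c1.
  by rewrite [in RHS](bigD1 c1) //= addrAC subrr add0r.
have T (A C e : R) : \sum_i (- e + A * u i 0 - C) = A * (\sum_i u i 0) - d.+1%:R * (e + C).
  rewrite mulr_sumr mulr_natl -[in X in _ *+ X](card_ord d.+1) -sumr_const -sumrB.
  by apply: eq_bigr => i _; ring.
rewrite helmert_cov_mul eqxx S -mulr_sumr T -natr1.
by move: (\sum_j _) (u _ _) (_^-1) => T' e f; ring.
Qed.

(** The image of [u] is the critical point of half the quadratic form plus the linear
    form [u] among zero-sum vectors: the gradient there is a constant vector. *)
Lemma helmert_cov_stationary u (z : 'cV[R]_d.+1) : \sum_i z i 0 = 0 ->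
  \sum_i ((if i == c1 then a else b) * (helmert_cov *m u) i 0 + u i 0) * z i 0 = 0.
Proof.
move=> z0; pose w := (- (d%:R * a + b))^-1 * - a.
pose C := w * (\sum_j u j 0 - u c1 0) - (- (d%:R * a + b))^-1 * b * u c1 0.
rewrite (eq_bigr (fun i => C * z i 0)) => [|i _]; first by rewrite -mulr_sumr z0 mulr0.
congr (_ * _); rewrite helmert_cov_mul /C /w.
have den0 : d%:R * a + b != 0 by rewrite lt_eqF.
case: (eqVneq i c1) => [->|ic].
  rewrite -natr1; move: (\sum_j _) (u _ _) => T e; move: den0; move: d%:R => D den0.
  by field.
have [d1|] := ltnP 1 d.
  have b0 : b != 0 by rewrite lt_eqF// b_lt0.
  move: (\sum_j _) (u c1 0) (u i 0) => T e f; move: den0; move: d%:R => D den0.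
  by field; rewrite den0 b0.
(* For [d = 1] the ratio [a / b] may be a division by 0; it cancels because the sum of
   the entries other than the first has a single term. *)
rewrite leq_eqVlt ltnS leqn0 [d == 0%N]gtn_eqF// orbF => /eqP dE.
have S : \sum_j u j 0 - u c1 0 = u i 0.
  rewrite (bigD1 c1) //= (bigD1 i) //= addrAC subrr add0r big1 ?addr0// => j /andP[jc ji].
  move: jc ji ic; rewrite -!val_eqE /=.
  have : (j < 2)%N by apply: leq_trans (ltn_ord _) _; rewrite dE.
  have : (i < 2)%N by apply: leq_trans (ltn_ord _) _; rewrite dE.
  by case: (nat_of_ord i) => [|[|?]]; case: (nat_of_ord j) => [|[|?]].
rewrite S; move: den0; rewrite (_ : d%:R = 1); last by rewrite dE.
rewrite !mul1r; move: (u c1 0) (u i 0) (a / b) => e f r den0.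
by field.
Qed.

(** Equality of the quadratic forms of the matrix and of
    [\sum_k helmert_variance k *: (v_k v_k^T)], the covariance of a Gaussian walk along
    the Helmert vectors. *)
Lemma helmert_cov_dot u : (u^T *m helmert_cov *m u) 0 0 =
  \sum_(k < d) helmert_variance k * ((u^T *m @helmert_vec R d k) 0 0) ^+ 2.
Proof.
pose z k := u (inord k) 0.
have zE (i : 'I_d.+1) : z i = u i 0 by rewrite /z inord_val.
have devE k : (k < d)%N -> (u^T *m @helmert_vec R d k) 0 0 = tail_dev d z k.
  move=> kd; rewrite -dot_helmert_vec// mxE; apply: eq_bigr => i _.
  by rewrite mxE zE.
rewrite (eq_bigr (fun k : 'I_d => helmert_variance k * tail_dev d z k ^+ 2)); last first.
  by move=> k _; rewrite devE.
rewrite -(big_mkord xpredT (fun k => helmert_variance k * tail_dev d z k ^+ 2)).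
rewrite (big_ltn d_gt0) {1}/helmert_variance eqxx.
have b0 : (1 < d)%N -> b != 0 by move=> d1; rewrite lt_eqF// b_lt0.
have -> : \sum_(1 <= k < d) helmert_variance k * tail_dev d z k ^+ 2 =
    - b^-1 * tail_var d z 1.
  rewrite tail_var1E mulr_sumr; apply: eq_big_nat => k /andP[k1 kd].
  rewrite /helmert_variance gtn_eqF// kd [RHS]mulrA; congr (_ * _).
  have : (d.+1 - k)%:R != 0 :> R by rewrite pnatr_eq0 -lt0n subn_gt0 ltnW.
  have {}b0 := b0 (leq_ltn_trans k1 kd).
  by move: (d - k)%:R (d.+1 - k)%:R => D D' D0; field; rewrite D0 b0.
have zs : \sum_(i < d.+1) z i = \sum_i u i 0 by apply: eq_bigr => i _.
have z0 : z 0%N = u c1 0 by rewrite -zE.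
pose g := (- (d%:R * a + b))^-1; pose r := a / b.
pose S := \sum_j u j 0 - u c1 0.
have sumF (F : 'I_d.+1 -> R) : \sum_(i | i != c1) F i = \sum_i F i - F c1.
  by rewrite [in RHS](bigD1 c1) //= addrAC subrr add0r.
have WE : tail_var d z 1 = \sum_(i | i != c1) u i 0 ^+ 2 - S ^+ 2 / d%:R.
  rewrite tail_var1 zs z0 sumF; congr (_ - _ - _).
  by apply: eq_bigr => i _; rewrite zE.
have SE : \sum_(1 <= i < d.+1) z i = S.
  by rewrite /S -zs -z0 -(big_mkord xpredT) (big_ltn (ltn0Sn d)) addrAC subrr add0r.
have -> : (u^T *m helmert_cov *m u) 0 0 =
    g * (d%:R * u c1 0 ^+ 2 - 2 * u c1 0 * S + (1 + d%:R * r) * \sum_(i | i != c1) u i 0 ^+ 2 - r * S ^+ 2).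
  rewrite -mulmxA mxE (eq_bigr (fun i => u i 0 * (helmert_cov *m u) i 0)); last first.
    by move=> i _; rewrite mxE.
  rewrite (bigD1 c1) //= helmert_cov_mul eqxx.
  have -> : \sum_(i | i != c1) u i 0 * (helmert_cov *m u) i 0 =
      g * (- u c1 0 * S + (1 + d%:R * r) * (\sum_(i | i != c1) u i 0 ^+ 2) - r * S * S).
    have SE' : S = \sum_(i | i != c1) u i 0 by rewrite sumF.
    rewrite [X in - u c1 0 * X]SE' [X in r * S * X]SE'.
    rewrite !mulr_sumr -big_split -sumrB mulr_sumr /=.
    apply: eq_bigr => i ic; rewrite helmert_cov_mul (negbTE ic) -/S -/g -/r; ring.
  have ST : \sum_j u j 0 = S + u c1 0 by rewrite subrK.
  rewrite -/g ST -natr1; ring.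
rewrite (_ : \sum_(i | i != c1) u i 0 ^+ 2 = tail_var d z 1 + S ^+ 2 / d%:R); last first.
  by rewrite WE subrK.
rewrite /tail_dev SE subn0 z0.
have -> : - (a + b / d%:R)^-1 = g * d%:R.
  by rewrite /g; field; rewrite d_neq0 /= lt_eqF.
have -> : - b^-1 * tail_var d z 1 = g * (1 + d%:R * r) * tail_var d z 1.
  have [d1|d1] := ltnP 1 d; last by rewrite [tail_var d z 1]tail_var1E big_geq// !mulr0.
  congr (_ * _); rewrite /g /r; field; by rewrite b0//= lt_eqF.
by field.
Qed.

End helmert_quadratic_forms.

(** * The free energy near its maximizer *)

Section model_derivatives.
Context {R : realType}.
Variables (p d : nat) (p_gt1 : (1 < p)%N) (q_gt1 : (1 < d.+1)%N) (beta h : R).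
Local Notation c1 := (color1 q_gt1).
Local Notation k := (k_potts p beta).
Local Notation k1 := (k_der p beta).
Local Notation k2 := (k_der2 p beta).
Local Notation H := (neg_free_energy p q_gt1 beta h).

Definition first_coord (s : R) : R := (1 + (d.+1%:R - 1) * s) / d.+1%:R.
Definition other_coord (s : R) : R := (1 - s) / d.+1%:R.

Let d_gt0R : 0 < d%:R :> R. Proof. by rewrite ltr0n -ltnS. Qed.

Lemma neg_free_energyE (t : 'cV[R]_d.+1) : H t = \sum_r k (t r 0) + h * t c1 0.
Proof.
by rewrite /neg_free_energy /k_potts sumrB -mulr_sumr; ring.
Qed.

Lemma sum_xvec (F : R -> R) (s : R) :
  \sum_r F (xvec q_gt1 s r 0) = F (first_coord s) + d%:R * F (other_coord s).
Proof.
rewrite (bigD1 c1) //= mxE eqxx; congr (_ + _).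
rewrite (eq_bigr (fun=> F (other_coord s))) => [|i ic]; last by rewrite mxE (negbTE ic).
by rewrite sumr_const mulr_natl cardC1 card_ord.
Qed.

Lemma xvecE s r : xvec q_gt1 s r 0 = if r == c1 then first_coord s else other_coord s.
Proof. by rewrite mxE. Qed.

Lemma f_pottsE s : f_potts p q_gt1 beta h s =
  k (first_coord s) + d%:R * k (other_coord s) + h * first_coord s.
Proof. by rewrite /f_potts neg_free_energyE sum_xvec xvecE eqxx. Qed.

Lemma first_coord_gt0 s : - d%:R^-1 < s -> 0 < first_coord s.
Proof.
move=> ds; rewrite divr_gt0// -natr1 addrK.
by rewrite -(ltr_pM2l d_gt0R) mulrN divff ?gt_eqF// in ds; lra.
Qed.

Lemma other_coord_gt0 s : s < 1 -> 0 < other_coord s.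
Proof. by move=> s1; rewrite divr_gt0// subr_gt0. Qed.

Lemma prob_vectors_xvec s : - d%:R^-1 < s -> s < 1 -> @prob_vectors R d.+1 (xvec q_gt1 s).
Proof.
move=> s0 s1; split=> [r|].
  by rewrite xvecE; case: ifP => _; apply/ltW; [exact: first_coord_gt0|exact: other_coord_gt0].
rewrite (sum_xvec id) /first_coord /other_coord -natr1; by field.
Qed.

Lemma is_derive_first_coord (s : R) :
  is_derive s 1 first_coord (d%:R / d.+1%:R).
Proof.
apply: is_derive_eq; rewrite /GRing.scale /= -natr1; by field.
Qed.

Lemma is_derive_other_coord (s : R) : is_derive s 1 other_coord (- d.+1%:R^-1).
Proof.
apply: is_derive_eq; rewrite /GRing.scale /= -natr1; by field.
Qed.

Definition f_der (s : R) : R :=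
  d%:R / d.+1%:R * (k1 (first_coord s) + h - k1 (other_coord s)).

Lemma is_derive_f_potts (s : R) : - d%:R^-1 < s -> s < 1 ->
  is_derive s 1 (f_potts p q_gt1 beta h) (f_der s).
Proof.
move=> s0 s1; rewrite (_ : f_potts _ _ _ _ = fun s =>
  (k \o first_coord) s + d%:R * (k \o other_coord) s + h * first_coord s); last first.
  by apply/funext => x; rewrite f_pottsE.
have e1 := is_derive_first_coord s.
have e2 := is_derive1_comp (is_derive_k p beta (first_coord_gt0 s0)) e1.
have e3 := is_derive1_comp (is_derive_k p beta (other_coord_gt0 s1)) (is_derive_other_coord s).
apply: is_derive_eq; rewrite /GRing.scale /= /f_der; ring.
Qed.

(** For [- d^-1 < s < 1] the points [xvec s] stay in the open simplex, so these
    derivatives are two-sided also at [s = 0]. *)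
Lemma derive2_f_potts (s : R) : - d%:R^-1 < s -> s < 1 ->
  derive1n 2 (f_potts p q_gt1 beta h) s =
  d%:R / d.+1%:R ^+ 2 * (d%:R * k2 (first_coord s) + k2 (other_coord s)).
Proof.
move=> s0 s1 /=; rewrite derive1E.
have E : {near s, f_der =1 (f_potts p q_gt1 beta h)^`()%classic}.
  near=> x; have x0 : - d%:R^-1 < x by near: x; exact: lt_nbhsr.
  have x1 : x < 1 by near: x; exact: lt_nbhsl.
  by have := is_derive_f_potts x0 x1; rewrite derive1E => D; rewrite derive_val.
have e1 := is_derive1_comp (is_derive_k_der beta p_gt1 (first_coord_gt0 s0)) (is_derive_first_coord s).
have e2 := is_derive1_comp (is_derive_k_der beta p_gt1 (other_coord_gt0 s1)) (is_derive_other_coord s).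
have e3 : is_derive s 1 f_der (d%:R / d.+1%:R ^+ 2 *
    (d%:R * k2 (first_coord s) + k2 (other_coord s))).
  rewrite (_ : f_der = fun s => d%:R / d.+1%:R *
    ((k1 \o first_coord) s + h - (k1 \o other_coord) s))//.
  by apply: is_derive_eq; rewrite /GRing.scale /=; field; rewrite gt_eqF.
have D := near_eq_is_derive E e3.
by rewrite derive_val.
Unshelve. all: by end_near. Qed.

Variable s : R.
Hypotheses (s_ge0 : 0 <= s) (s_lt1 : s < 1).
Hypothesis max_s : unique_maximizer p q_gt1 beta h (xvec q_gt1 s).

Let s_gt : - d%:R^-1 < s.
Proof. by apply: lt_le_trans s_ge0; rewrite oppr_lt0 invr_gt0. Qed.

(** Interior stationarity: the two-sided derivative of the restriction of the
    functional to the curve [xvec] vanishes, because [xvec] stays in the simplex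
    slightly below [0]. *)
Lemma maximizer_stationary : k1 (first_coord s) + h = k1 (other_coord s).
Proof.
have sI : s \in `]- d%:R^-1, 1[ by rewrite in_itv /= s_gt s_lt1.
have D0 : is_derive s 1 (f_potts p q_gt1 beta h) 0.
  apply: (@derive1_at_max _ _ (- d%:R^-1) 1) sI _.
  - by rewrite ltW// (lt_trans s_gt).
  - by move=> t; rewrite in_itv /= => /andP[t0 t1]; have [] := is_derive_f_potts t0 t1.
  - move=> t; rewrite in_itv /= => /andP[t0 t1].
    have [[_ M] _] := max_s; exact/M/prob_vectors_xvec.
have D1 := is_derive_f_potts s_gt s_lt1.
have : f_der s = 0 by rewrite -(@derive_val _ _ _ _ _ _ _ D1) (@derive_val _ _ _ _ _ _ _ D0).
move/eqP; rewrite mulf_eq0 gt_eqF ?divr_gt0//= subr_eq0 => /eqP//.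
Qed.

Hypothesis reg : regular p q_gt1 beta h.

Lemma regular_neg (t : 'cV[R]_d.+1) : @zero_sum R d.+1 t -> t != 0 ->
  k2 (first_coord s) * t c1 0 ^+ 2 +
  k2 (other_coord s) * (\sum_r t r 0 ^+ 2 - t c1 0 ^+ 2) < 0.
Proof.
have [m [[mM mU] neg]] := reg; have [sM _] := max_s.
move=> t0 tn0; have := neg _ t0 tn0; rewrite (mU _ sM).
rewrite /hessian_form (bigD1 c1) //= [X in _ -> _ + _ * (X - _) < _](bigD1 c1) //=.
rewrite addrAC subrr add0r !xvecE eqxx mulr_sumr; congr (_ + _ < _).
by apply: eq_bigr => r rc; rewrite xvecE (negbTE rc).
Qed.

(** Regularity tested on the direction of the curve [xvec]. *)
Lemma regular_sum_lt0 : d%:R * k2 (first_coord s) + k2 (other_coord s) < 0.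
Proof.
pose t : 'cV[R]_d.+1 := \col_r (if r == c1 then d%:R else -1).
have tc : t c1 0 = d%:R by rewrite mxE eqxx.
have sumt (F : R -> R) : \sum_r F (t r 0) = F d%:R + d%:R * F (-1).
  rewrite (bigD1 c1) //= tc; congr (_ + _).
  rewrite (eq_bigr (fun=> F (-1))) => [|i ic]; last by rewrite mxE (negbTE ic).
  by rewrite sumr_const mulr_natl cardC1 card_ord.
have t0 : @zero_sum R d.+1 t by rewrite /zero_sum /= (sumt id) mulrN1 subrr.
have tn0 : t != 0.
  by apply/negP => /eqP/matrixP/(_ c1 0); rewrite tc mxE => /eqP; rewrite gt_eqF.
have := regular_neg t0 tn0; rewrite tc (sumt (fun x => x ^+ 2)).
rewrite (_ : _ + _ = d%:R * (d%:R * k2 (first_coord s) + k2 (other_coord s))).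
  by rewrite pmulr_rlt0.
by ring.
Qed.

(** Regularity tested on the difference of two basis vectors other than the first;
    two such vectors exist only for [1 < d]. *)
Lemma regular_other_lt0 : (1 < d)%N -> k2 (other_coord s) < 0.
Proof.
move=> d1; pose i1 : 'I_d.+1 := inord 1; pose i2 : 'I_d.+1 := inord 2.
have v1 : i1 = 1%N :> nat by rewrite inordK.
have v2 : i2 = 2%N :> nat by rewrite inordK.
have i12 : i2 != i1 by rewrite -val_eqE /= v1 v2.
have ic1 : i1 != c1 by rewrite -val_eqE /= v1.
have ic2 : i2 != c1 by rewrite -val_eqE /= v2.
pose t : 'cV[R]_d.+1 := \col_r (if r == i1 then 1 else if r == i2 then -1 else 0).
have t1 : t i1 0 = 1 by rewrite mxE eqxx.
have t2 : t i2 0 = -1 by rewrite mxE (negbTE i12) eqxx.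
have tc : t c1 0 = 0 by rewrite mxE eq_sym (negbTE ic1) eq_sym (negbTE ic2).
have sumt (F : R -> R) : F 0 = 0 -> \sum_r F (t r 0) = F 1 + F (-1).
  move=> F0; rewrite (bigD1 i1) //= t1 (bigD1 i2) //= t2 big1 ?addr0// => r /andP[r1 r2].
  by rewrite mxE (negbTE r1) (negbTE r2).
have t0 : @zero_sum R d.+1 t by rewrite /zero_sum /= (sumt id)// subrr.
have tn0 : t != 0.
  by apply/negP => /eqP/matrixP/(_ i1 0); rewrite t1 mxE => /eqP; rewrite oner_eq0.
have := regular_neg t0 tn0.
rewrite tc (sumt (fun x => x ^+ 2)) ?expr0n// expr1n sqrrN expr1n mulr0 add0r subr0.
by rewrite pmulr_llt0// addr_gt0.
Qed.

End model_derivatives.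

Section free_energy_gap.
Context {R : realType}.
Variables (p d : nat) (p_gt1 : (1 < p)%N) (q_gt1 : (1 < d.+1)%N) (beta h : R).
Local Notation c1 := (color1 q_gt1).
Local Notation k := (k_potts p beta).
Local Notation k1 := (k_der p beta).
Local Notation k2 := (k_der2 p beta).
Local Notation H := (neg_free_energy p q_gt1 beta h).
Variable s : R.
Hypotheses (s_ge0 : 0 <= s) (s_lt1 : s < 1).
Hypothesis max_s : unique_maximizer p q_gt1 beta h (xvec q_gt1 s).
Hypothesis reg : regular p q_gt1 beta h.
Local Notation m := (xvec q_gt1 s).
Local Notation a := (k2 (first_coord d s)).
Local Notation b := (k2 (other_coord d s)).

Let d_gt0 : (0 < d)%N. Proof. by rewrite -ltnS. Qed.

Let s_gt : - d%:R^-1 < s.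
Proof. by apply: lt_le_trans s_ge0; rewrite oppr_lt0 invr_gt0 ltr0n. Qed.

Lemma xvec_gt0 r : 0 < m r 0.
Proof.
by rewrite xvecE; case: ifP => _; [exact: first_coord_gt0|exact: other_coord_gt0].
Qed.

Lemma sum_xvec1 : \sum_r m r 0 = 1.
Proof. by have [_ ->] := prob_vectors_xvec q_gt1 s_gt s_lt1. Qed.

(** The first-order terms cancel: by stationarity the partial derivatives of the free
    energy at [m] are all equal, and [t - m] sums to zero. *)
Lemma local_expansion (e : R) : 0 < e -> exists2 dl : R, 0 < dl &
  forall t : 'cV[R]_d.+1, \sum_r t r 0 = 1 -> (forall r, `|t r 0 - m r 0| < dl) ->
  `|H t - H m - (a * (t c1 0 - m c1 0) ^+ 2 + b * (\sum_r (t r 0 - m r 0) ^+ 2 -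
     (t c1 0 - m c1 0) ^+ 2)) / 2| <= e * \sum_r (t r 0 - m r 0) ^+ 2.
Proof.
move=> e0.
have loc (x0 : R) : 0 < x0 -> exists2 dl, 0 < dl & forall x, `|x - x0| < dl ->
    `|k x - k x0 - k1 x0 * (x - x0) - k2 x0 / 2 * (x - x0) ^+ 2| <= e * (x - x0) ^+ 2.
  move=> x0_gt0.
  apply: (taylor_order2 x0_gt0 _ (is_derive_k_der beta p_gt1 x0_gt0) e0) => x xx0.
  by apply: is_derive_k; move: xx0; rewrite ltr_norml => /andP[]; lra.
have [d1 d1_gt0 D1] := loc _ (first_coord_gt0 q_gt1 s_gt).
have [d2 d2_gt0 D2] := loc _ (other_coord_gt0 d s_lt1).
exists (Num.min d1 d2); first by rewrite lt_min d1_gt0.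
move=> t t1 tm.
pose err r := k (t r 0) - k (m r 0) - k1 (m r 0) * (t r 0 - m r 0)
  - k2 (m r 0) / 2 * (t r 0 - m r 0) ^+ 2.
have errP r : `|err r| <= e * (t r 0 - m r 0) ^+ 2.
  have := tm r; rewrite lt_min /err => /andP[h1 h2]; move: h1 h2; rewrite !xvecE.
  by case: ifP => _ h1 h2; [exact: D1|exact: D2].
set X := (X in `|X|); have -> : X = \sum_r err r.
  rewrite /X !neg_free_energyE /err !sumrB.
  have stat := maximizer_stationary s_ge0 s_lt1 max_s.
  have -> : \sum_r k1 (m r 0) * (t r 0 - m r 0) = - (h * (t c1 0 - m c1 0)).
    have sum0 : \sum_r (t r 0 - m r 0) = 0 by rewrite sumrB t1 sum_xvec1 subrr.
    rewrite (bigD1 c1) //= in sum0; rewrite (bigD1 c1) //=.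
    rewrite (eq_bigr (fun r => k1 (other_coord d s) * (t r 0 - m r 0))) => [|r rc].
      rewrite -mulr_sumr [m c1 0]xvecE eqxx -stat.
      by move/eqP: sum0; rewrite addrC addr_eq0 xvecE eqxx => /eqP ->; ring.
    by rewrite xvecE (negbTE rc).
  have -> : \sum_r k2 (m r 0) / 2 * (t r 0 - m r 0) ^+ 2 =
      (a * (t c1 0 - m c1 0) ^+ 2 + b * (\sum_r (t r 0 - m r 0) ^+ 2 -
      (t c1 0 - m c1 0) ^+ 2)) / 2.
    rewrite (bigD1 c1) //= [in RHS](bigD1 c1) //= [X in b * X]addrAC subrr add0r.
    rewrite (eq_bigr (fun r => b / 2 * (t r 0 - m r 0) ^+ 2)) => [|r rc].
      by rewrite -mulr_sumr [m c1 0]xvecE eqxx; ring.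
    by rewrite xvecE (negbTE rc).
  by ring.
apply: le_trans (ler_norm_sum _ _ _) _; rewrite mulr_sumr.
exact: ler_sum.
Qed.

Lemma coordinate_extension (z : 'cV[R]_d.+1) (F : R -> R) :
  \sum_(i < d.+1) F (z (inord i) 0) = \sum_r F (z r 0).
Proof. by apply: eq_bigr => i _; rewrite inord_val. Qed.

Lemma quadratic_coercive : exists2 c : R, 0 < c & forall z : 'cV[R]_d.+1,
  \sum_r z r 0 = 0 ->
  a * z c1 0 ^+ 2 + b * (\sum_r z r 0 ^+ 2 - z c1 0 ^+ 2) <= - (c * \sum_r z r 0 ^+ 2).
Proof.
have [c c0 Hc] := quadratic_form_coercive d_gt0
  (regular_sum_lt0 max_s reg) (regular_other_lt0 max_s reg).
exists c => // z z0; have := Hc (fun i => z (inord i) 0).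
rewrite (coordinate_extension z id) (coordinate_extension z (fun x => x ^+ 2)).
have -> : z (inord 0) 0 = z c1 0 by congr (z _ 0); apply: val_inj; rewrite /= inordK.
exact.
Qed.

Lemma continuous_free_energy : continuous (fun v : 'rV[R]_d.+1 => H v^T).
Proof.
rewrite (_ : (fun _ => _) = fun v : 'rV[R]_d.+1 => \sum_r k (v 0 r) + h * v 0 c1); last first.
  apply/funext => v; rewrite neg_free_energyE mxE; congr (_ + _).
  by apply: eq_bigr => r _; rewrite mxE.
have kc : continuous k.
  move=> x; apply: cvgB; last exact: continuous_xlnx.
  by apply: cvgM; [exact: cvg_cst|exact: exprn_continuous].
have coord (v : 'rV[R]_d.+1) r : w 0 r @[w --> v] --> v 0 r by exact: coord_continuous.
suff cG (v : 'rV[R]_d.+1) : \sum_r k (w 0 r) + h * w 0 c1 @[w --> v] -->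
    \sum_r k (v 0 r) + h * v 0 c1 by move=> v; exact: cG.
apply: cvgD; last by apply: cvgM; [exact: cvg_cst|exact: coord].
by apply: cvg_bigsum => r _; apply: continuous_cvg; [exact: kc|exact: coord].
Qed.

(** Near [m] the expansion and the negative definiteness of its quadratic part give the
    bound. Away from [m] the maximum over a compact set is smaller than [H m] by
    uniqueness, while the distance to [m] stays bounded on the simplex. *)
Lemma free_energy_gap : exists2 c, 0 < c & forall t, prob_vectors t ->
  H t - H m <= - (c * \sum_r (t r 0 - m r 0) ^+ 2).
Proof.
have [c c0 Hc] := quadratic_coercive.
(* The quadratic part contributes [- c / 2], of which the error may take one half. *)
have c4 : 0 < c / 4 by rewrite divr_gt0.
have [dl dl0 loc] := local_expansion c4.
pose dist (v : 'rV[R]_d.+1) := \sum_r (v 0 r - m r 0) ^+ 2.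
have cdist : continuous dist.
  have coord (v : 'rV[R]_d.+1) r : w 0 r @[w --> v] --> v 0 r by exact: coord_continuous.
  suff cd (v : 'rV[R]_d.+1) : \sum_r (w 0 r - m r 0) ^+ 2 @[w --> v] -->
      \sum_r (v 0 r - m r 0) ^+ 2 by move=> v; exact: cd.
  apply: cvg_bigsum => r _.
  apply: (continuous_cvg _ (h := fun x : R => x ^+ 2)); first exact: exprn_continuous.
  by apply: cvgB; [exact: coord|exact: cvg_cst].
pose K := [set v : 'rV[R]_d.+1 | prob_vectors v^T /\ dl ^+ 2 <= dist v].
have local t : prob_vectors t -> dist t^T < dl ^+ 2 ->
    H t - H m <= - (c / 4 * \sum_r (t r 0 - m r 0) ^+ 2).
  move=> [t0 t1] td.
  have td' : \sum_r (t r 0 - m r 0) ^+ 2 < dl ^+ 2.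
    by move: td; rewrite /dist; under eq_bigr => r _ do rewrite [t^T _ _]mxE.
  have tr r : `|t r 0 - m r 0| < dl.
    rewrite -(@ltr_pXn2r _ 2) ?nnegrE ?(ltW dl0)// real_normK ?num_real//.
    apply: le_lt_trans td'; rewrite (bigD1 r) //= lerDl.
    by apply: sumr_ge0 => i _; exact: sqr_ge0.
  have := loc t t1 tr; rewrite ler_norml => /andP[_ up].
  have := Hc (t - m); have -> : \sum_r (t - m) r 0 = 0.
    transitivity (\sum_r (t r 0 - m r 0)); first by apply: eq_bigr => r _; rewrite !mxE.
    by rewrite sumrB t1 sum_xvec1 subrr.
  move=> /(_ erefl).
  have E : \sum_r (t - m) r 0 ^+ 2 = \sum_r (t r 0 - m r 0) ^+ 2.
    by apply: eq_bigr => r _; rewrite !mxE.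
  rewrite E (_ : (t - m) c1 0 = t c1 0 - m c1 0); last by rewrite !mxE.
  move=> quad; move: up quad; move: (\sum_r _) (H t) (H m) => S Ht Hm; lra.
have [K0|/set0P Kne] := eqVneq K set0.
  exists (c / 4) => // t tP; apply: local => //; rewrite ltNge; apply/negP => td.
  suff : K t^T by rewrite K0.
  by split; rewrite ?trmxK.
have prob_le1 (t : 'cV[R]_d.+1) r : prob_vectors t -> t r 0 <= 1.
  move=> [t0 <-]; rewrite (bigD1 r) //= lerDl.
  by apply: sumr_ge0 => i _; exact: t0.
have Kcomp : compact K.
  apply: bounded_closed_compact.
    exists 1; split; first exact: num_real.
    move=> M M1 v [vP _]; change (mx_norm v <= M); rewrite mx_normrE; apply: bigmax_le.
      exact: le_trans (ltW M1).
    move=> [i r] _; rewrite ord1 /= ger0_norm.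
      by have := prob_le1 _ r vP; rewrite mxE => /le_trans; apply; exact: ltW.
    by have [v0 _] := vP; have := v0 r; rewrite mxE.
  rewrite (_ : K = \bigcap_(r in setT) [set v : 'rV[R]_d.+1 | 0 <= v 0 r] `&`
      ([set v : 'rV[R]_d.+1 | \sum_r v 0 r = 1] `&` [set v | dl ^+ 2 <= dist v])); last first.
    apply/seteqP; split=> v /=.
      move=> [[v0 v1] vd]; split; first by move=> r _; have := v0 r; rewrite /= mxE.
      by split=> //; rewrite -v1; apply: eq_bigr => r _; rewrite mxE.
    move=> [v0 [v1 vd]]; split=> //; split; first by move=> r; rewrite mxE; exact: v0.
    by rewrite -v1; apply: eq_bigr => r _; rewrite mxE.
  apply: closedI; last apply: closedI.
  - apply: closed_bigI => r _.
    by apply: (@preimage_closed _ _ (fun v : 'rV[R]_d.+1 => v 0 r) [set x | 0 <= x]);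
      [move=> v _; exact: coord_continuous|exact: closed_ge].
  - apply: (@preimage_closed _ _ (fun v : 'rV[R]_d.+1 => \sum_r v 0 r) [set x | x = 1]);
      last exact: closed_eq.
    suff cs (v : 'rV[R]_d.+1) : \sum_r w 0 r @[w --> v] --> \sum_r v 0 r.
      by move=> v _; exact: cs.
    by apply: cvg_bigsum => r _; exact: coord_continuous.
  - by apply: (@preimage_closed _ _ dist [set x | dl ^+ 2 <= x]); [move=> v _; exact: cdist|exact: closed_ge].
have [v vK vmax] := compact_EVT_max Kne Kcomp (continuous_subspaceT continuous_free_energy).
rewrite inE in vK; have [vP vd] := vK.
have gap : H v^T < H m.
  have [[_ mmax] muniq] := max_s.
  rewrite lt_def (mmax _ vP) andbT; apply/eqP => Hv.
  have : m = v^T by apply: muniq; split=> // t tP; rewrite -Hv mmax.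
  move=> mv; move: vd; rewrite /dist big1 => [|r _]; last by rewrite mv [v^T _ _]mxE subrr expr0n.
  by rewrite leNgt exprn_gt0.
have B r (t : 'cV[R]_d.+1) : prob_vectors t -> (t r 0 - m r 0) ^+ 2 <= 1.
  move=> tP; have [t0 _] := tP; have := t0 r; have := prob_le1 _ r tP.
  have mP := prob_vectors_xvec q_gt1 s_gt s_lt1.
  have := xvec_gt0 r; have := prob_le1 _ r mP.
  rewrite -real_normK ?num_real// expr_le1// ler_norml.
  by move=> ? ? ? ?; apply/andP; split; lra.
(* By [B] the squared distance to [m] is at most [d.+1] on the simplex. *)
exists (Num.min (c / 4) ((H m - H v^T) / d.+1%:R)).
  by rewrite lt_min c4 divr_gt0 ?subr_gt0.
move=> t tP.
have S0 : 0 <= \sum_r (t r 0 - m r 0) ^+ 2 by apply: sumr_ge0 => i _; exact: sqr_ge0.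
have [td|td] := ltP (dist t^T) (dl ^+ 2).
  apply: le_trans (local t tP td) _; rewrite lerN2 ler_wpM2r//.
  by rewrite ge_min lexx.
have tK : t^T \in K by rewrite inE; split; rewrite ?trmxK.
have := vmax _ tK; rewrite trmxK => Htv.
apply: (@le_trans _ _ (- ((H m - H v^T) / d.+1%:R * \sum_r (t r 0 - m r 0) ^+ 2))).
  rewrite -[H t - H m]opprB lerN2 mulrAC ler_pdivrMr//.
  apply: (@le_trans _ _ ((H m - H v^T) * d.+1%:R)).
    rewrite ler_wpM2l ?subr_ge0 ?(ltW gap)//.
    apply: le_trans (ler_sum _ (fun r _ => B r t tP)) _.
    by rewrite sumr_const card_ord.
  by rewrite ler_wpM2r// lerB.
by rewrite lerN2 ler_wpM2r// ge_min lexx orbT.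
Qed.

End free_energy_gap.

(** * The law of the counts *)

Section log_weight.
Context {R : realType}.
Variables (p d : nat) (q_gt1 : (1 < d.+1)%N) (beta h bbar hbar : R) (m : 'cV[R]_d.+1).
Local Notation c1 := (color1 q_gt1).
Local Notation H := (neg_free_energy p q_gt1 beta h).
Implicit Types (N : nat) (nu : 'I_d.+1 -> nat).

Definition freq N nu : 'cV[R]_d.+1 := \col_r ((nu r)%:R / N%:R).

Definition count_weight N nu : R :=
  expR ((beta + (Num.sqrt N%:R)^-1 * bbar) * N%:R * (\sum_r freq N nu r 0 ^+ p) +
        N%:R * (h + (Num.sqrt N%:R)^-1 * hbar) * freq N nu c1 0).

Definition log_norm N : R :=
  ln N`!%:R + N%:R - N%:R * ln N%:R + N%:R * H m
  + Num.sqrt N%:R * (bbar * (\sum_r m r 0 ^+ p) + hbar * m c1 0)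
  - d.+1%:R * (ln N%:R / 2).

(** Logarithm of the unnormalized probability of the counts [nu], up to a term
    depending on [N] alone: [log_norm] collects the values at [t = m] and the terms in
    [N] of Stirling's formula. *)
Definition log_ratio N nu : R :=
  N%:R * (H (freq N nu) - H m)
  + Num.sqrt N%:R * (bbar * (\sum_r (freq N nu r 0 ^+ p - m r 0 ^+ p))
                     + hbar * (freq N nu c1 0 - m c1 0))
  - \sum_r ((ln (nu r)%:R - ln N%:R) / 2 + stirling_error (nu r)).

Lemma sqrtn_gt0 N : (0 < N)%N -> 0 < Num.sqrt N%:R :> R.
Proof. by move=> N0; rewrite sqrtr_gt0 ltr0n. Qed.

Lemma mulr_inv_sqrtn N : N%:R * (Num.sqrt N%:R)^-1 = Num.sqrt N%:R :> R.
Proof.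
case: N => [|N]; first by rewrite mul0r sqrtr0.
have s0 := @sqrtn_gt0 N.+1 isT.
by rewrite -[X in X * _](@sqr_sqrtr _ N.+1%:R)// expr2 mulfK// gt_eqF.
Qed.

(** Stirling's formula with its error kept exactly, so the identity holds for all
    counts, zero included; the terms [nu r * ln (nu r)] produce the entropy. *)
Lemma count_weightE N nu : (0 < N)%N -> \sum_r nu r = N ->
  N`!%:R / \prod_r (nu r)`!%:R * count_weight N nu =
  expR (log_norm N) * expR (log_ratio N nu).
Proof.
move=> N0 nuN; have N0R : 0 < N%:R :> R by rewrite ltr0n.
have -> : N`!%:R / \prod_r (nu r)`!%:R = expR (ln N`!%:R - \sum_r ln (nu r)`!%:R) :> R.
  rewrite expRB expR_sum lnK ?posrE ?ltr0n ?fact_gt0//; congr (_ / _).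
  by apply: eq_bigr => r _; rewrite lnK// posrE ltr0n fact_gt0.
rewrite /count_weight -!expRD; apply: (congr1 expR).
have lnf r : ln (nu r)`!%:R = N%:R * (freq N nu r 0 * ln (freq N nu r 0)) + (nu r)%:R * ln N%:R
    - (nu r)%:R + ln (nu r)%:R / 2 + stirling_error (nu r) :> R.
  rewrite /stirling_error mxE; have [->|nu0] := posnP (nu r).
    by rewrite fact0 ln1 mul0r; ring.
  have nu0R : 0 < (nu r)%:R :> R by rewrite ltr0n.
  by rewrite ln_div ?posrE//; field; rewrite gt_eqF.
have -> : \sum_r ln (nu r)`!%:R = N%:R * (\sum_r freq N nu r 0 * ln (freq N nu r 0))
    + N%:R * ln N%:R - N%:R + \sum_r ln (nu r)%:R / 2 + \sum_r stirling_error (nu r) :> R.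
  rewrite (eq_bigr _ (fun r _ => lnf r)) !big_split /= sumrN.
  have snu : \sum_r (nu r)%:R = N%:R :> R by rewrite -natr_sum nuN.
  have -> : \sum_r (nu r)%:R * ln N%:R = N%:R * ln N%:R :> R by rewrite -mulr_suml snu.
  by rewrite snu -mulr_sumr.
rewrite /log_norm /log_ratio.
have -> : \sum_r ((ln (nu r)%:R - ln N%:R) / 2 + stirling_error (nu r)) =
    \sum_r ln (nu r)%:R / 2 - d.+1%:R * (ln N%:R / 2) + \sum_r stirling_error (nu r) :> R.
  have -> : d.+1%:R * (ln N%:R / 2) = \sum_(r < d.+1) ln N%:R / 2 :> R.
    by rewrite sumr_const card_ord mulr_natl.
  rewrite -sumrB -big_split /=.
  by apply: eq_bigr => r _; rewrite mulrBl.
have -> : \sum_r (freq N nu r 0 ^+ p - m r 0 ^+ p) = \sum_r freq N nu r 0 ^+ p - \sum_r m r 0 ^+ p.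
  by rewrite sumrB.
rewrite [H (freq N nu)]/neg_free_energy.
have -> : (beta + (Num.sqrt N%:R)^-1 * bbar) * N%:R = beta * N%:R + Num.sqrt N%:R * bbar.
  by rewrite -[in RHS]mulr_inv_sqrtn; ring.
have -> : N%:R * (h + (Num.sqrt N%:R)^-1 * hbar) = N%:R * h + Num.sqrt N%:R * hbar.
  by rewrite -[in X in _ = _ + X]mulr_inv_sqrtn; ring.
by ring.
Qed.

End log_weight.

Section log_ratio_bound.
Context {R : realType}.
Variables (p d : nat) (q_gt1 : (1 < d.+1)%N) (beta h bbar hbar : R) (m : 'cV[R]_d.+1).
Local Notation c1 := (color1 q_gt1).
Local Notation H := (neg_free_energy p q_gt1 beta h).
Local Notation Phi := (log_ratio p q_gt1 beta h bbar hbar m).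
Implicit Types (N : nat) (nu : 'I_d.+1 -> nat).

Definition fluctuation N nu : 'cV[R]_d.+1 := Num.sqrt N%:R *: (freq N nu - m).

Lemma fluctuationE N nu r : fluctuation N nu r 0 = Num.sqrt N%:R * (freq N nu r 0 - m r 0).
Proof. by rewrite !mxE. Qed.

Lemma fluctuation_sqr N nu r :
  fluctuation N nu r 0 ^+ 2 = N%:R * (freq N nu r 0 - m r 0) ^+ 2.
Proof. by rewrite fluctuationE exprMn sqr_sqrtr. Qed.

Lemma prob_vectors_freq N nu : (0 < N)%N -> \sum_r nu r = N ->
  @prob_vectors R d.+1 (freq N nu).
Proof.
move=> N0 nuN; split=> [r|]; first by rewrite mxE divr_ge0.
under eq_bigr do rewrite mxE.
by rewrite -mulr_suml -natr_sum nuN divff// pnatr_eq0 -lt0n.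
Qed.

Lemma ln_natr_le (e : R) N : 0 < e -> (0 < N)%N -> ln N%:R <= e * N%:R - ln e.
Proof.
move=> e0 N0; rewrite lerBrDl -lnM ?posrE ?ltr0n//.
by apply/ltW/ln_sublinear; rewrite mulr_gt0 ?ltr0n.
Qed.

Lemma exprn_diff_le (x y : R) n : 0 <= x <= 1 -> 0 <= y <= 1 ->
  `|x ^+ n - y ^+ n| <= n%:R * `|x - y|.
Proof.
move=> /andP[x0 x1] /andP[y0 y1]; rewrite subrXX normrM mulrC ler_wpM2r//.
apply: le_trans (ler_norm_sum _ _ _) _.
rewrite (_ : n%:R = \sum_(i < n) 1); last by rewrite sumr_const card_ord.
apply: ler_sum => i _; rewrite ger0_norm ?mulr_ge0 ?exprn_ge0//.
by rewrite mulr_ile1 ?exprn_ge0 ?exprn_ile1.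
Qed.

Hypothesis m_gt0 : forall r, 0 < m r 0.
Hypothesis m_sum1 : \sum_r m r 0 = 1.
Variable c0 : R.
Hypothesis c0_gt0 : 0 < c0.
Hypothesis gap : forall t, prob_vectors t ->
  H t - H m <= - (c0 * \sum_r (t r 0 - m r 0) ^+ 2).

(** The factor [(nu r) ^ (- 1 / 2)] is singular at the boundary of the simplex, but a
    frequency below [m r 0 / 2] forces a fluctuation of order [sqrt N], whose square
    absorbs [ln N]. *)
Lemma log_count_bound r : exists C : R, forall N nu, (0 < N)%N ->
  - ((ln (nu r)%:R - ln N%:R) / 2) <= c0 / 4 * fluctuation N nu r 0 ^+ 2 + C.
Proof.
have mr := m_gt0 r.
(* For a frequency below [m r 0 / 2], this [e] gives
   [e * N <= c0 / 2 * fluctuation ^+ 2]. *)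
pose e := c0 * m r 0 ^+ 2 / 8.
have e0 : 0 < e by rewrite !mulr_gt0 ?exprn_gt0.
exists (`|ln (m r 0 / 2)| + `|ln e|) => N nu N0.
have N0R : 0 < N%:R :> R by rewrite ltr0n.
have Y0 : 0 <= c0 / 4 * fluctuation N nu r 0 ^+ 2.
  by apply: mulr_ge0; [rewrite divr_ge0 ?ltW|exact: sqr_ge0].
have a0 : 0 <= `|ln (m r 0 / 2)| by [].
have b0 : 0 <= `|ln e| by [].
have [tm|tm] := leP (m r 0 / 2) (freq N nu r 0).
  have m2 : 0 < m r 0 / 2 by rewrite divr_gt0.
  have tp : 0 < freq N nu r 0 :> R by exact: lt_le_trans m2 tm.
  have nu0 : 0 < (nu r)%:R :> R by move: tp; rewrite mxE pmulr_lgt0 ?invr_gt0.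
  have : ln (m r 0 / 2) <= ln (freq N nu r 0) by rewrite ler_ln ?posrE ?divr_gt0.
  rewrite [freq _ _ _ _]mxE [ln (_%:R / _)]ln_div ?posrE//.
  have := ler_norm (- ln (m r 0 / 2)); rewrite normrN.
  move: (ln (m r 0 / 2)) (ln (nu r)%:R) a0 => u w a0; lra.
have lnu : 0 <= ln (nu r)%:R :> R.
  by case: (nu r) => [|n]; [rewrite ln0|rewrite ln_ge0 ?ler1n].
have lN := ln_natr_le e0 N0.
have ll := ler_norm (- ln e); rewrite normrN in ll.
have : e * N%:R <= c0 / 2 * fluctuation N nu r 0 ^+ 2.
  rewrite fluctuation_sqr /e; have : (m r 0 / 2) ^+ 2 <= (freq N nu r 0 - m r 0) ^+ 2.
    have u0 : 0 <= m r 0 / 2 by rewrite divr_ge0 ?ltW.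
    have u1 : m r 0 / 2 <= m r 0 - freq N nu r 0 by move: tm; lra.
    by rewrite -[leRHS]sqrrN opprB ler_pXn2r ?nnegrE ?(le_trans u0 u1).
  move=> sq; rewrite [leLHS](_ : _ = c0 / 2 * (N%:R * (m r 0 / 2) ^+ 2)); last by field.
  by rewrite ler_wpM2l ?divr_ge0 ?(ltW c0_gt0)// ler_wpM2l// ltW.
lra.
Qed.

(** Linear terms in the fluctuation and the logarithms are absorbed by a part of the
    quadratic gap of the free energy. *)
Lemma log_ratio_bound : exists C : R, forall N nu, (0 < N)%N -> \sum_r nu r = N ->
  Phi N nu <= C - c0 / 4 * \sum_r fluctuation N nu r 0 ^+ 2.
Proof.
have [Cr HC] := choice log_count_bound.
pose L := `|bbar| * p%:R + `|hbar|.
have L0 : 0 <= L by rewrite addr_ge0// mulr_ge0.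
exists (\sum_r (Cr r + L ^+ 2 / (2 * c0) + 1)) => N nu N0 nuN.
have tP := prob_vectors_freq N0 nuN; have [t0 t1] := tP.
have sN0 := @sqrtn_gt0 R N N0.
have le1 (t : 'cV[R]_d.+1) r : (forall r, 0 <= t r 0) -> \sum_r t r 0 = 1 -> 0 <= t r 0 <= 1.
  move=> tt0 tt1; rewrite tt0 /= -tt1 (bigD1 r) //= lerDl.
  by apply: sumr_ge0 => i _; exact: tt0.
have tI r := le1 _ r t0 t1.
have mI r := le1 _ r (fun r => ltW (m_gt0 r)) m_sum1.
have h1 : N%:R * (H (freq N nu) - H m) <= - (c0 * \sum_r fluctuation N nu r 0 ^+ 2).
  under [X in _ <= - (c0 * X)]eq_bigr do rewrite fluctuation_sqr.
  rewrite -mulr_sumr mulrCA -mulrN ler_wpM2l//; exact: gap.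
have h2 : Num.sqrt N%:R * (bbar * (\sum_r (freq N nu r 0 ^+ p - m r 0 ^+ p))
            + hbar * (freq N nu c1 0 - m c1 0)) <= \sum_r L * `|fluctuation N nu r 0|.
  apply: le_trans (ler_norm _) _; rewrite normrM (gtr0_norm sN0).
  apply: (@le_trans _ _ (Num.sqrt N%:R * \sum_r L * `|freq N nu r 0 - m r 0|)); last first.
    rewrite mulr_sumr; apply: ler_sum => r _.
    by rewrite fluctuationE normrM (gtr0_norm sN0) mulrCA.
  rewrite ler_pM2l//; apply: le_trans (ler_normD _ _) _.
  have -> : \sum_r L * `|freq N nu r 0 - m r 0| =
      `|bbar| * (p%:R * \sum_r `|freq N nu r 0 - m r 0|) +
      `|hbar| * \sum_r `|freq N nu r 0 - m r 0|.
    by rewrite -mulr_sumr /L; ring.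
  apply: lerD; rewrite normrM ler_wpM2l//.
    rewrite mulr_sumr; apply: le_trans (ler_norm_sum _ _ _) _.
    by apply: ler_sum => r _; exact: exprn_diff_le.
  by rewrite (bigD1 c1) //= lerDl; apply: sumr_ge0.
have h3 : - \sum_r ((ln (nu r)%:R - ln N%:R) / 2 + stirling_error (nu r)) <=
    \sum_r (c0 / 4 * fluctuation N nu r 0 ^+ 2 + Cr r + 1).
  rewrite -sumrN; apply: ler_sum => r _; rewrite opprD lerD//; first exact: HC.
  by have := @stirling_error_normr R (nu r); rewrite ler_norml => /andP[]; lra.
rewrite /log_ratio; apply: le_trans (lerD (lerD h1 h2) h3) _.
rewrite !mulr_sumr -!sumrN -!big_split /=; apply: ler_sum => r _.
set Y := fluctuation N nu r 0.
have YE : Y ^+ 2 = `|Y| ^+ 2 by rewrite real_normK ?num_real.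
(* Young's inequality for the linear term. *)
have : 0 <= (c0 * `|Y| - L) ^+ 2 / (2 * c0).
  by apply: divr_ge0; [exact: sqr_ge0|rewrite mulr_ge0// ltW].
rewrite [X in 0 <= X](_ : _ = c0 / 2 * `|Y| ^+ 2 - L * `|Y| + L ^+ 2 / (2 * c0)); last first.
  by field; rewrite gt_eqF.
rewrite -YE; lra.
Qed.

End log_ratio_bound.

Section log_ratio_limit.
Context {R : realType}.
Variables (p d : nat) (q_gt1 : (1 < d.+1)%N) (beta h bbar hbar : R) (m : 'cV[R]_d.+1).
Local Notation c1 := (color1 q_gt1).
Local Notation H := (neg_free_energy p q_gt1 beta h).
Local Notation Phi := (log_ratio p q_gt1 beta h bbar hbar m).
Local Notation fluc := (fluctuation m).
Variables (a b : R).

Definition quadratic_part (z : 'cV[R]_d.+1) : R :=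
  a * z c1 0 ^+ 2 + b * (\sum_r z r 0 ^+ 2 - z c1 0 ^+ 2).

Definition linear_part (z : 'cV[R]_d.+1) : R :=
  \sum_r (bbar * (p%:R * m r 0 ^+ p.-1)) * z r 0 + hbar * z c1 0.

Hypothesis m_gt0 : forall r, 0 < m r 0.
Hypothesis expansion : forall e : R, 0 < e -> exists2 dl : R, 0 < dl &
  forall t : 'cV[R]_d.+1, \sum_r t r 0 = 1 -> (forall r, `|t r 0 - m r 0| < dl) ->
  `|H t - H m - quadratic_part (t - m) / 2| <= e * \sum_r (t r 0 - m r 0) ^+ 2.
Variable cst : R.
Hypothesis stirling_cst : @stirling_error R n @[n --> \oo] --> cst.

Variables (nu : nat -> 'I_d.+1 -> nat) (y : 'I_d.+1 -> R).
Hypothesis nu_sum : \forall N \near \oo, (\sum_r nu N r)%N = N.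
Hypothesis fluc_cvg : forall r, fluc N (nu N) r 0 @[N --> \oo] --> y r.

Lemma near_nat_gt0 : \forall N \near \oo, (0 < N)%N.
Proof. exact: nbhs_infty_gt. Qed.

Lemma freq_cvg r : freq N (nu N) r 0 @[N --> \oo] --> m r 0.
Proof.
have : m r 0 + (Num.sqrt N%:R)^-1 * fluc N (nu N) r 0 @[N --> \oo] --> m r 0 + 0 * y r.
  apply: cvgD; first exact: cvg_cst.
  by apply: cvgM; [exact: cvg_inv_sqrtn|exact: fluc_cvg].
rewrite mul0r addr0; apply: cvg_trans; apply: near_eq_cvg; near=> N.
have N0 : (0 < N)%N by near: N; exact: near_nat_gt0.
rewrite fluctuationE mulKf ?gt_eqF ?sqrtn_gt0//.
by rewrite addrC subrK.
Unshelve. all: by end_near. Qed.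

Let near_freq r : \forall N \near \oo, (0 : R) < freq N (nu N) r 0.
Proof. by apply: (cvgr_gt (m r 0)); [exact: freq_cvg|exact: m_gt0]. Qed.

Lemma count_cvg_infty r : nu N r @[N --> \oo] --> \oo.
Proof.
apply/cvgnyPge => A.
have m2 : m r 0 / 2 < m r 0 by have := m_gt0 r; lra.
have h1 : \forall N \near \oo, m r 0 / 2 < freq N (nu N) r 0.
  by apply: (cvgr_gt (m r 0)); [exact: freq_cvg|].
near=> N.
have N0 : (0 < N)%N by near: N; exact: near_nat_gt0.
have : m r 0 / 2 < freq N (nu N) r 0 by near: N; exact: h1.
rewrite mxE ltr_pdivlMr ?ltr0n// => lt1.
have : A%:R <= m r 0 / 2 * N%:R.
  rewrite -ler_pdivrMl ?divr_gt0//; near: N; exact: nbhs_infty_ger.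
by move=> /le_lt_trans /(_ lt1); rewrite ltr_nat => /ltnW.
Unshelve. all: by end_near. Qed.

Let sum_sqr_cvg : \sum_r fluc N (nu N) r 0 ^+ 2 @[N --> \oo] --> \sum_r y r ^+ 2.
Proof.
apply: cvg_bigsum => r _.
by apply: (continuous_cvg _ (h := fun x : R => x ^+ 2)); [exact: exprn_continuous|].
Qed.

(** The error of the local expansion is [e] times a squared distance, which becomes
    [e] times a convergent quantity after multiplication by [N]. *)
Lemma entropy_part_cvg : N%:R * (H (freq N (nu N)) - H m) -
  quadratic_part (fluc N (nu N)) / 2 @[N --> \oo] --> (0 : R).
Proof.
apply/cvgr0Pnorm_le => e e0.
pose S := \sum_r y r ^+ 2 + 1.
have S1 : 0 < S by rewrite ltr_wpDl// sumr_ge0// => i _; exact: sqr_ge0.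
have [dl dl0 Hdl] := expansion (divr_gt0 e0 S1).
have close r : \forall N \near \oo, `|freq N (nu N) r 0 - m r 0| < dl.
  have := @freq_cvg r; move/cvgrPdist_lt => /(_ _ dl0).
  by apply: filterS => N; rewrite distrC.
have closeall : \forall N \near \oo, forall r, `|freq N (nu N) r 0 - m r 0| < dl.
  exact: filter_forall.
have bdd : \forall N \near \oo, \sum_r fluc N (nu N) r 0 ^+ 2 < S.
  by apply: (cvgr_lt (\sum_r y r ^+ 2)); [exact: sum_sqr_cvg|rewrite ltrDl].
near=> N.
have N0 : (0 < N)%N by near: N; exact: near_nat_gt0.
have nuN : (\sum_r nu N r)%N = N by near: N; exact: nu_sum.
have [_ t1] := @prob_vectors_freq R d N (nu N) N0 nuN.
have : `|H (freq N (nu N)) - H m - quadratic_part (freq N (nu N) - m) / 2| <=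
    e / S * \sum_r (freq N (nu N) r 0 - m r 0) ^+ 2.
  by apply: Hdl => //; near: N; exact: closeall.
have N0R : 0 <= N%:R :> R by [].
move=> /(ler_wpM2l N0R); rewrite -[X in X * `|_|]ger0_norm// -normrM => le1.
have qE : quadratic_part (fluc N (nu N)) = N%:R * quadratic_part (freq N (nu N) - m).
  have dE r : (freq N (nu N) - m) r 0 = freq N (nu N) r 0 - m r 0.
    by rewrite [LHS]mxE [(- m) r 0]mxE.
  rewrite /quadratic_part !fluctuation_sqr dE.
  have -> : \sum_r fluc N (nu N) r 0 ^+ 2 =
      N%:R * \sum_r (freq N (nu N) - m) r 0 ^+ 2.
    by rewrite mulr_sumr; apply: eq_bigr => r _; rewrite fluctuation_sqr dE.
  by ring.
have sE : N%:R * \sum_r (freq N (nu N) r 0 - m r 0) ^+ 2 = \sum_r fluc N (nu N) r 0 ^+ 2.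
  by rewrite mulr_sumr; apply: eq_bigr => r _; rewrite fluctuation_sqr.
rewrite qE [X in `|X|](_ : _ = N%:R * (H (freq N (nu N)) - H m -
    quadratic_part (freq N (nu N) - m) / 2)); last by ring.
apply: le_trans le1 _; rewrite mulrCA sE mulrAC ler_pdivrMr// ler_pM2l//.
by apply/ltW; near: N; exact: bdd.
Unshelve. all: by end_near. Qed.

Lemma power_part_cvg r :
  Num.sqrt N%:R * (freq N (nu N) r 0 ^+ p - m r 0 ^+ p) -
  p%:R * m r 0 ^+ p.-1 * fluc N (nu N) r 0 @[N --> \oo] --> (0 : R).
Proof.
pose G (t : R) := \sum_(i < p) t ^+ (p.-1 - i) * m r 0 ^+ i.
have GE : G (m r 0) = p%:R * m r 0 ^+ p.-1.
  rewrite /G (eq_bigr (fun=> m r 0 ^+ p.-1)) => [|i _].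
    by rewrite sumr_const card_ord mulr_natl.
  have p0 : (0 < p)%N by exact: leq_ltn_trans (ltn_ord i).
  by rewrite -exprD subnK// -ltnS prednK.
have Gc : G (freq N (nu N) r 0) @[N --> \oo] --> G (m r 0).
  apply: cvg_bigsum => i _; apply: cvgM; last exact: cvg_cst.
  apply: (continuous_cvg _ (h := fun x : R => x ^+ (p.-1 - i))).
    exact: exprn_continuous.
  exact: freq_cvg.
have : fluc N (nu N) r 0 * (G (freq N (nu N) r 0) - G (m r 0)) @[N --> \oo] -->
    y r * (G (m r 0) - G (m r 0)).
  by apply: cvgM; [exact: fluc_cvg|apply: cvgB; [exact: Gc|exact: cvg_cst]].
rewrite subrr mulr0; apply: cvg_trans; apply: near_eq_cvg; near=> N.
rewrite GE subrXX fluctuationE -/(G (freq N (nu N) r 0)).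
by ring.
Unshelve. all: by end_near. Qed.

Lemma log_part_cvg r : (ln (nu N r)%:R - ln N%:R) / 2 + stirling_error (nu N r)
  @[N --> \oo] --> ln (m r 0) / 2 + cst.
Proof.
apply: cvgD; last exact: cvg_comp (@count_cvg_infty r) stirling_cst.
apply: cvgM; last exact: cvg_cst.
have : ln (freq N (nu N) r 0) @[N --> \oo] --> ln (m r 0).
  by apply: continuous_cvg; [exact: continuous_ln|exact: freq_cvg].
apply: cvg_trans; apply: near_eq_cvg; near=> N.
have N0 : (0 < N)%N by near: N; exact: near_nat_gt0.
have f0 : (0 : R) < freq N (nu N) r 0 by near: N; exact: near_freq.
rewrite mxE ln_div ?posrE ?ltr0n//.
by move: f0; rewrite mxE pmulr_lgt0 ?invr_gt0 ?ltr0n.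
Unshelve. all: by end_near. Qed.

(** The fluctuations have order 1, so only the second-order term of the free energy,
    the first-order term of the perturbation by [bbar] and [hbar], and the values at
    [m] of the square-root factors of Stirling's formula survive. *)
Lemma log_ratio_cvg :
  Phi N (nu N) - (quadratic_part (fluc N (nu N)) / 2 + linear_part (fluc N (nu N)))
  @[N --> \oo] --> - \sum_r (ln (m r 0) / 2 + cst).
Proof.
have c1P := entropy_part_cvg.
have c2P : bbar * \sum_r (Num.sqrt N%:R * (freq N (nu N) r 0 ^+ p - m r 0 ^+ p) -
    p%:R * m r 0 ^+ p.-1 * fluc N (nu N) r 0) @[N --> \oo] -->
    bbar * \sum_(r < d.+1) (0 : R).
  apply: cvgM; first exact: cvg_cst.
  by apply: cvg_bigsum => r _; exact: power_part_cvg.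
have c3P : \sum_r ((ln (nu N r)%:R - ln N%:R) / 2 + stirling_error (nu N r))
    @[N --> \oo] --> \sum_r (ln (m r 0) / 2 + cst).
  by apply: cvg_bigsum => r _; exact: log_part_cvg.
rewrite big1_eq mulr0 in c2P.
rewrite -[X in _ --> X]add0r -[X in _ --> X + _]addr0.
apply: cvg_trans (cvgB (cvgD c1P c2P) c3P); apply: near_eq_cvg; near=> N.
have e1 : \sum_r (Num.sqrt N%:R * (freq N (nu N) r 0 ^+ p - m r 0 ^+ p) -
      p%:R * m r 0 ^+ p.-1 * fluc N (nu N) r 0) =
    Num.sqrt N%:R * \sum_r (freq N (nu N) r 0 ^+ p - m r 0 ^+ p) -
    \sum_r p%:R * m r 0 ^+ p.-1 * fluc N (nu N) r 0.
  by rewrite sumrB mulr_sumr.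
have e2 : \sum_r bbar * (p%:R * m r 0 ^+ p.-1) * fluc N (nu N) r 0 =
    bbar * \sum_r p%:R * m r 0 ^+ p.-1 * fluc N (nu N) r 0.
  by rewrite mulr_sumr; apply: eq_bigr => r _; ring.
have e3 := fluctuationE m N (nu N) c1.
transitivity (N%:R * (H (freq N (nu N)) - H m) - quadratic_part (fluc N (nu N)) / 2 +
  bbar * \sum_r (Num.sqrt N%:R * (freq N (nu N) r 0 ^+ p - m r 0 ^+ p) -
    p%:R * m r 0 ^+ p.-1 * fluc N (nu N) r 0) -
  \sum_r ((ln (nu N r)%:R - ln N%:R) / 2 + stirling_error (nu N r))) => //.
by rewrite e1 /log_ratio /linear_part e2 e3; ring.
Unshelve. all: by end_near. Qed.

End log_ratio_limit.

(** * Rescaled weights in Helmert coordinates *)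

Section centred_counts.
Context {R : realType}.
Variables (p d : nat) (d_gt0 : (0 < d)%N) (q_gt1 : (1 < d.+1)%N) (a b bbar hbar : R).
Variable m : 'cV[R]_d.+1.
Hypotheses (ab_lt0 : d%:R * a + b < 0) (b_lt0 : (1 < d)%N -> b < 0).
Local Notation c1 := (color1 q_gt1).
Implicit Types (N : nat) (n : nat -> nat).

(** Gradient at [m] of the perturbation by [bbar] and [hbar]. *)
Definition tilt : 'cV[R]_d.+1 := (bbar * p%:R) *: vpow m p.-1 + hbar *: basis_vec c1.

Definition limit_mean : 'cV[R]_d.+1 := helmert_cov q_gt1 a b *m tilt.

Definition centred N n j : R :=
  (n j)%:R / Num.sqrt N%:R - (Num.sqrt N%:R * m (inord j) 0 + limit_mean (inord j) 0).

Definition walk_coord N n k : R := helmert_coord d (centred N n) k.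

(** The Helmert coordinate of index [k] runs over a grid whose offset depends on the
    earlier counts only ([walk_coord_upd_same]). *)
Definition walk_offset N n k : R :=
  Num.sqrt N%:R * m (inord k) 0 + limit_mean (inord k) 0
  - (\sum_(i < k) centred N n i) / (d.+1 - k)%:R.

Lemma centred_upd_lt N n k l i : (i < k)%N -> centred N (upd n k l) i = centred N n i.
Proof. by move=> ik; rewrite /centred upd_lt. Qed.

Lemma walk_coord_upd_lt N n k l i : (i < k)%N ->
  walk_coord N (upd n k l) i = walk_coord N n i.
Proof.
move=> ik; rewrite /walk_coord /helmert_coord centred_upd_lt//; congr (_ + _ / _).
by apply: eq_bigr => j _; rewrite centred_upd_lt// (ltn_trans (ltn_ord j)).
Qed.

Lemma walk_coord_upd_same N n k l :
  walk_coord N (upd n k l) k = grid N (walk_offset N n k) l.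
Proof.
rewrite /walk_coord /helmert_coord /grid /walk_offset.
rewrite (eq_bigr (fun i : 'I_k => centred N n i)) => [|i _]; last by rewrite centred_upd_lt.
by rewrite {1}/centred upd_same; ring.
Qed.

(** The Helmert change of coordinates is triangular, so convergence passes back to the
    counts one index at a time. *)
Lemma centred_cvg (n : nat -> nat -> nat) (x : nat -> R) k :
  (forall i, (i < k)%N -> walk_coord N (n N) i @[N --> \oo] --> x i) ->
  exists z : nat -> R, forall i, (i < k)%N -> centred N (n N) i @[N --> \oo] --> z i.
Proof.
elim: k => [|k IHk] xk; first by exists (fun=> 0).
have [|z zP] := IHk; first by move=> i ik; apply: xk; exact: ltnW.
exists (upd z k (x k - (\sum_(i < k) z i) / (d.+1 - k)%:R)) => i.
rewrite ltnS leq_eqVlt => /predU1P[->|ik]; last by rewrite upd_lt//; exact: zP.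
rewrite upd_same.
have : walk_coord N (n N) k - (\sum_(j < k) centred N (n N) j) / (d.+1 - k)%:R
    @[N --> \oo] --> x k - (\sum_(i < k) z i) / (d.+1 - k)%:R.
  apply: cvgB; first exact: xk.
  apply: cvgM; last exact: cvg_cst.
  by apply: cvg_bigsum => j _; exact: zP.
apply: cvg_trans; apply: near_eq_cvg; apply: nearW => N.
by rewrite /walk_coord /helmert_coord addrK.
Qed.

Hypothesis m_gt0 : forall r, 0 < m r 0.

Lemma walk_offset_large (n : nat -> nat -> nat) (x : nat -> R) k : (k < d)%N ->
  (forall i, (i < k)%N -> walk_coord N (n N) i @[N --> \oo] --> x i) ->
  forall y, \forall N \near \oo, 0 <= y + walk_offset N (n N) k.
Proof.
move=> _ xk y; have [z zP] := centred_cvg xk.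
pose S N := (\sum_(i < k) centred N (n N) i) / (d.+1 - k)%:R.
pose L := (\sum_(i < k) z i) / (d.+1 - k)%:R.
have SL : S N @[N --> \oo] --> L.
  apply: cvgM; last exact: cvg_cst.
  by apply: cvg_bigsum => j _; exact: zP.
have S1 : \forall N \near \oo, S N < L + 1 by apply: (cvgr_lt L); [|rewrite ltrDl].
set mk := m (inord k) 0; have mk0 : 0 < mk by exact: m_gt0.
set e := limit_mean (inord k) 0.
pose B := Num.max 0 ((L + 1 - y - e) / mk).
near=> N.
have h1 : S N < L + 1 by near: N; exact: S1.
have h2 : B <= Num.sqrt N%:R.
  have B0 : 0 <= B by rewrite le_max lexx.
  rewrite -[B]ger0_norm// -sqrtr_sqr ler_wsqrtr//; near: N; exact: nbhs_infty_ger.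
have : (L + 1 - y - e) / mk <= Num.sqrt N%:R by apply: le_trans h2; rewrite le_max lexx orbT.
rewrite ler_pdivrMr// => h3; rewrite /walk_offset -/(S N) -/mk -/e.
move: h1 h3; move: (Num.sqrt _ * mk) (S N) => u v; lra.
Unshelve. all: by end_near. Qed.

Hypothesis m_sum1 : \sum_r m r 0 = 1.

Section completed_word.
Variables (N : nat) (n : nat -> nat).
Hypotheses (N_gt0 : (0 < N)%N) (nN : (\sum_(j < d) n j <= N)%N).
Let nu : 'I_d.+1 -> nat := complete_counts N n.
Let w := fluctuation m N nu - limit_mean.

Let wE r : w r 0 = fluctuation m N nu r 0 - limit_mean r 0.
Proof. by rewrite /w; move: (fluctuation _ _ _) limit_mean => A B; rewrite !mxE. Qed.

Lemma sum_centred_fluctuation : \sum_r w r 0 = 0.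
Proof.
have [_ f1] := @prob_vectors_freq R d N nu N_gt0 (sum_complete_counts nN).
under eq_bigr do rewrite wE fluctuationE.
by rewrite sumrB helmert_cov_mul_sum0 -mulr_sumr sumrB f1 m_sum1 subrr mulr0 subr0.
Qed.

Let z k := w (inord k) 0.

Let sum_z (f : R -> R) : \sum_(i < d.+1) f (z i) = \sum_r f (w r 0).
Proof. by apply: eq_bigr => i _; rewrite /z inord_val. Qed.

Let z_centred j : (j < d)%N -> z j = centred N n j.
Proof.
move=> jd; have jd1 : (j < d.+1)%N by exact: ltnW.
rewrite /z wE fluctuationE mxE /nu /complete_counts inordK// jd /centred.
rewrite -[in N%:R^-1](@sqr_sqrtr _ N%:R)//.
by field; rewrite gt_eqF ?sqrtn_gt0.
Qed.

Let coord_z k : (k < d)%N -> helmert_coord d z k = walk_coord N n k.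
Proof.
move=> kd; rewrite /walk_coord /helmert_coord z_centred//; congr (_ + _ / _).
by apply: eq_bigr => j _; rewrite z_centred// (ltn_trans (ltn_ord j)).
Qed.

Let z0 : \sum_(i < d.+1) z i = 0. Proof. by rewrite (sum_z id) sum_centred_fluctuation. Qed.

Lemma fluctuation_walk :
  fluctuation m N nu = limit_mean + \sum_(k < d) walk_coord N n k *: @helmert_vec R d k.
Proof.
rewrite -[LHS](subrK limit_mean) -/w addrC; congr (_ + _).
apply/matrixP => r c; rewrite [c]ord1.
have -> : w r 0 = z r by rewrite /z inord_val.
rewrite (helmert_expansion r z0); congr (fun_of_matrix _ _ _).
by apply: eq_bigr => k _; rewrite coord_z.
Qed.

Lemma sum_walk_coord_sqr : \sum_(k < d) walk_coord N n k ^+ 2 <=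
  2 * \sum_r fluctuation m N nu r 0 ^+ 2 + 2 * \sum_r limit_mean r 0 ^+ 2.
Proof.
have := sum_helmert_coord_sqr z0; rewrite (sum_z (fun x => x ^+ 2)).
rewrite (eq_bigr (fun k : 'I_d => walk_coord N n k ^+ 2)) => [|k _]; last by rewrite coord_z.
move=> /le_trans; apply; rewrite !mulr_sumr -big_split /=; apply: ler_sum => r _.
rewrite wE -subr_ge0 (_ : _ - _ = (fluctuation m N nu r 0 + limit_mean r 0) ^+ 2); last by ring.
exact: sqr_ge0.
Qed.

Let quadraticE t : quadratic_part q_gt1 a b t =
  \sum_i (if i == c1 then a else b) * t i 0 ^+ 2.
Proof.
rewrite /quadratic_part [in LHS](bigD1 c1) //= [RHS](bigD1 c1) //= ?eqxx [X in b * X]addrAC subrr add0r.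
congr (_ + _); rewrite mulr_sumr; apply: eq_bigr => i ic; by rewrite (negbTE ic).
Qed.

Let linearE t : linear_part p q_gt1 bbar hbar m t = \sum_i tilt i 0 * t i 0.
Proof.
have tE i : tilt i 0 = bbar * (p%:R * m i 0 ^+ p.-1) + hbar * (i == c1)%:R.
  by rewrite /tilt !mxE mulrA.
rewrite /linear_part; under [RHS]eq_bigr do rewrite tE mulrDl.
rewrite big_split /=; congr (_ + _); rewrite [RHS](bigD1 c1)//= ?eqxx mulr1 big1 ?addr0// => i ic.
by rewrite (negbTE ic) mulr0 mul0r.
Qed.

(** [limit_mean] is the critical point of [quadratic_part / 2 + linear_part] among
    zero-sum vectors, so the cross terms vanish; the remaining square is diagonal in
    Helmert coordinates. *)
Lemma completed_square :
  quadratic_part q_gt1 a b (fluctuation m N nu) / 2 +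
    linear_part p q_gt1 bbar hbar m (fluctuation m N nu) =
  quadratic_part q_gt1 a b limit_mean / 2 + linear_part p q_gt1 bbar hbar m limit_mean
  - (\sum_(k < d) walk_coord N n k ^+ 2 / helmert_variance d a b k) / 2.
Proof.
have qw : quadratic_part q_gt1 a b w =
    - \sum_(k < d) walk_coord N n k ^+ 2 / helmert_variance d a b k.
  have := quadratic_form_helmert d_gt0 a b_lt0 z0.
  rewrite (sum_z (fun x => x ^+ 2)).
  have -> : z 0 = w c1 0 by congr (w _ 0); apply: val_inj; rewrite /= inordK.
  rewrite /quadratic_part => ->; congr (- _).
  by apply: eq_bigr => k _; rewrite coord_z.
have := helmert_cov_stationary d_gt0 q_gt1 ab_lt0 b_lt0 tilt sum_centred_fluctuation.
rewrite -/limit_mean => st.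
rewrite -[X in _ - X / 2]opprK -qw !quadraticE !linearE.
have fE i : fluctuation m N nu i 0 = w i 0 + limit_mean i 0 by rewrite wE subrK.
pose c i := if i == c1 then a else b.
have qE : \sum_i c i * fluctuation m N nu i 0 ^+ 2 = \sum_i c i * w i 0 ^+ 2 +
    \sum_i c i * limit_mean i 0 ^+ 2 + 2 * \sum_i c i * limit_mean i 0 * w i 0.
  rewrite mulr_sumr -!big_split /=; apply: eq_bigr => i _; rewrite fE.
  by move: (limit_mean i 0) (w i 0) (c i) => e f t; ring.
have lE : \sum_i tilt i 0 * fluctuation m N nu i 0 =
    \sum_i tilt i 0 * w i 0 + \sum_i tilt i 0 * limit_mean i 0.
  by rewrite -big_split /=; apply: eq_bigr => i _; rewrite fE mulrDr.
have {}st : \sum_i c i * limit_mean i 0 * w i 0 + \sum_i tilt i 0 * w i 0 = 0.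
  by rewrite -[RHS]st -big_split /=; apply: eq_bigr => i _; rewrite mulrDl.
rewrite qE lE; move: st; move: (\sum_i _) (\sum_i _) (\sum_i _) (\sum_i _) => A B C D.
lra.
Qed.

End completed_word.
End centred_counts.

Section rescaled_weights.
Context {R : realType}.
Variables (p d : nat) (d_gt0 : (0 < d)%N) (q_gt1 : (1 < d.+1)%N).
Variables (beta h bbar hbar a b : R) (m : 'cV[R]_d.+1).
Hypotheses (ab_lt0 : d%:R * a + b < 0) (b_lt0 : (1 < d)%N -> b < 0).
Hypothesis m_gt0 : forall r, 0 < m r 0.
Hypothesis m_sum1 : \sum_r m r 0 = 1.
Local Notation c1 := (color1 q_gt1).
Local Notation H := (neg_free_energy p q_gt1 beta h).
Local Notation mu := (limit_mean p q_gt1 a b bbar hbar m).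
Local Notation coord := (walk_coord p q_gt1 a b bbar hbar m).
Local Notation Phi := (log_ratio p q_gt1 beta h bbar hbar m).
Implicit Types (N : nat) (n : nat -> nat) (g : 'cV[R]_d.+1 -> R).

(** Extended by zero outside of the simplex, like [multinomial]. *)
Definition rescaled_weight g N n : R :=
  if (\sum_(j < d) n j <= N)%N then
    expR (Phi N (complete_counts N n)) * g (fluctuation m N (complete_counts N n))
  else 0.

Lemma rescaled_weight_out g N n : (exists2 k, (k < d)%N & (N < n k)%N) ->
  rescaled_weight g N n = 0.
Proof.
move=> [k kd Nk]; rewrite /rescaled_weight ifF//; apply/negbTE; rewrite -ltnNge.
by apply: leq_trans Nk _; rewrite (bigD1 (Ordinal kd))//= leq_addr.
Qed.

(** Half of the decay [c0 / 4] of [log_ratio_bound] is spent on replacing the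
    fluctuation by its centred version, which the Helmert coordinates require. *)
Lemma rescaled_weight_bound g (M c0 : R) : 0 < c0 ->
  (forall t, prob_vectors t -> H t - H m <= - (c0 * \sum_r (t r 0 - m r 0) ^+ 2)) ->
  (forall y, `|g y| <= M) ->
  exists2 C, 0 <= C & forall N n, (0 < N)%N ->
    `|rescaled_weight g N n| <= C * \prod_(i < d) gauss_kernel (c0 / 8) (coord N n i).
Proof.
move=> c0_gt0 gap gM.
have [C1 HC1] := log_ratio_bound bbar hbar m_gt0 m_sum1 c0_gt0 gap.
have M_ge0 : 0 <= M by exact: le_trans (gM 0).
pose C := expR (C1 + c0 / 4 * \sum_r mu r 0 ^+ 2) * M.
have C_ge0 : 0 <= C by rewrite mulr_ge0// expR_ge0.
exists C => // N n N0; rewrite /rescaled_weight; case: ifP => [nN|_]; last first.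
  by rewrite normr0 mulr_ge0// prodr_ge0// => i _; exact: gauss_kernel_ge0.
rewrite normrM (ger0_norm (expR_ge0 _)) /C mulrAC; apply: ler_pM => //.
rewrite -expR_sum -expRD ler_expR.
apply: le_trans (HC1 _ _ N0 (sum_complete_counts nN)) _.
have := sum_walk_coord_sqr p q_gt1 a b bbar hbar m_sum1 N0 nN.
rewrite -mulr_sumr.
set X := \sum_(k < d) _; move: X (\sum_r _) (\sum_r _) => X T S XST.
have : c0 / 8 * X <= c0 / 8 * (2 * S + 2 * T) by rewrite ler_pM2l// divr_gt0.
lra.
Qed.

Hypothesis expansion : forall e : R, 0 < e -> exists2 dl : R, 0 < dl &
  forall t : 'cV[R]_d.+1, \sum_r t r 0 = 1 -> (forall r, `|t r 0 - m r 0| < dl) ->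
  `|H t - H m - quadratic_part q_gt1 a b (t - m) / 2| <= e * \sum_r (t r 0 - m r 0) ^+ 2.
Variable cst : R.
Hypothesis stirling_cst : @stirling_error R n @[n --> \oo] --> cst.

Definition weight_limit : R :=
  expR (- (\sum_r (ln (m r 0) / 2 + cst)) +
    (quadratic_part q_gt1 a b mu / 2 + linear_part p q_gt1 bbar hbar m mu)).

(** The last color keeps a positive frequency in the limit, so the other counts
    eventually leave room for it. *)
Lemma counts_near_simplex (n : nat -> nat -> nat) (x : nat -> R) :
  (forall i, (i < d)%N -> coord N (n N) i @[N --> \oo] --> x i) ->
  \forall N \near \oo, (\sum_(j < d) n N j <= N)%N.
Proof.
move=> xP; have [z zP] := centred_cvg xP.
have fP (j : 'I_d) : (n N j)%:R / N%:R @[N --> \oo] --> m (inord j) 0.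
  have : m (inord j) 0 + (Num.sqrt N%:R)^-1 *
      (centred p q_gt1 a b bbar hbar m N (n N) j + mu (inord j) 0) @[N --> \oo] -->
      m (inord j) 0 + 0 * (z j + mu (inord j) 0).
    apply: cvgD; first exact: cvg_cst.
    apply: cvgM; first exact: cvg_inv_sqrtn.
    by apply: cvgD; [exact: zP|exact: cvg_cst].
  rewrite mul0r addr0; apply: cvg_trans; apply: near_eq_cvg; near=> N.
  have N0 : (0 < N)%N by near: N; exact: near_nat_gt0.
  rewrite /centred -[in RHS](@sqr_sqrtr _ N%:R)//.
  by field; rewrite gt_eqF ?sqrtn_gt0.
have SP : \sum_(j < d) (n N j)%:R / N%:R @[N --> \oo] --> \sum_(j < d) m (inord j) 0.
  by apply: cvg_bigsum => j _; exact: fP.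
have lt1 : \sum_(j < d) m (inord j) 0 < 1.
  rewrite -m_sum1 big_ord_recr /= ltr_pwDr//.
  rewrite le_eqVlt; apply/orP; left; apply/eqP; apply: eq_bigr => j _; congr (m _ 0).
  by apply: val_inj; rewrite /= inordK// ltnS ltnW.
have near1 : \forall N \near \oo, \sum_(j < d) (n N j)%:R / N%:R < (1 : R).
  by apply: (cvgr_lt (\sum_(j < d) m (inord j) 0)); [exact: SP|].
near=> N.
have N0 : (0 < N)%N by near: N; exact: near_nat_gt0.
have : \sum_(j < d) (n N j)%:R / N%:R < (1 : R) by near: N; exact: near1.
by rewrite -mulr_suml ltr_pdivrMr ?ltr0n// mul1r -natr_sum ltr_nat => /ltnW.
Unshelve. all: by end_near. Qed.

Lemma rescaled_weight_cvg g (n : nat -> nat -> nat) (x : nat -> R) : continuous g ->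
  (forall i, (i < d)%N -> coord N (n N) i @[N --> \oo] --> x i) ->
  rescaled_weight g N (n N) @[N --> \oo] --> weight_limit *
    (\prod_(i < d) normal_fun 0 (Num.sqrt (helmert_variance d a b i)) (x i) *
     g (mu + \sum_(i < d) x i *: @helmert_vec R d i)).
Proof.
move=> gc xP; have nN := counts_near_simplex xP.
set y := mu + \sum_(i < d) _.
pose nu N : 'I_d.+1 -> nat := complete_counts N (n N).
have fluc_cvg : fluctuation m N (nu N) @[N --> \oo] --> y.
  have : mu + \sum_(i < d) coord N (n N) i *: @helmert_vec R d i @[N --> \oo] --> y.
    apply: cvgD; first exact: cvg_cst.
    by apply: cvg_bigsum => i _; apply: cvgZ; [exact: xP|exact: cvg_cst].
  apply: cvg_trans; apply: near_eq_cvg; near=> N.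
  have N0 : (0 < N)%N by near: N; exact: near_nat_gt0.
  by rewrite (fluctuation_walk p q_gt1 a b bbar hbar m_sum1 N0)//; near: N.
have nu_sum : \forall N \near \oo, (\sum_r nu N r)%N = N.
  by apply: filterS nN => N; exact: sum_complete_counts.
have coord_fluc r : fluctuation m N (nu N) r 0 @[N --> \oo] --> y r 0.
  apply: (continuous_cvg _ (h := fun w : 'cV[R]_d.+1 => w r 0)); last exact: fluc_cvg.
  exact: coord_continuous.
have Phi_cvg := log_ratio_cvg bbar hbar m_gt0 expansion stirling_cst nu_sum coord_fluc.
pose kappa := quadratic_part q_gt1 a b mu / 2 + linear_part p q_gt1 bbar hbar m mu.
have quad_cvg : (\sum_(k < d) coord N (n N) k ^+ 2 / helmert_variance d a b k) / 2
    @[N --> \oo] --> (\sum_(k < d) x k ^+ 2 / helmert_variance d a b k) / 2.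
  apply: cvgM; last exact: cvg_cst.
  apply: cvg_bigsum => k _; apply: cvgM; last exact: cvg_cst.
  by apply: (continuous_cvg _ (h := fun x : R => x ^+ 2)); [exact: exprn_continuous|exact: xP].
have logP : Phi N (nu N) @[N --> \oo] --> - (\sum_r (ln (m r 0) / 2 + cst)) +
    (kappa - (\sum_(k < d) x k ^+ 2 / helmert_variance d a b k) / 2).
  apply: cvg_trans (cvgD Phi_cvg (cvgB (cvg_cst kappa) quad_cvg)).
  apply: near_eq_cvg; near=> N.
  have N0 : (0 < N)%N by near: N; exact: near_nat_gt0.
  have nNN : (\sum_(j < d) n N j <= N)%N by near: N.
  have := completed_square p d_gt0 q_gt1 bbar hbar ab_lt0 b_lt0 m_sum1 N0 nNN.
  rewrite -/(nu N) -/kappa => E.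
  transitivity (Phi N (nu N) - (quadratic_part q_gt1 a b (fluctuation m N (nu N)) / 2 +
    linear_part p q_gt1 bbar hbar m (fluctuation m N (nu N))) + (kappa -
      (\sum_(k < d) coord N (n N) k ^+ 2 / helmert_variance d a b k) / 2)) => //.
  by rewrite -E subrK.
have expP : expR (Phi N (nu N)) @[N --> \oo] -->
    expR (- (\sum_r (ln (m r 0) / 2 + cst)) + (kappa -
      (\sum_(k < d) x k ^+ 2 / helmert_variance d a b k) / 2)).
  by apply: continuous_cvg logP; exact: continuous_expR.
set l := (X in _ --> X).
have -> : l = expR (- (\sum_r (ln (m r 0) / 2 + cst)) + (kappa -
      (\sum_(k < d) x k ^+ 2 / helmert_variance d a b k) / 2)) * g y.
  rewrite /l mulrA; congr (_ * _); rewrite addrA expRD -/weight_limit; congr (_ * _).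
  rewrite mulr_suml -sumrN expR_sum; apply: eq_bigr => k _.
  rewrite /normal_fun subr0 sqr_sqrtr ?ltW ?helmert_variance_gt0//; congr expR.
  have := helmert_variance_gt0 d_gt0 ab_lt0 b_lt0 k.
  by move: (helmert_variance d a b k) (x k) => v t v0; field; rewrite gt_eqF.
have gP : g (fluctuation m N (nu N)) @[N --> \oo] --> g y.
  by apply: continuous_cvg; [exact: gc|exact: fluc_cvg].
apply: cvg_trans (cvgM expP gP); apply: near_eq_cvg; near=> N.
have nNN : (\sum_(j < d) n N j <= N)%N by near: N.
by rewrite /rescaled_weight nNN.
Unshelve. all: by end_near. Qed.

End rescaled_weights.

(** * Central limit theorem *)

Section potts_sums.
Context {R : realType}.
Variables (p d : nat) (q_gt1 : (1 < d.+1)%N) (beta h bbar hbar : R) (m : 'cV[R]_d.+1).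
Implicit Types (N : nat) (g : 'cV[R]_d.+1 -> R).

Lemma magnetizationE N (X : {ffun 'I_N -> 'I_d.+1}) :
  magnetization X = freq N (letter_count X) :> 'cV[R]_d.+1.
Proof.
apply/matrixP => r c; rewrite !mxE; congr (_%:R / _).
by rewrite /letter_count -sum1_card big_mkcond; apply: eq_bigr => i _; rewrite inE; case: eqP.
Qed.

Definition weighted_sum g N : R :=
  \sum_(X : {ffun 'I_N -> 'I_d.+1})
    potts_weight p q_gt1 (beta + (Num.sqrt N%:R)^-1 * bbar)
      (h + (Num.sqrt N%:R)^-1 * hbar) X * g (Num.sqrt N%:R *: (magnetization X - m)).

Lemma potts_expectationE g N :
  potts_expectation p q_gt1 (beta + (Num.sqrt N%:R)^-1 * bbar)
    (h + (Num.sqrt N%:R)^-1 * hbar)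
    (fun X : {ffun 'I_N -> 'I_d.+1} => g (Num.sqrt N%:R *: (magnetization X - m))) =
  weighted_sum g N / weighted_sum (fun=> 1) N.
Proof.
rewrite /potts_expectation /potts_pmf /weighted_sum.
under [X in _ = _ / X]eq_bigr do rewrite mulr1.
by rewrite [RHS]mulr_suml; apply: eq_bigr => X _; rewrite mulrAC.
Qed.

Lemma weighted_sumE g N n0 : (0 < N)%N ->
  weighted_sum g N = expR (log_norm p q_gt1 beta h bbar hbar m N) * Num.sqrt N%:R ^+ d *
    iter_sum (Num.sqrt N%:R)^-1 N d d (rescaled_weight p q_gt1 beta h bbar hbar m g N) n0.
Proof.
move=> N0; pose G (nu : 'I_d.+1 -> nat) :=
  count_weight p q_gt1 beta h bbar hbar N nu * g (fluctuation m N nu).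
transitivity (\sum_(X : {ffun 'I_N -> 'I_d.+1}) G (letter_count X)).
  by apply: eq_bigr => X _; rewrite /potts_weight magnetizationE.
rewrite (sum_words _ _ n0) (@eq_iter_sum _ _ _ _ _ _ (fun n =>
  expR (log_norm p q_gt1 beta h bbar hbar m N) *
  rescaled_weight p q_gt1 beta h bbar hbar m g N n)) => [|n].
  rewrite iter_sum_mulr [in RHS]iter_sumZ -[in RHS]mulrA; congr (_ * _).
  by rewrite mulrA -exprMn divff ?expr1n ?mul1r// gt_eqF ?sqrtn_gt0.
rewrite /multinomial /rescaled_weight /G; case: ifP => [nN|_]; last by rewrite mul0r mulr0.
by rewrite mulrA (@count_weightE _ _ _ _ _ _ _ _ m)// ?mulrA//; exact: sum_complete_counts.
Qed.

End potts_sums.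

Section central_limit_theorem.
Context {R : realType}.
Variables (p d : nat) (p_gt1 : (1 < p)%N) (q_gt1 : (1 < d.+1)%N) (beta h : R).
Hypothesis reg : regular p q_gt1 beta h.
Variable s : R.
Hypotheses (s_ge0 : 0 <= s) (s_lt1 : s < 1).
Hypothesis max_s : unique_maximizer p q_gt1 beta h (xvec q_gt1 s).
Variables (bbar hbar : R).
Local Notation m := (xvec q_gt1 s).
Local Notation a := (k_der2 p beta (first_coord d s)).
Local Notation b := (k_der2 p beta (other_coord d s)).
Local Notation mu := (limit_mean p q_gt1 a b bbar hbar m).

Let d_gt0 : (0 < d)%N. Proof. by rewrite -ltnS. Qed.

Let s_gt : - d%:R^-1 < s.
Proof. by apply: lt_le_trans s_ge0; rewrite oppr_lt0 invr_gt0 ltr0n. Qed.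

Lemma potts_cov_helmert : potts_cov p q_gt1 beta h s = helmert_cov q_gt1 a b.
Proof.
have aE : derive1n 2 (k_potts p beta) ((1 + (d.+1%:R - 1) * s) / d.+1%:R) = a.
  exact: (@derive2_k R p beta p_gt1 _ (first_coord_gt0 q_gt1 s_gt)).
have bE : derive1n 2 (k_potts p beta) ((1 - s) / d.+1%:R) = b.
  exact: (@derive2_k R p beta p_gt1 _ (other_coord_gt0 d s_lt1)).
rewrite /potts_cov /rho aE bE (derive2_f_potts p_gt1 q_gt1 beta h s_gt s_lt1).
rewrite /helmert_cov; move: a b => A B.
have dd : d.+1%:R - 1 = d%:R :> R by rewrite -natr1 addrK.
have dd2 : d.+1%:R - 2 = d%:R - 1 :> R by rewrite -dd; ring.
have -> : d.+1%:R ^+ 2 / (d.+1%:R - 1) * (d%:R / d.+1%:R ^+ 2 * (d%:R * A + B)) =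
    d%:R * A + B :> R.
  have : d%:R != 0 :> R by rewrite pnatr_eq0 -lt0n.
  have : d.+1%:R != 0 :> R by rewrite pnatr_eq0.
  by rewrite dd; move: (d%:R) (d.+1%:R) => D D1 d1 d0; field; rewrite d0 d1.
by rewrite dd dd2.
Qed.

Let ab_lt0 : d%:R * a + b < 0 := regular_sum_lt0 max_s reg.
Let b_lt0 : (1 < d)%N -> b < 0 := regular_other_lt0 max_s reg.
Let sigma k := Num.sqrt (helmert_variance d a b k).

Let sigma_gt0 k : 0 < sigma k.
Proof. by rewrite sqrtr_gt0 helmert_variance_gt0. Qed.

Definition potts_limit : probability (borel_vec R d.+1) R :=
  gaussian_walk mu (@helmert_vec R d) sigma d.

Lemma multivariate_normal_potts_limit :
  multivariate_normal mu (helmert_cov q_gt1 a b) potts_limit.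
Proof.
split=> [|u]; first exact: helmert_cov_sym.
rewrite helmert_cov_dot//; split=> [|A mA].
  by apply: sumr_ge0 => k _; rewrite mulr_ge0 ?sqr_ge0// ltW// helmert_variance_gt0.
rewrite (eq_bigr (fun k : 'I_d => sigma k ^+ 2 * ((u^T *m @helmert_vec R d k) 0 0) ^+ 2)).
  exact: gaussian_walk_dot mA.
by move=> k _; rewrite sqr_sqrtr// ltW// helmert_variance_gt0.
Qed.

(** The factor [K] is common to all test functions, so it cancels in the quotient by
    the partition function, which is the case [g = 1]. *)
Lemma weighted_sum_cvg : exists2 K : R, K != 0 &
  forall g, continuous g -> (exists M, forall y, `|g y| <= M) ->
  iter_sum (Num.sqrt N%:R)^-1 N d d
    (rescaled_weight p q_gt1 beta h bbar hbar m g N) (fun=> 0%N) @[N --> \oo] -->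
  K * \int[potts_limit]_y g y.
Proof.
have [c0 c0_gt0 gap] := free_energy_gap p_gt1 s_ge0 s_lt1 max_s reg.
have m_gt0 := xvec_gt0 q_gt1 s_ge0 s_lt1.
have m_sum1 := sum_xvec1 q_gt1 s_ge0 s_lt1.
have [cst stirling_cst] := @stirling_error_cvg R.
have expansion e : 0 < e -> exists2 dl : R, 0 < dl &
  forall t : 'cV[R]_d.+1, \sum_r t r 0 = 1 -> (forall r, `|t r 0 - m r 0| < dl) ->
  `|neg_free_energy p q_gt1 beta h t - neg_free_energy p q_gt1 beta h m -
    quadratic_part q_gt1 a b (t - m) / 2| <= e * \sum_r (t r 0 - m r 0) ^+ 2.
  move=> e0; have [dl dl0 loc] := local_expansion p_gt1 s_ge0 s_lt1 max_s e0.
  exists dl => // t t1 tm; have dE r : (t - m) r 0 = t r 0 - m r 0.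
    by move: m => m'; rewrite !mxE.
  rewrite /quadratic_part dE; under [X in b * (X - _)]eq_bigr do rewrite dE.
  exact: loc.
exists (weight_limit p q_gt1 bbar hbar a b m cst *
  \prod_(0 <= i < d) (normal_peak (sigma i))^-1).
  rewrite mulf_neq0 ?gt_eqF ?expR_gt0//; apply: prodr_gt0 => i _.
  by rewrite invr_gt0 normal_peak_gt0// gt_eqF.
move=> g gc [M gM].
have g_bm : bounded_measurable g.
  by split; [exact: continuous_measurable_borel_vec|exists M].
have [C C0 F_bound] := rescaled_weight_bound bbar hbar a b m_gt0 m_sum1 c0_gt0 gap gM.
have c8 : 0 < c0 / 8 by rewrite divr_gt0.
have := iter_sum_cvg sigma_gt0 (walk_coord_upd_lt p q_gt1 a b bbar hbar m)
  (walk_coord_upd_same p q_gt1 a b bbar hbar m) (walk_offset_large m_gt0) C0 c8 g_bm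
  (@rescaled_weight_out _ _ _ q_gt1 beta h bbar hbar m g) F_bound
  (fun n x => @rescaled_weight_cvg _ _ _ d_gt0 q_gt1 _ _ _ _ _ _ _ ab_lt0 b_lt0 m_gt0 m_sum1
     expansion _ stirling_cst g n x gc) (leqnn d).
(* All [d] indices are summed, so any starting point will do. *)
move=> /(_ (fun=> fun=> 0%N) (fun=> 0)).
rewrite subnn !big_ord0 mul1r addr0 -(Rintegral_gaussian_walk _ _ _ _ g_bm).
by apply.
Qed.

End central_limit_theorem.

Theorem theorem2p4 (R : realType) (p q : nat)
    (p_gt1 : (1 < p)%N) (q_gt1 : (1 < q)%N)
    (beta h : R) (beta_gt0 : 0 < beta) (h_ge0 : 0 <= h)
    (reg : regular p q_gt1 beta h)
    (s : R) (s_ge0 : 0 <= s) (s_lt1 : s < 1)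
    (max_s : unique_maximizer p q_gt1 beta h (xvec q_gt1 s))
    (bbar hbar : R) :
  let m := xvec q_gt1 s in
  let Sigma := potts_cov p q_gt1 beta h s in
  exists P : probability (borel_vec R q) R,
    multivariate_normal
      (Sigma *m ((bbar * p%:R) *: vpow m p.-1
                 + hbar *: basis_vec (color1 q_gt1)))
      Sigma P /\
    cvg_in_distribution
      (fun (N : nat) (g : 'cV[R]_q -> R) =>
         potts_expectation p q_gt1
           (beta + (Num.sqrt N%:R)^-1 * bbar) (h + (Num.sqrt N%:R)^-1 * hbar)
           (fun X : {ffun 'I_N -> 'I_q} =>
              g (Num.sqrt N%:R *: (magnetization X - m))))
      P.
Proof.
case: q q_gt1 reg max_s => // d q_gt1 reg max_s m Sigma.
exists (potts_limit p q_gt1 beta s bbar hbar); split.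
  rewrite /Sigma (potts_cov_helmert p_gt1 q_gt1 beta h s_ge0 s_lt1).
  exact (multivariate_normal_potts_limit reg max_s bbar hbar).
move=> g gc gb.
have [K K0 Kcvg] := weighted_sum_cvg p_gt1 reg s_ge0 s_lt1 max_s bbar hbar.
have gM : exists M, forall y, `|g y| <= M.
  have [M [_ MP]] := gb; exists (M + 1) => y; apply: MP => //; by rewrite ltrDl.
have one_bounded : exists M : R, forall y : 'cV[R]_d.+1, `|(1 : R)| <= M by exists `|1|.
have int1 : \int[potts_limit p q_gt1 beta s bbar hbar]_y (1 : R) = 1.
  rewrite Rintegral_cst//= mul1r.
  by rewrite (@probability_setT _ _ _ (potts_limit p q_gt1 beta s bbar hbar)).
have den := Kcvg _ (@cst_continuous _ _ (1 : R)) one_bounded.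
rewrite int1 mulr1 in den.
have num := Kcvg g gc gM.
suff : weighted_sum p q_gt1 beta h bbar hbar m g N /
    weighted_sum p q_gt1 beta h bbar hbar m (fun=> 1) N @[N --> \oo] -->
    \int[potts_limit p q_gt1 beta s bbar hbar]_y g y.
  by under eq_fun do rewrite -potts_expectationE.
rewrite -[X in _ --> X](mulKf K0) mulrC.
apply: cvg_trans (cvgM num (cvgV K0 den)); apply: near_eq_cvg; near=> N.
have N0 : (0 < N)%N by near: N; exact: near_nat_gt0.
rewrite !(weighted_sumE p q_gt1 beta h bbar hbar m _ (fun=> 0%N) N0).
rewrite -mulf_div divff ?mul1r// mulf_neq0 ?gt_eqF ?expR_gt0//.
by rewrite exprn_gt0// sqrtn_gt0.
Unshelve. all: by end_near. Qed.
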